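(* Let $a,b\in L^\infty$ satisfy $a\neq 0$ a.e. on $\mathbb T$, $b\neq 0$ a.e. on $\mathbb T$, and either $a=b$ or $a-b\neq 0$ a.e. on $\mathbb T$. Let $h_+\in H^\infty$. Then: (i) $h_+\ker^+ S_{ah_+,\,b}\subseteq\ker^+ S_{a,b}$ and $h_+\ker^+ S_{a,b}\subseteq\ker^+ S_{a,\,bh_+}$; (ii) if $h_+\in\mathcal G H^\infty$, or if $h_+$ is outer with $\dfrac{b}{ah_+}\in L^\infty$, then $h_+\ker^+ S_{ah_+,\,b}=\ker^+ S_{a,b}$; (iii) if $h_+\in\mathcal G H^\infty$, or if $h_+$ is outer with $\dfrac ba\in L^\infty$, then $h_+\ker^+ S_{a,b}=\ker^+ S_{a,\,bh_+}$; (iv) if $h_+$ is not outer, then the inclusions in (i) are strict.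
   Context: $\mathbb T$ is the unit circle, $\mathbb D$ the unit disc, $L^2=L^2(\mathbb T)$, $L^\infty=L^\infty(\mathbb T)$. $H^2_+=H^2(\mathbb D)$ is identified with a closed subspace of $L^2$ via boundary values, and $H^2_-=L^2\ominus H^2_+=\overline{H^2_0}$. $P^{\pm}$ are the orthogonal projections of $L^2$ onto $H^2_\pm$. $H^\infty$ is the algebra of bounded analytic functions on $\mathbb D$ (identified with boundary functions), and $\mathcal G H^\infty$ is the group of its invertible elements. For $a,b\in L^\infty$ the paired operator $S_{a,b}:L^2\to L^2$ is $S_{a,b}\phi=aP^+\phi+bP^-\phi$, and $\ker^{+}S_{a,b}:=P^{+}\ker S_{a,b}$, i.e. $\phi_+\in\ker^+S_{a,b}$ iff $\phi_+\in H^2_+$ and there is $\phi_-\in H^2_-$ with $a\phi_++b\phi_-=0$.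
   Formalization: In (iv), each inclusion is asserted to be strict only when its right-hand set (ker⁺S_{a,b}, resp. ker⁺S_{a,bh₊}) is not {0}; otherwise both sides are {0} and the claim fails, e.g. a=b=1, h₊=z. *)

(* Defs.v *)
From mathcomp Require Import all_boot all_order all_algebra.
From mathcomp Require Import all_classical all_reals all_analysis.
From mathcomp.real_closed Require Import complex.

Set Implicit Arguments.
Unset Strict Implicit.
Unset Printing Implicit Defensive.

Import Order.TTheory GRing.Theory Num.Theory.
Import numFieldNormedType.Exports.
Import ComplexField.Normc.

Local Open Scope classical_set_scope.
Local Open Scope ring_scope.

(* A function on the unit circle is given by f : R -> R[i], where f t is its
   value at the point e^(it) and only t in [0, 2 pi[ matters. Elements of L^2
   and L^infty are handled through representatives: equality is [aeT], and all
   the sets of functions defined below (from [L2] on) contain, together with a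
   function, all the representatives of its class. *)

Section CircleFunctions.
Variable R : realType.
Local Notation C := R[i].
Local Notation mu := (@lebesgue_measure R).
Implicit Types (f g h a b : R -> C) (F : C -> C) (z w : C).

Definition circle : set R := `[0, pi *+ 2[%classic.

Definition cis (t : R) : C := Complex (cos t) (sin t).

Definition cexp z : C := (expR (complex.Re z))%:C%C * cis (complex.Im z).

Definition almost_everywhereT (P : R -> Prop) : Prop :=
  {ae mu, forall t, circle t -> P t}.

Definition aeT f g : Prop := almost_everywhereT (fun t => f t = g t).

Definition measurableC f : Prop :=
  measurable_fun circle (fun t => complex.Re (f t)) /\
  measurable_fun circle (fun t => complex.Im (f t)).

Definition cintegral f : C :=
  Complex (\int[mu]_(t in circle) complex.Re (f t)) (\int[mu]_(t in circle) complex.Im (f t)).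

Definition sqnorm f : \bar R :=
  (\int[mu]_(t in circle) (normc (f t) ^+ 2)%:E)%E.

Definition L2 : set (R -> C) := [set f | measurableC f /\ (sqnorm f < +oo)%E].

Definition Linfty : set (R -> C) :=
  [set f | measurableC f /\
           exists M : R, almost_everywhereT (fun t => normc (f t) <= M)].

Definition inner f g : C :=
  ((pi *+ 2)^-1)%:C%C * cintegral (fun t => f t * conjc (g t)).

Definition analytic_disc F : Prop :=
  exists c : nat -> C, forall z, normc z < 1 ->
    (fun n => normc (F z - \sum_(k < n) c k * z ^+ k)) @ \oo --> (0 : R).

Definition dilate F (r : R) : R -> C := fun t => F (r%:C%C * cis t).

Definition boundary_function F f : Prop :=
  (fun r : R => sqnorm (fun t => dilate F r t - f t)) @ (1 : R)^'- --> (0 : \bar R).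

Definition H2_disc : set (C -> C) :=
  [set F | analytic_disc F /\
           exists M : R, forall r, 0 <= r < 1 -> (sqnorm (dilate F r) <= M%:E)%E].

Definition Hinfty_disc : set (C -> C) :=
  [set F | analytic_disc F /\
           exists M : R, forall z, normc z < 1 -> normc (F z) <= M].

Definition H2plus : set (R -> C) :=
  [set f | L2 f /\ exists F, H2_disc F /\ boundary_function F f].

Definition H2minus : set (R -> C) :=
  [set f | L2 f /\ forall g, H2plus g -> inner f g = 0].

Definition Hinfty : set (R -> C) :=
  [set h | Linfty h /\ exists F, Hinfty_disc F /\ boundary_function F h].

Definition GHinfty : set (R -> C) :=
  [set h | Hinfty h /\ exists g, Hinfty g /\ aeT (fun t => h t * g t) (cst 1)].

(* The condition h <> 0 a.e. is part of the integrability of log |h|; it has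
   to be stated because [ln 0 = 0] in the library. *)
Definition outer h : Prop :=
  [/\ almost_everywhereT (fun t => h t <> 0),
      mu.-integrable circle (fun t => (ln (normc (h t)))%:E)
    & exists F, [/\ analytic_disc F, boundary_function F h
      & exists lam : C, normc lam = 1 /\
          forall z, normc z < 1 ->
            F z = lam * cexp (((pi *+ 2)^-1)%:C%C *
              cintegral (fun t => (cis t + z) / (cis t - z) *
                                  (ln (normc (h t)))%:C%C))]].

(* [orth_proj M f p]: p is the orthogonal projection of f on the subspace M. *)
Definition orth_proj (M : set (R -> C)) f p : Prop :=
  M p /\ forall g, M g -> inner (fun t => f t - p t) g = 0.

(* [paired a b f g]: S_{a,b} f = g. *)
Definition paired a b f g : Prop :=
  exists fp fm, [/\ orth_proj H2plus f fp, orth_proj H2minus f fm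
                  & aeT g (fun t => a t * fp t + b t * fm t)].

Definition ker_paired a b : set (R -> C) :=
  [set f | L2 f /\ paired a b f (cst 0)].

Definition kerplus a b : set (R -> C) :=
  [set fp | exists f, ker_paired a b f /\ orth_proj H2plus f fp].

Definition mulset h (K : set (R -> C)) : set (R -> C) :=
  [set g | L2 g /\ exists f, K f /\ aeT g (fun t => h t * f t)].

Definition nontrivial (K : set (R -> C)) : Prop :=
  exists f, K f /\ ~ aeT f (cst 0).

End CircleFunctions.

(* Main.v *)
(** Everything rests on the factorization h = q o of a bounded analytic h <> 0
    into an inner function q (|q| = 1 a.e.) and an outer function o. With H the
    extension of h to the disc, the maximum principle applied to H divided by
    the outer function of modulus max(|h|, 1/n) bounds |H| by that outer
    function; at a point where H does not vanish this makes ln |h| integrable,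
    and n -> oo then gives |H| <= |O| for O the outer function of modulus |h|.
    So Q = H / O is bounded by 1, and its boundary function is q.

    The inclusions (i) and the cases of an invertible h are direct. If h is
    outer, an L^2 quotient f / h of f in H^2 is again in H^2: it is the L^2 limit
    of q_n f / h, where q_n is the boundary function of the outer function of
    modulus |h| / max(|h|, 1/n), and q_n / h is bounded analytic.

    If h is not outer then q is not constant, so |Q(0)| < 1. Equality in (i)
    would make each f in the larger kernel K equal to h g = q (o g), with o g
    again in K because the multiplication by conj(q) preserves H^2_-. So K would
    consist of functions divisible by q within K infinitely often; as division
    by q divides the first nonzero Fourier coefficient by Q(0) and preserves the
    L^2 norm, K would be {0}. *)

Require Import Defs.
From mathcomp Require Import all_boot all_order all_algebra.
From mathcomp Require Import all_classical all_reals all_analysis.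
From mathcomp.real_closed Require Import complex.
From mathcomp Require Import measurable_realfun ring lra.

Set Implicit Arguments.
Unset Strict Implicit.
Unset Printing Implicit Defensive.

Import Order.TTheory GRing.Theory Num.Theory.
Import numFieldNormedType.Exports.
Import ComplexField.Normc.
Import Defs.

Local Open Scope classical_set_scope.
Local Open Scope ring_scope.

(** * Modulus and exponential of complex numbers *)

Section ComplexNumbers.
Variable R : realType.
Implicit Types (z w : R[i]) (x y t : R).

(** Boundary values are limits in mean square only; no radial limit at a point of the circle is ever
    used. This shapes the treatment of outer functions. The modulus of an outer function on the
    circle is found from the convergence of a Poisson integral in L^2, which is available when the
    logarithm is bounded and is an L^2 limit of Lipschitz functions. The cut-off max(|h|, 1/n) has
    both properties: its logarithm is bounded, and it is a Lipschitz function of |h|, hence the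
    limit of the same expression in the Fourier partial sums of h. For ln |h| itself, which may be
    unbounded below, only |o| <= |h| is proved; as h = q o with |q| <= 1 and h <> 0 a.e., this
    already forces |q| = 1. In the outer cases of (ii) and (iii), the bounded quotient of the
    symbols is what puts f / h in L^2: the equation defining the kernel writes f / h as minus that
    quotient times the component in H^2_-. *)

Lemma normc_ge0 z : 0 <= normc z.
Proof. by case: z => a b; exact: sqrtr_ge0. Qed.

Lemma normc_norm z : `|z| = (normc z)%:C%C.
Proof. by case: z. Qed.

Lemma normcX z n : normc (z ^+ n) = normc z ^+ n.
Proof. by elim: n => [|n IH]; rewrite ?normc1// !exprS normcM IH. Qed.

Lemma normcN z : normc (- z) = normc z.
Proof. by case: z => a b /=; rewrite !sqrrN. Qed.

Lemma normcB z w : normc (z - w) = normc (w - z).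
Proof. by rewrite -normcN opprB. Qed.

Lemma normc_triangle z w : normc (z + w) <= normc z + normc w.
Proof.
by have := ler_normD z w; rewrite !normc_norm -[X in _ <= X]rmorphD/= lecR.
Qed.

Lemma normc_sqr z : normc z ^+ 2 = complex.Re z ^+ 2 + complex.Im z ^+ 2.
Proof. by case: z => a b /=; rewrite sqr_sqrtr// addr_ge0 ?sqr_ge0. Qed.

Lemma normcJ z : normc (conjc z) = normc z.
Proof. by case: z => a b /=; rewrite sqrrN. Qed.

Lemma normcR x : normc x%:C%C = `|x|.
Proof. by rewrite /= expr0n/= addr0 sqrtr_sqr. Qed.

Lemma mulcJ z : z * conjc z = (normc z ^+ 2)%:C%C.
Proof. by case: z => a b; rewrite normc_sqr/=; simpc; congr Complex; ring. Qed.

Lemma ler_sqr_le x y : 0 <= y -> x ^+ 2 <= y ^+ 2 -> x <= y.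
Proof.
move=> y0 xy; rewrite leNgt; apply/negP => yx.
by move: xy; apply/negP; rewrite -ltNge ltr_pXn2r// nnegrE (le_trans y0)// ltW.
Qed.

Lemma normr_Re_le z : `|complex.Re z| <= normc z.
Proof.
apply: ler_sqr_le; first exact: normc_ge0.
by rewrite normc_sqr real_normK ?num_real// lerDl sqr_ge0.
Qed.

Lemma normr_Im_le z : `|complex.Im z| <= normc z.
Proof.
apply: ler_sqr_le; first exact: normc_ge0.
by rewrite normc_sqr real_normK ?num_real// lerDr sqr_ge0.
Qed.

Lemma normc_le_ReIm z : normc z <= `|complex.Re z| + `|complex.Im z|.
Proof.
apply: ler_sqr_le; first exact: addr_ge0.
rewrite normc_sqr sqrrD !real_normK ?num_real// addrAC lerDl.
by rewrite mulrn_wge0// mulr_ge0.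
Qed.

Lemma normc_eq0 z : (normc z == 0) = (z == 0).
Proof.
apply/eqP/eqP => [/eq0_normc//|->]; exact: normc0.
Qed.

Lemma normc_gt0 z : (0 < normc z) = (z != 0).
Proof. by rewrite lt_neqAle normc_ge0 andbT eq_sym normc_eq0. Qed.

Lemma normc_sum I (r : seq I) (P : pred I) (F : I -> R[i]) :
  normc (\sum_(i <- r | P i) F i) <= \sum_(i <- r | P i) normc (F i).
Proof.
elim/big_ind2: _ => [||//]; first by rewrite normc0.
by move=> a b c d ab cd; rewrite (le_trans (normc_triangle _ _))// lerD.
Qed.

Lemma normc_dist z w : `|normc z - normc w| <= normc (z - w).
Proof.
rewrite ler_norml; apply/andP; split.
  rewrite lerNl opprB lerBlDr normcB.
  by apply: le_trans (normc_triangle _ _); rewrite subrK.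
by rewrite lerBlDr; apply: le_trans (normc_triangle _ _); rewrite subrK.
Qed.

Lemma normc_sqrD z w : normc (z + w) ^+ 2 <= 2 * normc z ^+ 2 + 2 * normc w ^+ 2.
Proof.
apply: (@le_trans _ _ ((normc z + normc w) ^+ 2)).
  by rewrite ler_pXn2r ?nnegrE ?addr_ge0 ?normc_ge0// normc_triangle.
by rewrite -subr_ge0; apply: le_trans (sqr_ge0 (normc z - normc w)) _; lra.
Qed.

Lemma normc_cis t : normc (cis t) = 1.
Proof. by rewrite /= cos2Dsin2 sqrtr1. Qed.

Lemma cis0 : cis 0 = 1 :> R[i].
Proof. by rewrite /cis cos0 sin0. Qed.

Lemma cisD x y : cis (x + y) = cis x * cis y.
Proof.
by rewrite /cis cosD sinD; simpc; congr Complex; rewrite addrC [X in X + _]mulrC.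
Qed.

Lemma cisX t n : cis t ^+ n = cis (t *+ n).
Proof. by elim: n => [|n IH]; rewrite ?cis0// exprS IH -cisD -mulrS. Qed.

Lemma cis_mulJ t : cis t * conjc (cis t) = 1.
Proof. by rewrite mulcJ normc_cis expr1n. Qed.

Lemma cexp0 : cexp 0 = 1 :> R[i].
Proof. by rewrite /cexp/= expR0 cis0 mulr1. Qed.

Lemma cexpD z w : cexp (z + w) = cexp z * cexp w.
Proof.
case: z w => [a b] [c d]; rewrite /cexp/= expRD cisD rmorphM /=; ring.
Qed.

Lemma cexpMn z n : cexp (z *+ n) = cexp z ^+ n.
Proof.
by elim: n => [|n IH]; rewrite ?mulr0n ?cexp0// mulrS cexpD IH exprS.
Qed.

Lemma normc_cexp z : normc (cexp z) = expR (complex.Re z).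
Proof. by rewrite normcM normc_cis mulr1 normcR ger0_norm// expR_ge0. Qed.

Lemma cexp_real x : cexp x%:C%C = (expR x)%:C%C.
Proof. by rewrite /cexp/= cis0 mulr1. Qed.

End ComplexNumbers.

(** * Measurability and integration on the circle *)

Section CircleMeasure.
Variable R : realType.
Local Notation mu := (@lebesgue_measure R).
Local Notation C := R[i].
Local Notation circle := (@circle R).
Local Notation int1 f := (mu.-integrable circle (EFin \o f)).
Implicit Types (f g h : R -> C) (u v : R -> R).

#[local] Instance ae_lebesgue_filter : Filter (almost_everywhere mu) :=
  ae_filter_ringOfSetsType mu.

Lemma measurable_circle : measurable circle.
Proof. exact: measurable_itv. Qed.
Hint Resolve measurable_circle : core.

Lemma pi2_gt0 : 0 < (pi : R) *+ 2.
Proof. by rewrite mulrn_wgt0// pi_gt0. Qed.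

Lemma mu_circle : mu circle = (pi *+ 2)%:E.
Proof.
by rewrite /Defs.circle lebesgue_measure_itv/= lte_fin pi2_gt0 oppr0 adde0.
Qed.

Lemma aeT_W (P : R -> Prop) : (forall t, circle t -> P t) -> almost_everywhereT P.
Proof. by move=> H; apply: aeW => t; exact: H. Qed.

Lemma aeT_imp (P Q : R -> Prop) : almost_everywhereT P ->
  (forall t, circle t -> P t -> Q t) -> almost_everywhereT Q.
Proof.
rewrite /almost_everywhereT => HP PQ; apply: filterS HP => t Pt ct; by apply: PQ => //; exact: Pt.
Qed.

Lemma aeT_imp2 (P Q S : R -> Prop) : almost_everywhereT P -> almost_everywhereT Q ->
  (forall t, circle t -> P t -> Q t -> S t) -> almost_everywhereT S.
Proof.
rewrite /almost_everywhereT => HP HQ PQ; apply: filterS2 HP HQ => t Pt Qt ct.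
by apply: PQ => //; [exact: Pt|exact: Qt].
Qed.

Lemma aeT_forall_nat (P : nat -> R -> Prop) :
  (forall n, almost_everywhereT (P n)) -> almost_everywhereT (fun t => forall n, P n t).
Proof.
rewrite /almost_everywhereT => H; have := ae_foralln H.
by apply: filterS => t Pt ct n; exact: Pt.
Qed.

Lemma aeT_sym f g : aeT f g -> aeT g f.
Proof. by move=> fg; apply: aeT_imp fg _ => t _ ->. Qed.

Section Measurability.

Lemma measurableC_cst z : measurableC (fun=> z : C).
Proof. by split => /=; exact: measurable_cst. Qed.

Lemma measurableCD f g : measurableC f -> measurableC g ->
  measurableC (fun t => f t + g t).
Proof.
move=> [f1 f2] [g1 g2]; split.
- rewrite [X in measurable_fun _ X](_ : _ = (fun t => complex.Re (f t) + complex.Re (g t))).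
    exact: measurable_funD.
  by apply/funext => t; rewrite raddfD.
- rewrite [X in measurable_fun _ X](_ : _ = (fun t => complex.Im (f t) + complex.Im (g t))).
    exact: measurable_funD.
  by apply/funext => t; rewrite raddfD.
Qed.

Lemma measurableCM f g : measurableC f -> measurableC g ->
  measurableC (fun t => f t * g t).
Proof.
move=> [f1 f2] [g1 g2]; split.
- rewrite [X in measurable_fun _ X](_ : _ = (fun t =>
      complex.Re (f t) * complex.Re (g t) - complex.Im (f t) * complex.Im (g t))).
    by apply: measurable_funB; exact: measurable_funM.
  by apply/funext => t; case: (f t) (g t) => [a b] [c d].
- rewrite [X in measurable_fun _ X](_ : _ = (fun t =>
      complex.Re (f t) * complex.Im (g t) + complex.Im (f t) * complex.Re (g t))).
    by apply: measurable_funD; exact: measurable_funM.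
  by apply/funext => t; case: (f t) (g t) => [a b] [c d].
Qed.

Lemma measurableCN f : measurableC f -> measurableC (fun t => - f t).
Proof.
move=> mf; rewrite (_ : (fun t => _) = (fun t => -1 * f t)).
  by apply: measurableCM => //; exact: measurableC_cst.
by apply/funext => t; rewrite mulN1r.
Qed.

Lemma measurableCB f g : measurableC f -> measurableC g ->
  measurableC (fun t => f t - g t).
Proof. by move=> mf mg; apply: measurableCD => //; exact: measurableCN. Qed.

Lemma measurableCJ f : measurableC f -> measurableC (fun t => conjc (f t)).
Proof.
move=> [f1 f2]; split.
- rewrite [X in measurable_fun _ X](_ : _ = (fun t => complex.Re (f t)))//.
  by apply/funext => t; case: (f t).
- rewrite [X in measurable_fun _ X](_ : _ = (fun t => - complex.Im (f t)))//.
    exact: measurable_funN.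
  by apply/funext => t; case: (f t).
Qed.

Lemma measurableC_real u : measurable_fun circle u ->
  measurableC (fun t => (u t)%:C%C).
Proof. by move=> mu'; split => //=; exact: measurable_cst. Qed.

Lemma measurable_normc2 f : measurableC f ->
  measurable_fun circle (fun t => normc (f t) ^+ 2).
Proof.
move=> [f1 f2].
rewrite [X in measurable_fun _ X](_ : _ =
  (fun t => complex.Re (f t) ^+ 2 + complex.Im (f t) ^+ 2)).
  by apply: measurable_funD; exact: measurable_funX.
by apply/funext => t; rewrite normc_sqr.
Qed.

Lemma measurable_normc f : measurableC f ->
  measurable_fun circle (fun t => normc (f t)).
Proof.
move=> mf; rewrite [X in measurable_fun _ X](_ : _ =
  Num.sqrt \o (fun t => normc (f t) ^+ 2)).
  apply: measurableT_comp (measurable_normc2 mf).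
  by apply: continuous_measurable_fun; exact: sqrt_continuous.
by apply/funext => t /=; rewrite sqrtr_sqr ger0_norm// normc_ge0.
Qed.

Lemma measurableC_cis : measurableC (@cis R).
Proof.
split => /=; apply: measurable_funTS; apply: continuous_measurable_fun.
- exact: continuous_cos.
- exact: continuous_sin.
Qed.

Lemma measurableCX f n : measurableC f -> measurableC (fun t => f t ^+ n).
Proof.
move=> mf; elim: n => [|n IH]; first exact: measurableC_cst.
rewrite (_ : (fun t => _) = (fun t => f t * f t ^+ n)); first exact: measurableCM.
by apply/funext => t; rewrite exprS.
Qed.

Lemma measurableC_sum (I : Type) (r : seq I) (F : I -> R -> C) :
  (forall i, measurableC (F i)) -> measurableC (fun t => \sum_(i <- r) F i t).
Proof.
move=> mF; elim: r => [|i r IH].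
  by rewrite (_ : (fun t => _) = fun=> 0); [exact: measurableC_cst|apply/funext => t; rewrite big_nil].
rewrite (_ : (fun t => _) = (fun t => F i t + \sum_(i <- r) F i t)).
  exact: measurableCD.
by apply/funext => t; rewrite big_cons.
Qed.

Lemma measurableC_cvg (f_ : nat -> R -> C) f :
  (forall n, measurableC (f_ n)) ->
  (forall t, circle t -> (fun n => normc (f_ n t - f t)) @ \oo --> (0 : R)) ->
  measurableC f.
Proof.
move=> mf ff; split.
- apply: (measurable_fun_cvg (h := fun n t => complex.Re (f_ n t))) => [n|t ct].
    by have [] := mf n.
  apply/cvgrPdist_le => /= e e0.
  move/cvgrPdist_le : (ff t ct) => /(_ e e0); apply: filterS => n.
  rewrite sub0r normrN ger0_norm ?normc_ge0//; apply: le_trans.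
  by rewrite distrC -raddfB; exact: normr_Re_le.
- apply: (measurable_fun_cvg (h := fun n t => complex.Im (f_ n t))) => [n|t ct].
    by have [] := mf n.
  apply/cvgrPdist_le => /= e e0.
  move/cvgrPdist_le : (ff t ct) => /(_ e e0); apply: filterS => n.
  rewrite sub0r normrN ger0_norm ?normc_ge0//; apply: le_trans.
  by rewrite distrC -raddfB; exact: normr_Im_le.
Qed.

End Measurability.

Lemma int1_cst (k : R) : int1 (fun=> k).
Proof.
apply: (@measurable_bounded_integrable _ _ _ mu (cst k)) => //.
- by rewrite -[X in (X < _)%E]/(mu circle) mu_circle ltry.
- by exists `|k|; split; [exact: num_real|move=> x kx t _ /=; exact: ltW].
Qed.

Lemma int1_le u v : measurable_fun circle u -> int1 v ->
  (forall t, circle t -> `|u t| <= v t) -> int1 u.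
Proof.
move=> mu' iv uv; apply: (@le_integrable _ _ _ mu _ measurable_circle _ (EFin \o v)) => //.
  exact/measurable_EFinP.
by move=> t ct /=; rewrite lee_fin (le_trans (uv _ ct))// ler_norm.
Qed.

Lemma int1_bounded u M : measurable_fun circle u ->
  (forall t, circle t -> `|u t| <= M) -> int1 u.
Proof. by move=> mu' uM; apply: int1_le (int1_cst M) uM. Qed.

Lemma int1D u v : int1 u -> int1 v -> int1 (fun t => u t + v t).
Proof. by move=> iu iv; exact: (@integrableD _ _ _ mu _ measurable_circle _ _ iu iv). Qed.

Lemma int1B u v : int1 u -> int1 v -> int1 (fun t => u t - v t).
Proof.
move=> iu iv; rewrite (_ : EFin \o _ = (EFin \o u) \- (EFin \o v))%E.
  exact: (@integrableB _ _ _ mu _ measurable_circle _ _ iu iv).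
by apply/funext => t.
Qed.

Lemma int1Z k u : int1 u -> int1 (fun t => k * u t).
Proof.
move=> iu; rewrite (_ : EFin \o _ = (fun t => k%:E * (EFin \o u) t)%E).
  exact: (@integrableZl _ _ _ mu _ measurable_circle).
by apply/funext => t.
Qed.

Lemma int1N u : int1 u -> int1 (fun t => - u t).
Proof.
move=> /(int1Z (-1)); rewrite (_ : (fun t => _) = (fun t => - u t))//.
by apply/funext => t; rewrite mulN1r.
Qed.

Lemma int1_measurable u : int1 u -> measurable_fun circle u.
Proof. by move=> /measurable_int/measurable_EFinP. Qed.

Lemma int1_ae u v : measurable_fun circle v ->
  almost_everywhereT (fun t => u t = v t) -> int1 u -> int1 v.
Proof.
move=> mv uv /[dup] /int1_measurable mu' /integrableP[_ iu].
apply/integrableP; split; first exact/measurable_EFinP.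
rewrite (_ : (\int[mu]_(x in circle) _ = \int[mu]_(t in circle) `|(EFin \o u) t|)%E)//.
apply: (@ae_eq_integral _ _ _ mu) => //.
- by apply: measurableT_comp => //; exact/measurable_EFinP.
- by apply: measurableT_comp => //; exact/measurable_EFinP.
- by apply: (aeT_imp uv) => t _ /= ->.
Qed.

Lemma Rint_ae u v : measurable_fun circle u -> measurable_fun circle v ->
  almost_everywhereT (fun t => u t = v t) ->
  \int[mu]_(t in circle) u t = \int[mu]_(t in circle) v t.
Proof.
move=> mu' mv uv; congr fine; apply: (@ae_eq_integral _ _ _ mu) => //.
- exact/measurable_EFinP.
- exact/measurable_EFinP.
- by apply: (aeT_imp uv) => t _ /= ->.
Qed.

Lemma EFin_Rint u : int1 u ->
  (\int[mu]_(t in circle) u t)%:E = (\int[mu]_(t in circle) (u t)%:E)%E.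
Proof. by move=> iu; rewrite fineK//; exact: integrable_fin_num. Qed.

Lemma int1_ge0_lty u : measurable_fun circle u -> (forall t, circle t -> 0 <= u t) ->
  (\int[mu]_(t in circle) (u t)%:E < +oo)%E -> int1 u.
Proof.
move=> mu' u0 iu; apply/integrableP; split; first exact/measurable_EFinP.
rewrite (_ : (\int[mu]_(x in circle) _ = \int[mu]_(t in circle) (u t)%:E)%E)//.
apply: eq_integral => t; rewrite inE => ct /=.
by rewrite ger0_norm// u0.
Qed.

Lemma le_Rint u v : int1 u -> int1 v -> almost_everywhereT (fun t => u t <= v t) ->
  \int[mu]_(t in circle) u t <= \int[mu]_(t in circle) v t.
Proof.
move=> iu iv uv.
have mu' := int1_measurable iu; have mv := int1_measurable iv.
(* The inequality becomes a pointwise one for [min u v], which is almost everywhere equal to u. *)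
rewrite (@Rint_ae u (fun t => Num.min (u t) (v t)))//.
- apply: (@le_Rintegral _ _ _ mu) => //; last by move=> t _; rewrite ge_min lexx orbT.
  apply: int1_ae iu; first exact: measurable_minr.
  by apply: aeT_imp uv _ => t _ h; rewrite min_l.
- exact: measurable_minr.
- by apply: aeT_imp uv _ => t _ h; rewrite min_l.
Qed.

End CircleMeasure.

(** * The space L^2 and convergence in mean square *)

Section SquareIntegrable.
Variable R : realType.
Local Notation mu := (@lebesgue_measure R).
Local Notation C := R[i].
Local Notation circle := (@circle R).
Local Notation int1 f := (mu.-integrable circle (EFin \o f)).
Implicit Types (f g h : R -> C) (u v : R -> R).

Let mcircle := @measurable_circle R.
#[local] Hint Resolve mcircle : core.

Lemma sqnorm_ge0 f : (0 <= sqnorm f)%E.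
Proof. by apply: integral_ge0 => t _; rewrite lee_fin sqr_ge0. Qed.

Lemma L2_int1 f : L2 f -> int1 (fun t => normc (f t) ^+ 2).
Proof.
move=> [mf nf]; apply: int1_ge0_lty => //; first exact: measurable_normc2.
by move=> t _; rewrite sqr_ge0.
Qed.

Lemma sqnorm_EFin f : L2 f ->
  sqnorm f = (\int[mu]_(t in circle) (normc (f t) ^+ 2))%:E.
Proof. by move=> Lf; rewrite EFin_Rint//; exact: L2_int1. Qed.

Lemma le_sqnorm f g : measurableC f -> measurableC g ->
  almost_everywhereT (fun t => normc (f t) <= normc (g t)) ->
  (sqnorm f <= sqnorm g)%E.
Proof.
move=> mf mg fg; apply: (@ae_ge0_le_integral _ _ _ mu) => //.
- by move=> t _; rewrite lee_fin sqr_ge0.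
- by apply/measurable_EFinP; exact: measurable_normc2.
- by move=> t _; rewrite lee_fin sqr_ge0.
- by apply/measurable_EFinP; exact: measurable_normc2.
- apply: (aeT_imp fg) => t _ h.
  by rewrite lee_fin ler_pXn2r// nnegrE normc_ge0.
Qed.

Lemma sqnorm_aeT f g : measurableC f -> measurableC g -> aeT f g ->
  sqnorm f = sqnorm g.
Proof.
move=> mf mg fg; apply/eqP; rewrite eq_le; apply/andP.
by split; apply: le_sqnorm => //; apply: aeT_imp fg _ => t _ ->.
Qed.

Lemma sqnormZ (k : C) f : measurableC f ->
  sqnorm (fun t => k * f t) = ((normc k ^+ 2)%:E * sqnorm f)%E.
Proof.
move=> mf; have mf2 : measurable_fun circle (fun t => (normc (f t) ^+ 2)%:E).
  by apply/measurable_EFinP; exact: measurable_normc2.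
have f0 t : circle t -> (0 <= (normc (f t) ^+ 2)%:E)%E by rewrite lee_fin sqr_ge0.
have := @ge0_integralZl_EFin _ _ _ mu _ mcircle _ f0 mf2 _ (sqr_ge0 (normc k)).
by rewrite /sqnorm => <-; apply: eq_integral => t _; rewrite normcM exprMn EFinM.
Qed.

Lemma sqnormN f : sqnorm (fun t => - f t) = sqnorm f.
Proof. by apply: eq_integral => t _; rewrite normcN. Qed.

Lemma sqnormBC f g : sqnorm (fun t => f t - g t) = sqnorm (fun t => g t - f t).
Proof. by apply: eq_integral => t _; rewrite normcB. Qed.

(** As [sqnorm] is the square of the norm, the triangle inequality appears as |x + y|^2 <= 2 |x|^2 +
    2 |y|^2. The fractions e / 4, e / 16, e / 64 of later proofs absorb these factors 2. *)
Lemma sqnormD f g : measurableC f -> measurableC g ->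
  (sqnorm (fun t => f t + g t)%R <= 2%:E * sqnorm f + 2%:E * sqnorm g)%E.
Proof.
move=> mf mg.
have m2 h : measurableC h -> measurable_fun circle (fun t => (normc (h t) ^+ 2)%:E).
  by move=> mh; apply/measurable_EFinP; exact: measurable_normc2.
have h0 h t : circle t -> (0 <= (normc (h t) ^+ 2)%:E)%E by rewrite lee_fin sqr_ge0.
have Z h (mh : measurableC h) := @ge0_integralZl_EFin _ _ _ mu _
  mcircle _ (h0 h) (m2 h mh) 2 (ler0n R 2).
rewrite /sqnorm -(Z f mf) -(Z g mg).
rewrite -(@ge0_integralD _ _ _ mu)//; last 4 first.
- by move=> t ct; rewrite mule_ge0// h0.
- by apply: measurable_funeM; exact: m2.
- by move=> t ct; rewrite mule_ge0// h0.
- by apply: measurable_funeM; exact: m2.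
apply: (@ge0_le_integral _ _ _ mu) => //.
- by move=> t _; rewrite lee_fin sqr_ge0.
- by apply: m2; exact: measurableCD.
- by apply: emeasurable_funD; apply: measurable_funeM; exact: m2.
- by move=> t _; rewrite -!EFinM -EFinD lee_fin normc_sqrD.
Qed.

Lemma sqnorm_triangle g f h : measurableC f -> measurableC g -> measurableC h ->
  (sqnorm (fun t => f t - h t)%R <=
   2%:E * sqnorm (fun t => f t - g t)%R + 2%:E * sqnorm (fun t => g t - h t)%R)%E.
Proof.
move=> mf mg mh; rewrite [X in (sqnorm X <= _)%E](_ : _ =
    (fun t => (f t - g t) + (g t - h t))).
  by apply: sqnormD; exact: measurableCB.
by apply/funext => t; rewrite addrA subrK.
Qed.

Lemma sqnorm0_ae f : measurableC f -> sqnorm f = 0%E -> aeT f (cst 0).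
Proof.
move=> mf f0.
have := (@ae_eq_integral_abs _ _ _ mu _ mcircle
  (fun t => (normc (f t) ^+ 2)%:E)).
move=> /(_ _)[|h _].
  by apply/measurable_EFinP; exact: measurable_normc2.
have {}h := h _; apply: (aeT_imp (h _)).
- rewrite -[RHS]f0; apply: eq_integral => t _ /=.
  by rewrite ger0_norm// sqr_ge0.
- by move=> t _ /= [] /eqP; rewrite expf_eq0/= normc_eq0 => /eqP.
Qed.

Lemma L2_meas f : L2 f -> measurableC f. Proof. by case. Qed.

Lemma L2D f g : L2 f -> L2 g -> L2 (fun t => f t + g t).
Proof.
move=> Lf Lg; split; first by apply: measurableCD; exact: L2_meas.
apply: le_lt_trans (sqnormD (L2_meas Lf) (L2_meas Lg)) _.
by rewrite !sqnorm_EFin// -!EFinM -EFinD ltry.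
Qed.

Lemma L2Z (k : C) f : L2 f -> L2 (fun t => k * f t).
Proof.
move=> Lf; split; first by apply: measurableCM; [exact: measurableC_cst|exact: L2_meas].
by rewrite sqnormZ ?sqnorm_EFin// ?ltry//; exact: L2_meas.
Qed.

Lemma L2N f : L2 f -> L2 (fun t => - f t).
Proof. by move=> [mf nf]; split; [exact: measurableCN|rewrite sqnormN]. Qed.

Lemma L2B f g : L2 f -> L2 g -> L2 (fun t => f t - g t).
Proof. by move=> Lf Lg; apply: L2D => //; exact: L2N. Qed.

Lemma L2J f : L2 f -> L2 (fun t => conjc (f t)).
Proof.
move=> [mf nf]; split; first exact: measurableCJ.
by rewrite (_ : sqnorm _ = sqnorm f)//; apply: eq_integral => t _; rewrite normcJ.
Qed.

Lemma L2_le f g : measurableC f -> L2 g ->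
  almost_everywhereT (fun t => normc (f t) <= normc (g t)) -> L2 f.
Proof.
move=> mf [mg ng] fg; split => //.
exact: le_lt_trans (le_sqnorm mf mg fg) ng.
Qed.

Lemma L2_aeT f g : measurableC g -> aeT f g -> L2 f -> L2 g.
Proof. by move=> mg fg Lf; apply: (L2_le mg Lf); apply: aeT_imp fg _ => t _ ->. Qed.

Lemma L2_cst (k : C) : L2 (fun=> k).
Proof.
split; first exact: measurableC_cst.
by rewrite /sqnorm -EFin_Rint ?ltry//; exact: int1_cst.
Qed.

Lemma Linfty_L2 f : Linfty f -> L2 f.
Proof.
move=> [mf [M fM]]; apply: (L2_le mf (L2_cst M%:C%C)).
by apply: aeT_imp fM _ => t _ fM; rewrite normcR (le_trans fM)// ler_norm.
Qed.

Lemma sqnormM_le M f g : measurableC f -> measurableC g ->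
  almost_everywhereT (fun t => normc (f t) <= M) ->
  (sqnorm (fun t => f t * g t)%R <= (M ^+ 2)%:E * sqnorm g)%E.
Proof.
move=> mf mg fM.
have -> : M ^+ 2 = normc M%:C%C ^+ 2 by rewrite normcR real_normK ?num_real.
rewrite -sqnormZ//; apply: le_sqnorm.
- exact: measurableCM.
- by apply: measurableCM => //; exact: measurableC_cst.
- apply: aeT_imp fM _ => t _ h; rewrite !normcM normcR ler_wpM2r ?normc_ge0//.
  by rewrite (le_trans h)// ler_norm.
Qed.

Lemma L2M_Linfty f g : Linfty f -> L2 g -> L2 (fun t => f t * g t).
Proof.
move=> [mf [M fM]] [mg ng]; split; first exact: measurableCM.
apply: le_lt_trans (sqnormM_le mf mg fM) _.
by rewrite (sqnorm_EFin (conj mg ng)) -EFinM ltry.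
Qed.

Lemma LinftyJ f : Linfty f -> Linfty (fun t => conjc (f t)).
Proof.
move=> [mf [M fM]]; split; first exact: measurableCJ.
by exists M; apply: aeT_imp fM _ => t _; rewrite normcJ.
Qed.

(** An arbitrary set system U lets the same lemmas serve sequences ([\oo]) and radii tending to 1
    from the left. *)
Definition cvgL2 (I : Type) (U : set_system I) (f_ : I -> R -> C) f : Prop :=
  forall e : R, 0 < e -> U [set i | (sqnorm (fun t => f_ i t - f t)%R <= e%:E)%E].

Section Convergence.
Variables (I : Type) (U : set_system I).
Context {FU : ProperFilter U}.

Lemma cvgL2_sqnorm0 (f_ : I -> R -> C) f :
  cvgL2 U f_ f <-> (fun i => sqnorm (fun t => f_ i t - f t)) @ U --> 0%E.
Proof.
split=> [H A [e /= e0 eA]|H e e0].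
- have e20 : 0 < e / 2 by rewrite divr_gt0.
  suff : U [set i | A (sqnorm (fun t => f_ i t - f t))] by [].
  apply: filterS (H _ e20) => i /=; have := sqnorm_ge0 (fun t => f_ i t - f t).
  case: (sqnorm _) => [r||]//; rewrite !lee_fin => r0 re.
  apply: eA => /=; rewrite sub0r normrN ger0_norm//.
  by rewrite (le_lt_trans re)// ltr_pdivrMr// ltr_pMr// ltr1n.
- have : nbhs (0%E : \bar R) [set x : \bar R | (x <= e%:E)%E].
    exists e => //= r /=; rewrite sub0r normrN lee_fin => /ltW.
    exact/le_trans/ler_norm.
  by move=> /H.
Qed.

Lemma cvgL2_unique (f_ : I -> R -> C) f g : U [set i | measurableC (f_ i)] ->
  measurableC f -> measurableC g -> cvgL2 U f_ f -> cvgL2 U f_ g -> aeT f g.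
Proof.
move=> mf_ mf mg cf cg; suff H : sqnorm (fun t => f t - g t) = 0%E.
  have := sqnorm0_ae (measurableCB mf mg) H.
  by move/aeT_imp; apply => t _ /eqP; rewrite subr_eq0 => /eqP.
apply/eqP; rewrite eq_le sqnorm_ge0 andbT; apply/lee_addgt0Pr => e e0.
have e4 : 0 < e / 4 by rewrite divr_gt0.
have [i /= [[h1 h2] mfi]] := @filter_ex _ _ FU _
  (filterI (filterI (cf _ e4) (cg _ e4)) mf_).
rewrite add0e (le_trans (sqnorm_triangle mf mfi mg))//.
rewrite sqnormBC (@le_trans _ _ (2%:E * (e / 4)%:E + 2%:E * (e / 4)%:E)%E)//.
  by rewrite leeD// lee_pmul2l.
by rewrite -!EFinM -EFinD lee_fin; lra.
Qed.

Lemma cvgL2_le (f_ g_ : I -> R -> C) f g (k : R) : 0 <= k ->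
  U [set i | (sqnorm (fun t => g_ i t - g t)%R <=
              k%:E * sqnorm (fun t => f_ i t - f t)%R)%E] ->
  cvgL2 U f_ f -> cvgL2 U g_ g.
Proof.
move=> k0 H cf e e0; have k1 : 0 < k + 1 by rewrite ltr_wpDl.
have e1 : 0 < e / (k + 1) by rewrite divr_gt0.
apply: filterS2 (cf _ e1) H => i /= h H; apply: le_trans H _.
apply: (@le_trans _ _ ((k + 1)%:E * (e / (k + 1))%:E)%E).
  by apply: lee_pmul => //; rewrite ?sqnorm_ge0// lee_fin lerDl.
by rewrite -EFinM lee_fin mulrC divfK// gt_eqF.
Qed.

Lemma cvgL2D (f_ g_ : I -> R -> C) f g :
  U [set i | measurableC (f_ i)] -> U [set i | measurableC (g_ i)] ->
  measurableC f -> measurableC g -> cvgL2 U f_ f -> cvgL2 U g_ g ->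
  cvgL2 U (fun i t => f_ i t + g_ i t) (fun t => f t + g t).
Proof.
move=> mf_ mg_ mf mg cf cg e e0; have e4 : 0 < e / 4 by rewrite divr_gt0.
apply: filterS2 (filterI mf_ mg_) (filterI (cf _ e4) (cg _ e4)).
move=> i /= [mfi mgi] [h1 h2].
rewrite [X in (sqnorm X <= _)%E](_ : _ =
  (fun t => (f_ i t - f t) + (g_ i t - g t))); last first.
  by apply/funext => t; ring.
rewrite (le_trans (sqnormD (measurableCB mfi mf) (measurableCB mgi mg)))//.
rewrite (@le_trans _ _ (2%:E * (e / 4)%:E + 2%:E * (e / 4)%:E)%E)//.
  by rewrite leeD// lee_pmul2l.
by rewrite -!EFinM -EFinD lee_fin; lra.
Qed.

Lemma cvgL2_normc (f_ : I -> R -> C) f :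
  U [set i | measurableC (f_ i)] -> measurableC f -> cvgL2 U f_ f ->
  cvgL2 U (fun i t => (normc (f_ i t))%:C%C) (fun t => (normc (f t))%:C%C).
Proof.
move=> mf_ mf; apply: (@cvgL2_le _ _ _ _ 1) => //.
apply: filterS mf_ => i /= mfi; rewrite mul1e; apply: le_sqnorm.
- by apply: measurableCB; apply: measurableC_real; exact: measurable_normc.
- exact: measurableCB.
- by apply: aeT_W => t _; rewrite -rmorphB normcR normc_dist.
Qed.

(** The excess w = max(|f| - u, 0) is at most |f_i - f| almost everywhere as soon as |f_i| <= u, so
    [sqnorm w] is arbitrarily small. No subsequence converging almost everywhere has to be
    extracted. *)
Lemma cvgL2_ae_le (f_ : I -> R -> C) f u :
  U [set i | measurableC (f_ i) /\ almost_everywhereT (fun t => normc (f_ i t) <= u t)] ->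
  measurable_fun circle u -> measurableC f -> cvgL2 U f_ f ->
  almost_everywhereT (fun t => normc (f t) <= u t).
Proof.
move=> H mu' mf cf; pose w t := (Num.max (normc (f t) - u t) 0)%:C%C.
have mw : measurableC w.
  apply: measurableC_real; apply: measurable_maxr => //.
  by apply: measurable_funB => //; exact: measurable_normc.
suff w0 : sqnorm w = 0%E.
  apply: aeT_imp (sqnorm0_ae mw w0) _ => t _ /complexI /eqP.
  by rewrite maxEle; case: ifP => [|_ /eqP]; rewrite ?subr_le0// => /eqP; rewrite subr_eq0 => /eqP ->.
apply/eqP; rewrite eq_le sqnorm_ge0 andbT; apply/lee_addgt0Pr => e e0.
have [i /= [[mfi fu] h]] := @filter_ex _ _ FU _ (filterI H (cf _ e0)).
rewrite add0e; apply: le_trans h; apply: le_sqnorm => //; first exact: measurableCB.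
apply: aeT_imp fu _ => t _ h; rewrite normcR ger0_norm ?le_max ?lexx ?orbT//.
rewrite ge_max normc_ge0 andbT normcB.
by apply: le_trans (le_trans (ler_norm _) (normc_dist _ _)); rewrite lerB.
Qed.

End Convergence.

(** Dominated convergence: the part of |f|^2 above the level n tends to 0 pointwise and is dominated
    by |f|^2. *)
Lemma sqnorm_tail f (e : R) : L2 f -> 0 < e -> exists N : R, 0 <= N /\
  (\int[mu]_(t in circle) (Num.max (normc (f t) ^+ 2 - N) 0)%:E <= e%:E)%E.
Proof.
move=> Lf e0; have mf2 := measurable_normc2 (L2_meas Lf).
have cv : ((fun n => \int[mu]_(t in circle) (Num.max (normc (f t) ^+ 2 - n%:R) 0)%:E)
   @ \oo --> \int[mu]_(t in circle) (0 : \bar R))%E.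
  apply: (@dominated_cvg _ _ _ mu _ mcircle
    (fun n t => (Num.max (normc (f t) ^+ 2 - n%:R) 0)%:E) (fun=> 0%E)
    (fun t => (normc (f t) ^+ 2)%:E)) => //.
  - by move=> n; apply/measurable_EFinP; apply: measurable_maxr => //; exact: measurable_funB.
  - move=> t ct; apply/fine_cvgP; split; first exact: nearW.
    apply/cvgrPdist_le => /= d d0; near=> n.
    have h : normc (f t) ^+ 2 <= n%:R by near: n; exact: nbhs_infty_ger.
    by rewrite /= sub0r normrN max_r ?subr_le0// normr0 ltW.
  - exact: L2_int1.
  - move=> n t _ /=; rewrite lee_fin ger0_norm ?le_max ?lexx ?orbT//.
    by rewrite ge_max sqr_ge0 andbT gerBl.
have : nbhs (\int[mu]_(t in circle) (0 : \bar R))%E [set x : \bar R | (x <= e%:E)%E].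
  rewrite integral0; exists e => //= r /=; rewrite sub0r normrN lee_fin => /ltW.
  exact/le_trans/ler_norm.
move=> /cv [n _ /(_ n (leqnn n)) /= h]; exists n%:R; split => //.
Unshelve. all: by end_near. Qed.

(** Here f may be unbounded, so |w f| is not controlled by |w| alone. The pointwise bound |w f|^2 <=
    N |w|^2 + M^2 max(|f|^2 - N, 0) separates the two: N is chosen from the tail of f, and then w is
    taken small in mean square. *)
Lemma cvgL2_truncation (I : Type) (U : set_system I) {FU : ProperFilter U}
    (w_ : I -> R -> C) f (M : R) : 0 <= M ->
  U [set i | measurableC (w_ i) /\ almost_everywhereT (fun t => normc (w_ i t) <= M)] ->
  L2 f -> cvgL2 U w_ (cst 0) ->
  cvgL2 U (fun i t => w_ i t * f t) (cst 0).
Proof.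
move=> M0 Hw Lf cw e e0.
have e1 : 0 < e / 2 / (M ^+ 2 + 1).
  by rewrite !divr_gt0// ltr_wpDl// sqr_ge0.
have [N [N0 hN]] := sqnorm_tail Lf e1.
have e2 : 0 < e / 2 / (N + 1) by rewrite !divr_gt0// ltr_wpDl.
apply: filterS2 Hw (cw _ e2) => i /= [mw wM].
rewrite [X in (sqnorm X <= _)%E -> _](_ : _ = w_ i); last by apply/funext => t /=; rewrite subr0.
move=> hw; rewrite [X in (sqnorm X <= _)%E](_ : _ = (fun t => w_ i t * f t)); last first.
  by apply/funext => t /=; rewrite subr0.
pose u t : \bar R := (Num.max (normc (f t) ^+ 2 - N) 0)%:E.
have mu' : measurable_fun circle u.
  apply/measurable_EFinP; apply: measurable_maxr => //.
  by apply: measurable_funB => //; exact: measurable_normc2 (L2_meas Lf).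
have u0 t : circle t -> (0 <= u t)%E by rewrite lee_fin le_max lexx orbT.
have w0 t : circle t -> (0 <= (normc (w_ i t) ^+ 2)%:E)%E by rewrite lee_fin sqr_ge0.
have mw2 : measurable_fun circle (fun t => (normc (w_ i t) ^+ 2)%:E).
  by apply/measurable_EFinP; exact: measurable_normc2.
apply: (@le_trans _ _ (N%:E * sqnorm (w_ i) + (M ^+ 2)%:E * \int[mu]_(t in circle) u t)%E).
  rewrite /sqnorm -(@ge0_integralZl_EFin _ _ _ mu _ mcircle _ w0 mw2 _ N0).
  rewrite -(@ge0_integralZl_EFin _ _ _ mu _ mcircle _ u0 mu' _ (sqr_ge0 M)).
  rewrite -(@ge0_integralD _ _ _ mu)//; last 4 first.
  - by move=> t ct; rewrite mule_ge0// w0.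
  - exact: measurable_funeM.
  - by move=> t ct; rewrite mule_ge0// ?u0// lee_fin sqr_ge0.
  - exact: measurable_funeM.
  apply: (@ae_ge0_le_integral _ _ _ mu) => //.
  - by move=> t _; rewrite lee_fin sqr_ge0.
  - by apply/measurable_EFinP; apply: measurable_normc2; apply: measurableCM => //; exact: L2_meas.
  - by move=> t ct; rewrite adde_ge0// mule_ge0 ?w0 ?u0// lee_fin ?sqr_ge0.
  - by apply: emeasurable_funD; exact: measurable_funeM.
  - apply: (aeT_imp wM) => t _ h; rewrite /u -!EFinM -EFinD lee_fin.
    have h2 : normc (w_ i t) ^+ 2 <= M ^+ 2 by rewrite ler_pXn2r// nnegrE normc_ge0.
    have := sqr_ge0 (normc (w_ i t)); rewrite normcM exprMn.
    set x := normc (w_ i t) ^+ 2; set y := normc (f t) ^+ 2 => x0.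
    rewrite /= -/x in h2; have y0 : 0 <= y by exact: sqr_ge0.
    rewrite maxEle; case: ifP => [|/negbT]; rewrite -?ltNge => yN; nra.
apply: (@le_trans _ _ (N%:E * (e / 2 / (N + 1))%:E + (M ^+ 2)%:E * (e / 2 / (M ^+ 2 + 1))%:E)%E).
  by apply: leeD; apply: lee_wpmul2l => //; rewrite lee_fin ?sqr_ge0.
rewrite -!EFinM -EFinD lee_fin [leRHS](splitr e); apply: lerD.
- by rewrite mulrCA ger_pMr ?divr_gt0// ler_pdivrMr ?ltr_wpDl// mul1r lerDl.
- by rewrite mulrCA ger_pMr ?divr_gt0// ler_pdivrMr ?ltr_wpDl ?sqr_ge0// mul1r lerDl.
Qed.

(** g_i f_i - g f = g_i (f_i - f) + (g_i - g) f: the uniform bound on g_i handles the first term,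
    [cvgL2_truncation] the second. *)
Lemma cvgL2M (I : Type) (U : set_system I) {FU : ProperFilter U}
    (f_ g_ : I -> R -> C) f g (M : R) : 0 <= M ->
  U [set i | measurableC (f_ i)] ->
  U [set i | measurableC (g_ i) /\ almost_everywhereT (fun t => normc (g_ i t) <= M)] ->
  L2 f -> measurableC g -> cvgL2 U f_ f -> cvgL2 U g_ g ->
  cvgL2 U (fun i t => g_ i t * f_ i t) (fun t => g t * f t).
Proof.
move=> M0 mf_ mg_ Lf mg cf cg; have mf := L2_meas Lf.
have gM : almost_everywhereT (fun t => normc (g t) <= M).
  exact: cvgL2_ae_le mg_ (@measurable_cst _ _ _ _ _ M) mg cg.
have c1 : cvgL2 U (fun i t => g_ i t * (f_ i t - f t)) (cst 0).
  apply: (@cvgL2_le _ _ _ f_ _ f _ (M ^+ 2)) => //; first exact: sqr_ge0.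
  apply: filterS2 mf_ mg_ => i /= mfi [mgi giM].
  rewrite [X in (sqnorm X <= _)%E](_ : _ = (fun t => g_ i t * (f_ i t - f t))).
    by apply: sqnormM_le => //; exact: measurableCB.
  by apply/funext => t /=; rewrite subr0.
have c2 : cvgL2 U (fun i t => (g_ i t - g t) * f t) (cst 0).
  apply: (@cvgL2_truncation _ _ _ _ _ (M + M)) => //; first exact: addr_ge0.
  - apply: filterS mg_ => i /= [mgi giM]; split; first exact: measurableCB.
    apply: aeT_imp2 giM gM _ => t _ h1 h2.
    by rewrite (le_trans (normc_triangle _ _))// normcN lerD.
  - move=> e e0; apply: filterS (cg _ e0) => i /=.
    by under [in X in X -> _]eq_fun do rewrite -[_ - _]subr0.
have m1 : U [set i | measurableC (fun t => g_ i t * (f_ i t - f t))].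
  apply: filterS2 mf_ mg_ => i /= mfi [mgi _].
  by apply: measurableCM => //; exact: measurableCB.
have m2 : U [set i | measurableC (fun t => (g_ i t - g t) * f t)].
  apply: filterS mg_ => i /= [mgi _].
  by apply: measurableCM => //; exact: measurableCB.
have h := cvgL2D m1 m2 (measurableC_cst 0) (measurableC_cst 0) c1 c2.
move=> e e0; have := h FU e e0; apply: filterS => i /=.
rewrite [X in (sqnorm X <= _)%E -> _](_ : _ = (fun t => g_ i t * f_ i t - g t * f t))//.
by apply/funext => t /=; ring.
Qed.

End SquareIntegrable.

(** * Completeness of L^2 *)

Section Completeness.
Variable R : realType.
Local Notation mu := (@lebesgue_measure R).
Local Notation C := R[i].
Local Notation circle := (@circle R).
Let mcircle := @measurable_circle R.
#[local] Hint Resolve mcircle : core.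

Lemma real_cauchy (u : nat -> R) :
  (forall e, 0 < e -> exists N, forall m n, (N <= m)%N -> (N <= n)%N -> `|u m - u n| <= e) ->
  exists l : R, u @ \oo --> l.
Proof.
move=> H; suff : cvg (u @ \oo) by move=> cu; exists (lim (u @ \oo)).
apply: cauchy_cvg; apply: cauchy_exP => e e0.
have [N HN] := H (e / 2) (divr_gt0 e0 (ltr0Sn _ _)).
exists (u N); exists N => // n /= Nn; rewrite /ball/=.
by rewrite (le_lt_trans (HN _ _ (leqnn _) Nn))// ltr_pdivrMr// ltr_pMr// ltr1n.
Qed.

Lemma complex_cauchy (u : nat -> C) :
  (forall e, 0 < e -> exists N, forall m n, (N <= m)%N -> (N <= n)%N -> normc (u m - u n) <= e) ->
  exists l, (fun n => normc (u n - l)) @ \oo --> (0 : R).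
Proof.
move=> H.
have [a ha] : exists l : R, (fun n => complex.Re (u n)) @ \oo --> l.
  apply: real_cauchy => e /H[N HN]; exists N => m n Nm Nn.
  by rewrite -raddfB (le_trans (normr_Re_le _))// HN.
have [b hb] : exists l : R, (fun n => complex.Im (u n)) @ \oo --> l.
  apply: real_cauchy => e /H[N HN]; exists N => m n Nm Nn.
  by rewrite -raddfB (le_trans (normr_Im_le _))// HN.
exists (Complex a b); apply/cvgrPdist_le => e e0; near=> n.
rewrite sub0r normrN ger0_norm ?normc_ge0// (le_trans (normc_le_ReIm _))//.
rewrite (splitr e) !raddfB/= lerD// distrC; near: n.
- by move/cvgrPdist_le : ha; apply; rewrite divr_gt0.
- by move/cvgrPdist_le : hb; apply; rewrite divr_gt0.
Unshelve. all: by end_near. Qed.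

Lemma normc_cvg_le (u : nat -> C) l w (M : R) :
  (fun n => normc (u n - l)) @ \oo --> (0 : R) ->
  (\forall n \near \oo, normc (u n - w) <= M) -> normc (l - w) <= M.
Proof.
move=> ul uM; apply/ler_addgt0Pl => e e0.
have h1 : \forall n \near \oo, normc (u n - l) <= e.
  move/cvgrPdist_le : ul => /(_ _ e0); apply: filterS => n.
  by rewrite sub0r normrN ger0_norm// normc_ge0.
have [n [a b]] := @filter_ex _ _ _ _ (filterI h1 uM).
rewrite -(subrK (u n) l) -addrA (le_trans (normc_triangle _ _))//.
by rewrite normcB lerD.
Qed.

Lemma geometric_sum_le (r : R) m n : 0 <= r < 1 ->
  \sum_(m <= i < n) r ^+ i <= r ^+ m / (1 - r).
Proof.
move=> /andP[r0 r1]; have r10 : 0 < 1 - r by rewrite subr_gt0.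
have [mn|/ltnW nm] := leqP m n; last first.
  by rewrite big_geq// divr_ge0 ?exprn_ge0// ltW.
rewrite ler_pdivlMr// -(subnKC mn).
suff -> : (\sum_(m <= i < m + (n - m)) r ^+ i) * (1 - r) = r ^+ m - r ^+ (m + (n - m)).
  by rewrite gerBl exprn_ge0.
elim: (n - m)%N => [|k IH]; first by rewrite addn0 big_geq// mul0r subrr.
by rewrite addnS big_nat_recr ?leq_addr//= mulrDl IH exprS; ring.
Qed.

Lemma normc_telescope (u : nat -> C) (a : nat -> R) m n : (m <= n)%N ->
  (forall i, normc (u i.+1 - u i) <= a i) ->
  normc (u n - u m) <= \sum_(m <= i < n) a i.
Proof.
move=> mn H; rewrite -(subnKC mn); elim: (n - m)%N => [|k IH].
  by rewrite addn0 subrr normc0 big_geq.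
rewrite addnS big_nat_recr ?leq_addr//= addrC.
rewrite -(subrK (u (m + k)%N) (u (m + k).+1)) -addrA.
by rewrite (le_trans (normc_triangle _ _))// lerD.
Qed.

(* The weights 4^j in g make d_j = O(2^-j) at every point where g is finite,
   and the sqnorms of the d_j are at most 8^-j, so that g is integrable. *)
Lemma L2_complete (f_ : nat -> R -> C) : (forall n, L2 (f_ n)) ->
  (forall e : R, 0 < e -> exists N, forall m n, (N <= m)%N -> (N <= n)%N ->
     (sqnorm (fun t => f_ m t - f_ n t)%R <= e%:E)%E) ->
  exists f, L2 f /\ cvgL2 \oo f_ f.
Proof.
move=> Lf H.
have [N HN] : exists N : nat -> nat, forall j m n, (N j <= m)%N -> (N j <= n)%N ->
     (sqnorm (fun t => f_ m t - f_ n t)%R <= ((8^-1 : R) ^+ j)%:E)%E.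
  have h j : exists N, forall m n, (N <= m)%N -> (N <= n)%N ->
     (sqnorm (fun t => f_ m t - f_ n t)%R <= ((8^-1 : R) ^+ j)%:E)%E.
    by apply: H; rewrite exprn_gt0.
  by have [N HN] := choice h; exists N.
pose k j := (\sum_(i < j.+1) N i)%N.
have kN j : (N j <= k j)%N by rewrite /k big_ord_recr leq_addl.
have kS j : (k j <= k j.+1)%N by rewrite {2}/k big_ord_recr leq_addr.
pose d j t := f_ (k j.+1) t - f_ (k j) t.
have mf n : measurableC (f_ n) by exact: L2_meas.
have md j : measurableC (d j) by exact: measurableCB.
have hd j : (sqnorm (d j) <= ((8^-1 : R) ^+ j)%:E)%E.
  by apply: HN => //; exact: leq_trans (kS _).
pose a j t : \bar R := (4 ^+ j * normc (d j t) ^+ 2)%:E.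
have a0 j t : (0 <= a j t)%E by rewrite lee_fin; apply: mulr_ge0; [exact: exprn_ge0|exact: sqr_ge0].
have ma j : measurable_fun circle (a j).
  apply/measurable_EFinP; apply: measurable_funM; first exact: measurable_cst.
  exact: measurable_normc2.
pose g t := (\sum_(0 <= j <oo) a j t)%E.
have mg : measurable_fun circle g.
  by apply: (@ge0_emeasurable_sum _ _ _ circle a xpredT).
have g0 t : (0 <= g t)%E by apply: nneseries_ge0 => j _ _; exact: a0.
have ig : (\int[mu]_(t in circle) g t <= 2%:E)%E.
  rewrite (@integral_nneseries _ _ _ mu)//.
  apply: (@le_trans _ _ (\sum_(0 <= j <oo) ((2^-1 : R) ^+ j)%:E)%E).
    apply: lee_nneseries => [j _ _|j _]; first exact: integral_ge0.
    rewrite (_ : (\int[mu]_(t in circle) a j t = (4 ^+ j)%:E * sqnorm (d j))%E).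
      apply: (@le_trans _ _ ((4 ^+ j)%:E * ((8^-1 : R) ^+ j)%:E)%E).
        by apply: lee_wpmul2l; rewrite ?hd// lee_fin exprn_ge0.
      rewrite -EFinM lee_fin -exprMn (_ : 4 / 8 = 2^-1 :> R)//; by field.
    rewrite /sqnorm -(@ge0_integralZl_EFin _ _ _ mu)//.
    - by move=> t _; rewrite lee_fin sqr_ge0.
    - by apply/measurable_EFinP; exact: measurable_normc2.
  apply: lime_le; first by apply: is_cvg_nneseries => j _ _; rewrite lee_fin exprn_ge0.
  apply: nearW => n; rewrite sumEFin lee_fin (le_trans (geometric_sum_le 0 n _))//.
    by apply/andP; split; [|rewrite invf_lt1// ltr1n].
  by rewrite expr0 lter_pdivrMr; lra.
have gfin : almost_everywhereT (fun t => (g t < +oo)%E).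
  have : mu.-integrable circle g.
    apply/integrableP; split => //.
    rewrite (_ : (\int[mu]_(x in circle) _ = \int[mu]_(x in circle) g x)%E).
      by rewrite (le_lt_trans ig)// ltry.
    by apply: eq_integral => t _; rewrite gee0_abs.
  move=> ig'; apply: (aeT_imp (@integrable_ae _ _ _ mu _ mcircle _ ig')) => t _.
  by rewrite ge0_fin_numE.
pose A := circle `&` [set t | (g t < +oo)%E].
have mA : measurable A.
  by apply: emeasurable_fun_infty_o.
(* Cutting off by the indicator of A, where the series g is finite, makes the subsequence converge
   at every point, so that its limit is measurable. *)
pose p j t := f_ (k j) t * (\1_A t)%:C%C.
have mp j : measurableC (p j).
  apply: measurableCM => //; apply: measurableC_real.
  exact: measurable_indic.
have pd t : A t -> forall i j, (i <= j)%N ->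
    normc (f_ (k j) t - f_ (k i) t) <= 2 * Num.sqrt (fine (g t)) * (2^-1) ^+ i.
  move=> [_ gt] i j ij; set s := Num.sqrt _.
  have gE : g t = (fine (g t))%:E by rewrite fineK// ge0_fin_numE.
  have dj l : normc (d l t) <= s * (2^-1) ^+ l.
    apply: ler_sqr_le; first by rewrite mulr_ge0 ?sqrtr_ge0// exprn_ge0.
    rewrite exprMn sqr_sqrtr ?fine_ge0// -exprM mulnC exprM.
    have : (a l t <= g t)%E.
      rewrite /g (@nneseriesD1 _ (a^~ t) l xpredT)//.
      by rewrite leeDl// nneseries_ge0.
    rewrite gE lee_fin => h.
    rewrite (_ : 2^-1 ^+ 2 = 4^-1 :> R); last by field.
    by rewrite exprVn ler_pdivlMr ?exprn_gt0// mulrC.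
  apply: (le_trans (normc_telescope (u := fun j => f_ (k j) t) ij dj)).
  rewrite -mulr_sumr; apply: (@le_trans _ _ (s * ((2^-1) ^+ i / (1 - 2^-1)))).
    apply: ler_wpM2l; first exact: sqrtr_ge0.
    by apply: geometric_sum_le; apply/andP; split; [|rewrite invf_lt1// ltr1n].
  by rewrite (_ : 1 - 2^-1 = 2^-1 :> R) ?invrK; [lra|field].
have [f hf] : exists f : R -> C, forall t, circle t ->
    (fun j => normc (p j t - f t)) @ \oo --> (0 : R).
  suff h t : exists l, circle t -> (fun j => normc (p j t - l)) @ \oo --> (0 : R).
    by have [f hf] := choice h; exists f.
  suff [l hl] : exists l, (fun j => normc (p j t - l)) @ \oo --> (0 : R).
    by exists l.
  apply: complex_cauchy => e e0.
  have [At|At] := pselect (A t); last first.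
    exists 0%N => m n _ _; rewrite /p indicE memNset// !mulr0 subrr normc0.
    exact: ltW.
  have h0 : (fun n => 4 * Num.sqrt (fine (g t)) * (2^-1) ^+ n) @ \oo --> (0 : R).
    rewrite -[X in _ --> X](mulr0 (4 * Num.sqrt (fine (g t)))); apply: cvgMr.
    by apply: cvg_expr; rewrite ger0_norm// invf_lt1// ltr1n.
  move/cvgrPdist_le : h0 => /(_ e e0)[N0 _ hN0]; exists N0 => m n Nm Nn.
  have := hN0 _ (leqnn N0); rewrite /= sub0r normrN; apply: le_trans.
  rewrite (le_trans _ (ler_norm _))//.
  rewrite /p indicE mem_set// !mulr1.
  have := pd t At _ _ Nm; have := pd t At _ _ Nn.
  rewrite [X in X <= _ -> _]normcB => h1 h2.
  rewrite -(subrK (f_ (k N0) t) (f_ (k m) t)) -addrA.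
  by rewrite (le_trans (normc_triangle _ _))//; lra.
have mf' : measurableC f by exact: measurableC_cvg hf.
(* On A, |f_(k j) - f|^2 <= 4 * 4^-j * g by [pd], and the integral of g is at most 2. *)
have fd j : (sqnorm (fun t => f_ (k j) t - f t)%R <= (8 * (4^-1) ^+ j)%:E)%E.
  apply: (@le_trans _ _ (\int[mu]_(t in circle) ((4 * (4^-1) ^+ j)%:E * g t))%E).
    apply: (@ae_ge0_le_integral _ _ _ mu) => //.
    - by move=> t _; rewrite lee_fin sqr_ge0.
    - by apply/measurable_EFinP; apply: measurable_normc2; exact: measurableCB.
    - by move=> t _; rewrite mule_ge0// lee_fin mulr_ge0// exprn_ge0.
    - exact: measurable_funeM.
    - apply: (aeT_imp gfin) => t ct gt; have At : A t by [].
      have gE : g t = (fine (g t))%:E by rewrite fineK// ge0_fin_numE.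
      rewrite gE -EFinM lee_fin.
      have : normc (f t - f_ (k j) t) <= 2 * Num.sqrt (fine (g t)) * (2^-1) ^+ j.
        apply: (normc_cvg_le (hf _ ct)); exists j => // n /= jn.
        by rewrite /p indicE mem_set// !mulr1; exact: pd.
      rewrite normcB => h.
      rewrite (_ : _ * fine _ = (2 * Num.sqrt (fine (g t)) * (2^-1) ^+ j) ^+ 2).
        by rewrite ler_pXn2r// nnegrE ?normc_ge0// !mulr_ge0 ?sqrtr_ge0// exprn_ge0.
      rewrite !exprMn sqr_sqrtr ?fine_ge0// -exprM mulnC exprM.
      rewrite (_ : 2^-1 ^+ 2 = 4^-1 :> R); [|by field]; ring.
  rewrite (@ge0_integralZl_EFin _ _ _ mu)//.
  apply: (@le_trans _ _ ((4 * 4^-1 ^+ j)%:E * 2%:E)%E).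
    by apply: lee_wpmul2l => //; rewrite lee_fin mulr_ge0// exprn_ge0.
  by rewrite -EFinM lee_fin; lra.
exists f; split.
  have -> : f = (fun t => f_ (k 0%N) t - (f_ (k 0%N) t - f t)).
    by apply/funext => t; rewrite subKr.
  apply: L2B => //; split; first exact: measurableCB.
  by rewrite (le_lt_trans (fd 0%N))// ltry.
move=> e e0.
have h0 : (fun j => 18 * (4^-1) ^+ j) @ \oo --> (0 : R).
  rewrite -[X in _ --> X](mulr0 18); apply: cvgMr.
  by apply: cvg_expr; rewrite ger0_norm// invf_lt1// ltr1n.
move/cvgrPdist_le : h0 => /(_ e e0)[j _ /(_ _ (leqnn j))/=].
rewrite sub0r normrN => /(le_trans (ler_norm _)) hj.
exists (N j) => // n /= jn.
apply: (le_trans (sqnorm_triangle (mf n) (mf (k j)) mf')).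
apply: (@le_trans _ _ (2%:E * (8^-1 ^+ j)%:E + 2%:E * (8 * 4^-1 ^+ j)%:E)%E).
  by apply: leeD; apply: lee_wpmul2l => //; exact: HN.
rewrite -!EFinM -EFinD lee_fin; apply: le_trans hj.
have : 8^-1 ^+ j <= 4^-1 ^+ j :> R.
  by rewrite lerXn2r// ?nnegrE ?invr_ge0// lef_pV2// ?posrE// ler_nat.
lra.
Qed.

End Completeness.

(** * Fourier coefficients and Bessel's inequality *)

Section FourierCoefficients.
Variable R : realType.
Local Notation mu := (@lebesgue_measure R).
Local Notation C := R[i].
Local Notation circle := (@circle R).
Local Notation int1 f := (mu.-integrable circle (EFin \o f)).
Implicit Types (f g h : R -> C) (u v : R -> R).
Let mcircle := @measurable_circle R.
#[local] Hint Resolve mcircle : core.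

Definition cint1 f := int1 (fun t => complex.Re (f t)) /\ int1 (fun t => complex.Im (f t)).

Lemma cint1_normc f : measurableC f -> int1 (fun t => normc (f t)) -> cint1 f.
Proof.
move=> [m1 m2] iff; split; apply: int1_le iff _ => // t _.
- exact: normr_Re_le.
- exact: normr_Im_le.
Qed.

Lemma int1_Rint_normc f : cint1 f -> measurableC f -> int1 (fun t => normc (f t)).
Proof.
move=> [m1 m2] mf; apply: (@int1_le _ _ (fun t => `|complex.Re (f t)| + `|complex.Im (f t)|)).
- exact: measurable_normc.
- by apply: int1D; apply: (@integrable_norm _ _ _ mu).
- by move=> t _; rewrite ger0_norm ?normc_ge0// normc_le_ReIm.
Qed.

Lemma cintegralD f g : cint1 f -> cint1 g ->
  cintegral (fun t => f t + g t) = cintegral f + cintegral g.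
Proof.
move=> [f1 f2] [g1 g2]; rewrite /cintegral; simpc; congr Complex.
- rewrite -(@RintegralD _ _ _ mu)//; apply: eq_Rintegral => t _; exact: raddfD.
- rewrite -(@RintegralD _ _ _ mu)//; apply: eq_Rintegral => t _; exact: raddfD.
Qed.

Lemma cint1D f g : cint1 f -> cint1 g -> cint1 (fun t => f t + g t).
Proof.
move=> [f1 f2] [g1 g2]; split.
- rewrite (_ : (fun t => _) = (fun t => complex.Re (f t) + complex.Re (g t))).
    exact: int1D.
  by apply/funext => t; exact: raddfD.
- rewrite (_ : (fun t => _) = (fun t => complex.Im (f t) + complex.Im (g t))).
    exact: int1D.
  by apply/funext => t; exact: raddfD.
Qed.

Lemma ReM (z w : C) : complex.Re (z * w) =
  complex.Re z * complex.Re w - complex.Im z * complex.Im w.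
Proof. by case: z w => [a b] [c d]. Qed.

Lemma ImM (z w : C) : complex.Im (z * w) =
  complex.Re z * complex.Im w + complex.Im z * complex.Re w.
Proof. by case: z w => [a b] [c d]. Qed.

Lemma cint1Z (k : C) f : cint1 f -> cint1 (fun t => k * f t).
Proof.
move=> [f1 f2]; split.
- rewrite (_ : (fun t => _) = (fun t => complex.Re k * complex.Re (f t) -
    complex.Im k * complex.Im (f t))); last by apply/funext => t; rewrite ReM.
  by apply: int1B; exact: int1Z.
- rewrite (_ : (fun t => _) = (fun t => complex.Re k * complex.Im (f t) +
    complex.Im k * complex.Re (f t))); last by apply/funext => t; rewrite ImM.
  by apply: int1D; exact: int1Z.
Qed.

Lemma cintegralZ (k : C) f : cint1 f -> cintegral (fun t => k * f t) = k * cintegral f.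
Proof.
move=> [f1 f2]; rewrite /cintegral; case: k => a b; simpc; congr Complex.
- rewrite -!(@RintegralZl _ _ _ mu)// -(@RintegralB _ _ _ mu)//; try exact: int1Z.
  by apply: eq_Rintegral => t _; rewrite ReM.
- rewrite -!(@RintegralZl _ _ _ mu)// -(@RintegralD _ _ _ mu)//; try exact: int1Z.
  by apply: eq_Rintegral => t _; rewrite ImM.
Qed.

Lemma cintegral_cst (k : C) : cintegral (fun=> k) = (pi *+ 2)%:C%C * k.
Proof.
rewrite /cintegral !(@Rintegral_cst _ _ _ mu)//.
rewrite -[X in fine X]/(mu circle) mu_circle/=.
by case: k => a b; simpc; congr Complex; rewrite mulrC.
Qed.

Lemma cint1_cst (k : C) : cint1 (fun=> k).
Proof. by split; exact: int1_cst. Qed.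

(** The factor 2 comes from bounding the real and imaginary parts separately; it is harmless in all
    the estimates below. *)
Lemma normc_cintegral_le f : measurableC f -> cint1 f ->
  normc (cintegral f) <= 2 * \int[mu]_(t in circle) normc (f t).
Proof.
move=> mf [f1 f2]; have fn := int1_Rint_normc (conj f1 f2) mf.
rewrite (le_trans (normc_le_ReIm _))//= mulr2n mulrDl mul1r.
by apply: lerD; apply: (le_trans (@le_normr_Rintegral _ _ _ mu _ _ mcircle _));
  rewrite ?f1 ?f2//; apply: le_Rint => //; (try exact: (@integrable_norm _ _ _ mu));
  apply: aeT_W => t _; rewrite ?normr_Re_le ?normr_Im_le.
Qed.

Lemma int1M_L2 f g : L2 f -> L2 g -> int1 (fun t => normc (f t) * normc (g t)).
Proof.
move=> Lf Lg; apply: (@int1_le _ _ (fun t => normc (f t) ^+ 2 + normc (g t) ^+ 2)).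
- by apply: measurable_funM; apply: measurable_normc; exact: L2_meas.
- by apply: int1D; exact: L2_int1.
- move=> t _; rewrite ger0_norm ?mulr_ge0 ?normc_ge0//.
  have := sqr_ge0 (normc (f t) - normc (g t)).
  by have := normc_ge0 (f t); have := normc_ge0 (g t); nra.
Qed.

Lemma cint1_L2M f g : L2 f -> L2 g -> cint1 (fun t => f t * g t).
Proof.
move=> Lf Lg; apply: cint1_normc; first by apply: measurableCM; exact: L2_meas.
rewrite (_ : (fun t => _) = (fun t => normc (f t) * normc (g t))).
  exact: int1M_L2.
by apply/funext => t; rewrite normcM.
Qed.

Lemma cint1_inner f g : L2 f -> L2 g -> cint1 (fun t => f t * conjc (g t)).
Proof. by move=> Lf Lg; apply: cint1_L2M => //; exact: L2J. Qed.

Lemma innerDl f g h : L2 f -> L2 g -> L2 h ->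
  inner (fun t => f t + g t) h = inner f h + inner g h.
Proof.
move=> Lf Lg Lh; rewrite /inner -mulrDr -cintegralD; try exact: cint1_inner.
by congr (_ * cintegral _); apply/funext => t; rewrite mulrDl.
Qed.

Lemma innerZl (k : C) f h : L2 f -> L2 h ->
  inner (fun t => k * f t) h = k * inner f h.
Proof.
move=> Lf Lh; rewrite /inner mulrCA -(cintegralZ k); try exact: cint1_inner.
by congr (_ * cintegral _); apply/funext => t; rewrite mulrA.
Qed.

Lemma innerBl f g h : L2 f -> L2 g -> L2 h ->
  inner (fun t => f t - g t) h = inner f h - inner g h.
Proof.
move=> Lf Lg Lh; have -> : (fun t => f t - g t) = (fun t => f t + -1 * g t).
  by apply/funext => t; rewrite mulN1r.
by rewrite innerDl ?innerZl ?mulN1r//; exact: L2Z.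
Qed.

Lemma conjc_cintegral f : int1 (fun t => complex.Im (f t)) ->
  conjc (cintegral f) = cintegral (fun t => conjc (f t)).
Proof.
move=> i2; rewrite /cintegral/=; congr Complex.
  by apply: eq_Rintegral => t _; case: (f t).
rewrite -[LHS]mulN1r -(@RintegralZl _ _ _ mu)//.
by apply: eq_Rintegral => t _; case: (f t) => a b /=; rewrite mulN1r.
Qed.

Lemma conjcM (z w : C) : conjc (z * w) = conjc z * conjc w.
Proof. exact: rmorphM. Qed.

Lemma conjcB (z w : C) : conjc (z - w) = conjc z - conjc w.
Proof. exact: rmorphB. Qed.

Lemma conjcX (z : C) n : conjc (z ^+ n) = conjc z ^+ n.
Proof. exact: rmorphXn. Qed.

Lemma innerC f g : L2 f -> L2 g -> inner g f = conjc (inner f g).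
Proof.
move=> Lf Lg; rewrite /inner conjcM conjc_cintegral; last first.
  by case: (cint1_inner Lf Lg).
rewrite conjc_real; congr (_ * cintegral _); apply/funext => t.
by rewrite conjcM conjcK mulrC.
Qed.

Lemma inner_aeT f g h : measurableC f -> measurableC g -> measurableC h -> aeT f g ->
  inner f h = inner g h.
Proof.
move=> mf mg mh fg; congr (_ * _).
have [a1 a2] := measurableCM mf (measurableCJ mh).
have [b1 b2] := measurableCM mg (measurableCJ mh).
by congr Complex; apply: Rint_ae => //; apply: aeT_imp fg _ => t _ ->.
Qed.

(** The real-valued companion of [sqnorm], meaningful for f in [L2]: an infinite integral would be
    sent to 0 by [fine]. *)
Definition rnorm2 f : R := \int[mu]_(t in circle) (normc (f t) ^+ 2).

Lemma rnorm2_ge0 f : 0 <= rnorm2 f.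
Proof. by apply: Rintegral_ge0 => t _; rewrite sqr_ge0. Qed.

Lemma inner_self f : L2 f -> inner f f = ((pi *+ 2)^-1 * rnorm2 f)%:C%C.
Proof.
move=> Lf; rewrite /inner rmorphM/=; congr (_ * _).
rewrite /cintegral; congr Complex.
  by apply: eq_Rintegral => t _; rewrite mulcJ.
rewrite -[RHS](mul0r (fine (mu circle))) -(@Rintegral_cst _ _ _ mu)//.
by apply: eq_Rintegral => t _; rewrite mulcJ.
Qed.

Lemma Rint_derive u v : continuous u -> (forall t : R, is_derive t 1 v (u t)) ->
  \int[mu]_(t in circle) u t = v (pi *+ 2) - v 0.
Proof.
move=> cu dv; have cv : continuous v.
  by move=> t; apply: differentiable_continuous; apply/derivable1_diffP.
rewrite /Rintegral /Defs.circle integral_itv_bndo_bndc; last first.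
  apply/measurable_EFinP; apply: measurable_funTS.
  exact: continuous_measurable_fun.
rewrite (@continuous_FTC2 _ u v) ?pi2_gt0//.
- exact: continuous_subspaceT.
- split; first by move=> t _; have [] := dv t.
  + by apply: cvg_at_right_filter; exact: cv.
  + by apply: cvg_at_left_filter; exact: cv.
- by move=> t _; rewrite derive1E (@derive_val _ _ _ _ _ _ _ (dv t)).
Qed.

Lemma Rint_trig n : (0 < n)%N ->
  \int[mu]_(t in circle) (cos (t *+ n)) = 0 /\ \int[mu]_(t in circle) (sin (t *+ n)) = 0.
Proof.
move=> n0; have nn0 : (n%:R : R) != 0 by rewrite pnatr_eq0 -lt0n.
have dn (t : R) : is_derive t 1 (fun s : R => s *+ n) n%:R.
  rewrite (_ : (fun s : R => s *+ n) = n%:R \*: (id : R -> R)).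
    by apply: is_derive_eq; rewrite /GRing.scale/= mulr1.
  by apply/funext => s /=; rewrite /GRing.scale/= mulr_natl.
have cn : continuous (fun s : R => s *+ n) by exact: natmul_continuous.
have ds (t : R) : is_derive t 1 (fun t => n%:R^-1 * sin (t *+ n)) (cos (t *+ n)).
  have d1 := @is_derive1_comp _ sin (fun s => s *+ n) t _ _ (is_derive_sin (t *+ n)) (dn t).
  by have := is_deriveZ n%:R^-1 d1; rewrite /GRing.scale/= mulrCA mulVf// mulr1.
have dc (t : R) : is_derive t 1 (fun t => - n%:R^-1 * cos (t *+ n)) (sin (t *+ n)).
  have d1 := @is_derive1_comp _ cos (fun s => s *+ n) t _ _ (is_derive_cos (t *+ n)) (dn t).
  have h := is_deriveZ (- n%:R^-1) d1; apply: (is_derive_eq h).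
  transitivity (- n%:R^-1 * (- sin (t *+ n) * n%:R)) => //.
  by rewrite mulNr mulNr mulrN opprK mulrCA mulVf// mulr1.
split.
- have cc : continuous (fun s : R => cos (s *+ n)).
    by move=> t; apply: continuous_comp; [exact: cn|exact: continuous_cos].
  rewrite (Rint_derive cc ds) mul0rn sin0 -[(pi *+ 2) *+ n]add0r.
  by rewrite (periodicn (@sinD2pi R)) sin0 mulr0 subrr.
- have cs : continuous (fun s : R => sin (s *+ n)).
    by move=> t; apply: continuous_comp; [exact: cn|exact: continuous_sin].
  rewrite (Rint_derive cs dc) mul0rn cos0 -[(pi *+ 2) *+ n]add0r.
  by rewrite (periodicn (@cosD2pi R)) cos0 subrr.
Qed.

(** Nonnegative frequencies are enough: H^2 will be described as the set of the f that are the sum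
    of this half of their Fourier series. *)
Definition fcoef f (k : nat) : C := inner f (fun t => cis t ^+ k).

Lemma L2_cisX n : L2 (fun t => cis t ^+ n : C).
Proof.
apply: Linfty_L2; split; first by apply: measurableCX; exact: measurableC_cis.
by exists 1; apply: aeT_W => t _; rewrite normcX normc_cis expr1n.
Qed.

Lemma fcoef_cisX n k : fcoef (fun t => cis t ^+ n) k = (n == k)%:R.
Proof.
wlog kn : n k / (k <= n)%N.
  move=> H; have [|/ltnW nk] := leqP k n; first exact: H.
  rewrite /fcoef (innerC (L2_cisX k) (L2_cisX n)) -/(fcoef _ _) (H _ _ nk) eq_sym.
  by case: (_ == _); rewrite ?conjc1 ?conjc0.
rewrite /fcoef /inner.
have E (t : R) : cis t ^+ n * conjc (cis t ^+ k) = cis (t *+ (n - k)).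
  rewrite -{1}(subnKC kn) exprD conjcX mulrAC -exprMn cis_mulJ expr1n mul1r.
  by rewrite cisX.
under [X in cintegral X]eq_fun do rewrite E.
have [<-|nk] := eqVneq n k.
  rewrite subnn; under [X in cintegral X]eq_fun do rewrite mulr0n cis0.
  by rewrite cintegral_cst mulr1 -rmorphM/= mulVf// gt_eqF// pi2_gt0.
have /Rint_trig[h1 h2] : (0 < n - k)%N by rewrite subn_gt0 ltn_neqAle eq_sym nk.
by rewrite /cintegral/= h1 h2 mulr0.
Qed.

Definition trig (c : nat -> C) n t : C := \sum_(k < n) c k * cis t ^+ k.

Lemma L2_trig c n : L2 (trig c n).
Proof.
elim: n => [|n IH].
  rewrite (_ : trig c 0 = fun=> 0); first exact: L2_cst.
  by apply/funext => t; rewrite /trig big_ord0.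
rewrite (_ : trig c n.+1 = fun t => trig c n t + c n * cis t ^+ n).
  by apply: L2D => //; apply: L2Z; exact: L2_cisX.
by apply/funext => t; rewrite /trig big_ord_recr.
Qed.

Lemma fcoefB f g k : L2 f -> L2 g ->
  fcoef (fun t => f t - g t) k = fcoef f k - fcoef g k.
Proof. by move=> Lf Lg; apply: innerBl => //; exact: L2_cisX. Qed.

Lemma fcoef_trig c n k : fcoef (trig c n) k = if (k < n)%N then c k else 0.
Proof.
elim: n => [|n IH].
  rewrite (_ : trig c 0 = fun t => 0 * (cis t ^+ 0)).
    by rewrite /fcoef innerZl ?mul0r//; exact: L2_cisX.
  by apply/funext => t; rewrite /trig big_ord0 mul0r.
rewrite (_ : trig c n.+1 = fun t => trig c n t + c n * cis t ^+ n).
  have Le := L2_cisX n; have Lk := L2_cisX k; have Lz := L2Z (c n) Le.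
  rewrite /fcoef (innerDl (L2_trig c n) Lz Lk) (innerZl _ Le Lk) -!/(fcoef _ k).
  rewrite IH fcoef_cisX.
  rewrite ltnS; case: (ltngtP n k) => [nk|kn|->].
  - by rewrite mulr0 addr0.
  - by rewrite mulr0 addr0.
  - by rewrite mulr1 add0r.
by apply/funext => t; rewrite /trig big_ord_recr.
Qed.

(** Pythagoras for a single exponential. Besides Bessel's inequality it gives, for n = 0, the
    distance from a function to its mean value, which is how functions are later shown to be
    constant or close to a constant. *)
Lemma rnorm2_sub_cisX f n : L2 f ->
  rnorm2 (fun t => f t - fcoef f n * cis t ^+ n) =
  rnorm2 f - pi *+ 2 * normc (fcoef f n) ^+ 2.
Proof.
move=> Lf; set c := fcoef f n.
have Le : L2 (fun t => c * cis t ^+ n) by apply: L2Z; exact: L2_cisX.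
have Ln := L2_cisX n.
have LB := L2B Lf Le.
have ef : inner (fun t => cis t ^+ n) f = conjc c by rewrite (innerC Lf Ln).
have eB : inner (fun t => cis t ^+ n) (fun t => f t - c * cis t ^+ n) = 0.
  rewrite (innerC LB Ln) -/(fcoef _ n) fcoefB// -/c.
  rewrite /fcoef innerZl// -/(fcoef _ n) fcoef_cisX eqxx mulr1 subrr.
  exact: conjc0.
have fB : inner f (fun t => f t - c * cis t ^+ n) = inner f f - c * conjc c.
  rewrite (innerC LB Lf) innerBl// innerZl// ef conjcB -(innerC Lf Lf).
  by rewrite (conjcM c) conjcK mulrC.
have := inner_self LB; rewrite innerBl// innerZl// eB mulr0 subr0 fB.
rewrite inner_self// mulcJ -rmorphB/= => /complexI h.
have p0 : (pi : R) *+ 2 != 0 by rewrite gt_eqF// pi2_gt0.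
apply: (mulfI (invr_neq0 p0)); rewrite -h mulrBr; congr (_ - _).
by rewrite mulrA mulVf// mul1r.
Qed.

Lemma bessel_eq f n : L2 f ->
  rnorm2 (fun t => f t - trig (fcoef f) n t) =
  rnorm2 f - pi *+ 2 * \sum_(k < n) normc (fcoef f k) ^+ 2.
Proof.
move=> Lf; elim: n => [|n IH].
  rewrite big_ord0 mulr0 subr0; congr rnorm2; apply/funext => t.
  by rewrite /trig big_ord0 subr0.
have LB : L2 (fun t => f t - trig (fcoef f) n t) by apply: L2B => //; exact: L2_trig.
have := rnorm2_sub_cisX n LB.
rewrite fcoefB//; last exact: L2_trig.
rewrite fcoef_trig ltnn subr0 IH big_ord_recr/= mulrDr opprD addrA => <-.
congr rnorm2; apply/funext => t.
by rewrite /trig big_ord_recr/= opprD addrA.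
Qed.

Lemma bessel f n : L2 f ->
  pi *+ 2 * \sum_(k < n) normc (fcoef f k) ^+ 2 <= rnorm2 f.
Proof. by move=> Lf; rewrite -subr_ge0 -bessel_eq// rnorm2_ge0. Qed.

(** The remainder in [bessel_eq] vanishes for a trigonometric polynomial. *)
Lemma rnorm2_trig c n : rnorm2 (trig c n) = pi *+ 2 * \sum_(k < n) normc (c k) ^+ 2.
Proof.
have := bessel_eq n (L2_trig c n).
rewrite (_ : (fun t => _) = fun=> 0); last first.
  apply/funext => t; apply/eqP; rewrite subr_eq0; apply/eqP.
  by apply: eq_bigr => k _; rewrite fcoef_trig ltn_ord.
rewrite {1}/rnorm2; under eq_Rintegral do rewrite normc0 expr0n.
rewrite (@Rintegral_cst _ _ _ mu)// mul0r => /esym/eqP; rewrite subr_eq0 => /eqP ->.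
by congr (_ * _); apply: eq_bigr => k _; rewrite fcoef_trig ltn_ord.
Qed.

Lemma normc_fcoef f k : L2 f -> pi *+ 2 * normc (fcoef f k) ^+ 2 <= rnorm2 f.
Proof.
move=> Lf; apply: le_trans (bessel k.+1 Lf); rewrite big_ord_recr/=.
apply: ler_wpM2l; first by rewrite ltW// pi2_gt0.
by rewrite lerDr sumr_ge0// => i _; exact: sqr_ge0.
Qed.

Lemma sqnorm_rnorm2 f : L2 f -> sqnorm f = (rnorm2 f)%:E.
Proof. exact: sqnorm_EFin. Qed.

End FourierCoefficients.

(** * Approximation of the complex exponential by powers *)

Section ComplexExponential.
Variable R : realType.
Implicit Types (x y : R) (z w : R[i]).

Lemma sin_mean_value y : 0 < y -> exists c, 0 <= c <= y /\ sin y = cos c * y.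
Proof.
move=> y0; have [c] := @MVT_segment _ (@sin R) (@cos R) 0 y (ltW y0)
  (fun t _ => is_derive_sin t) (continuous_subspaceT (@continuous_sin R)).
by rewrite sin0 !subr0 in_itv/= => c0y h; exists c.
Qed.

Lemma normr_sin_le y : `|sin y| <= `|y|.
Proof.
wlog y0 : y / 0 < y => [H|].
  have [y0|y0|y0] := ltrgtP 0 y; first exact: H.
    by rewrite -normrN -[`|y|]normrN -sinN H// oppr_gt0.
  by rewrite -y0 sin0.
have [c [_ ->]] := sin_mean_value y0.
by rewrite normrM ler_piMl// ler_norml cos_geN1 cos_le1.
Qed.

Lemma normr_1Bcos_le y : `|1 - cos y| <= y ^+ 2.
Proof.
have -> : 1 - cos y = sin (y / 2) ^+ 2 *+ 2.
  have {1}-> : y = (y / 2) *+ 2 by rewrite -mulr_natr divfK.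
  by rewrite cos_mulr2n; have := cos2Dsin2 (y / 2); lra.
rewrite ger0_norm ?mulrn_wge0 ?sqr_ge0//.
have h : sin (y / 2) ^+ 2 <= (y / 2) ^+ 2.
  rewrite -real_normK ?num_real// -[leRHS]real_normK ?num_real//.
  by rewrite lerXn2r// ?nnegrE// normr_sin_le.
by have := sqr_ge0 y; move: h; rewrite exprMn exprVn; lra.
Qed.

Lemma normr_sinB_le y : `|y| <= 1 -> `|sin y - y| <= y ^+ 2.
Proof.
wlog y0 : y / 0 < y => [H|].
  have [y0|y0|y0] := ltrgtP 0 y; first exact: H.
    have := H (- y); rewrite oppr_gt0 sinN sqrrN normrN => /(_ y0) H' /H'.
    by rewrite -opprD normrN.
  by rewrite -y0 sin0 subr0 normr0 expr0n.
rewrite (ger0_norm (ltW y0)) => y1.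
have [c [/andP[c0 cy] ->]] := sin_mean_value y0.
have -> : cos c * y - y = - ((1 - cos c) * y) by ring.
rewrite normrN normrM (ger0_norm (ltW y0)).
by have := normr_1Bcos_le c; have := normr_ge0 (1 - cos c); nra.
Qed.

Lemma expR_1B_le x : expR x * (1 - x) <= 1.
Proof.
have h : 1 - x <= expR (- x) by exact: expR_ge1Dx.
apply: (@le_trans _ _ (expR x * expR (- x))).
  by rewrite ler_wpM2l// expR_ge0.
by rewrite -expRD subrr expR0.
Qed.

Lemma expR_le2 x : x <= 1 / 2 -> expR x <= 2.
Proof. by move=> h; have := expR_1B_le x; have := expR_ge0 x; nra. Qed.

Lemma expRB_le x : `|x| <= 1 / 2 -> `|expR x - 1 - x| <= 2 * x ^+ 2.
Proof.
rewrite ler_norml => /andP[h1 h2]; have h3 := expR_1B_le x.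
have h4 : 0 <= expR x - 1 - x by have := expR_ge1Dx x; lra.
rewrite ger0_norm//.
have h5 : expR x * (1 - x) <= (1 + x + 2 * x ^+ 2) * (1 - x).
  by apply: le_trans h3 _; have := sqr_ge0 x; nra.
by move: h5; rewrite ler_pM2r; lra.
Qed.

(** Only the quadratic order matters: at z = s / n it gives an error O(1/n^2) for each of the n
    factors of [cexp s]. The constant 16 is generous and comes from separate bounds on the real and
    imaginary parts. *)
Lemma normc_cexpB_le z : normc z <= 1 / 2 -> normc (cexp z - 1 - z) <= 16 * normc z ^+ 2.
Proof.
case: z => x y h.
have hx : `|x| <= 1 / 2 by apply: le_trans h; exact: (normr_Re_le (Complex x y)).
have hy : `|y| <= 1 / 2 by apply: le_trans h; exact: (normr_Im_le (Complex x y)).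
apply: (le_trans (normc_le_ReIm _)); rewrite normc_sqr.
have -> : cexp (Complex x y) - 1 - Complex x y =
    Complex (expR x * cos y - 1 - x) (expR x * sin y - y).
  by rewrite /cexp /cis/=; simpc; congr Complex; ring.
rewrite /=.
have -> : expR x * cos y - 1 - x = (expR x - 1 - x) - expR x * (1 - cos y) by ring.
have -> : expR x * sin y - y = expR x * (sin y - y) + (expR x - 1 - x + x) * y by ring.
have E0 := expR_ge0 x.
have E2 : expR x <= 2 by apply: expR_le2; exact: le_trans (ler_norm _) hx.
have hE := expRB_le hx; have hc := normr_1Bcos_le y.
have hs : `|sin y - y| <= y ^+ 2 by apply: normr_sinB_le; lra.
have x2 : x ^+ 2 = `|x| ^+ 2 by rewrite real_normK ?num_real.
have y2 : y ^+ 2 = `|y| ^+ 2 by rewrite real_normK ?num_real.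
have k1 : `|expR x - 1 - x - expR x * (1 - cos y)| <= 2 * x ^+ 2 + 2 * y ^+ 2.
  rewrite (le_trans (ler_normB _ _))// lerD// normrM (ger0_norm E0).
  by rewrite ler_pM.
have k2 : `|expR x * (sin y - y) + (expR x - 1 - x + x) * y| <=
    2 * y ^+ 2 + (2 * x ^+ 2 + `|x|) * `|y|.
  rewrite (le_trans (ler_normD _ _))// lerD// normrM.
    by rewrite (ger0_norm E0) ler_pM.
  by rewrite ler_wpM2r// (le_trans (ler_normD _ _))// lerD.
apply: le_trans (lerD k1 k2) _; rewrite /= x2 y2.
move: hx hy (normr_ge0 x) (normr_ge0 y).
set X := `|x|; set Y := `|y| => X2 Y2 X0 Y0.
have a : X ^+ 2 * Y <= X ^+ 2 by rewrite ler_piMr ?sqr_ge0//; lra.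
have b : X * Y <= X ^+ 2 + Y ^+ 2 by have := sqr_ge0 (X - Y); nra.
by have := sqr_ge0 X; have := sqr_ge0 Y; nra.
Qed.

Lemma normc_cexp_le z : normc (cexp z) <= expR (normc z).
Proof.
by rewrite normc_cexp ler_expR (le_trans (ler_norm _))// normr_Re_le.
Qed.

Lemma normc_exprB_le (a b : R[i]) (m : R) n : normc a <= m -> normc b <= m ->
  normc (a ^+ n - b ^+ n) <= n%:R * m ^+ n.-1 * normc (a - b).
Proof.
move=> am bm; have m0 : 0 <= m by apply: le_trans am; exact: normc_ge0.
elim: n => [|n IH]; first by rewrite subrr normc0 !mul0r.
have -> : a ^+ n.+1 - b ^+ n.+1 = a * (a ^+ n - b ^+ n) + (a - b) * b ^+ n.
  by rewrite !exprS; ring.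
apply: le_trans (normc_triangle _ _) _; rewrite !normcM normcX /=.
have h1 : normc b ^+ n <= m ^+ n by rewrite lerXn2r// nnegrE normc_ge0.
have h2 : normc a * normc (a ^+ n - b ^+ n) <= n%:R * m ^+ n * normc (a - b).
  apply: le_trans (ler_pM (normc_ge0 _) (normc_ge0 _) am IH) _.
  rewrite !mulrA; case: n {IH h1} => [|n] /=; first by rewrite mulr0 !mul0r.
  by rewrite [m * _]mulrC -(mulrA _ m) -exprS.
rewrite -natr1 -(mulrA (n%:R + 1)) mulrDl mul1r mulrA; apply: lerD => //.
by rewrite mulrC ler_wpM2r// normc_ge0.
Qed.

(* cexp s = cexp (s / n) ^ n is compared with (1 + p / n) ^ n factor by factor. *)
Lemma cexp_pow_approx (B eta : R) (s p : R[i]) n : 0 <= B ->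
  (0 < n)%N -> 2 * B <= n%:R -> normc s <= B -> normc p <= B -> normc (s - p) <= eta ->
  normc (cexp s - (1 + n%:R^-1 * p) ^+ n) <= expR B * (16 * B ^+ 2 / n%:R + eta).
Proof.
move=> B0 n0 Bn sB pB sp.
have nR : 0 < n%:R :> R by rewrite ltr0n.
have nC : normc (n%:R^-1 : R[i]) = n%:R^-1.
  by rewrite normcV -[n%:R](rmorph_nat (real_complex R)) normcR ger0_norm.
have -> : s = (n%:R^-1 * s) *+ n.
  rewrite -mulr_natl mulrA mulfV ?mul1r//.
  by rewrite pnatr_eq0 -lt0n.
rewrite cexpMn; set v := n%:R^-1 * s.
have vB : normc v <= B / n%:R by rewrite normcM nC mulrC ler_wpM2r// invr_ge0 ltW.
have wB : normc (n%:R^-1 * p) <= B / n%:R by rewrite normcM nC mulrC ler_wpM2r// invr_ge0 ltW.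
have eB : expR (B / n%:R) ^+ n = expR B.
  by rewrite -expRM_natl mulrC divfK// gt_eqF.
have e1 : 1 <= expR (B / n%:R) by rewrite -expR0 ler_expR divr_ge0// ltW.
apply: (le_trans (@normc_exprB_le _ _ (expR (B / n%:R)) n _ _)).
- by apply: le_trans (normc_cexp_le _) _; rewrite ler_expR.
- apply: le_trans (normc_triangle _ _) _; rewrite normc1.
  by apply: le_trans (expR_ge1Dx _); rewrite lerD2l.
have v12 : normc v <= 1 / 2 by rewrite (le_trans vB)// ler_pdivrMr//; lra.
have d : normc (cexp v - (1 + n%:R^-1 * p)) <= (16 * B ^+ 2 / n%:R + eta) / n%:R.
  have -> : cexp v - (1 + n%:R^-1 * p) = (cexp v - 1 - v) + n%:R^-1 * (s - p).
    by rewrite /v; ring.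
  apply: le_trans (normc_triangle _ _) _; rewrite mulrDl; apply: lerD.
    apply: le_trans (normc_cexpB_le v12) _.
    rewrite -2!mulrA ler_wpM2l// -invfM -expr2 -exprVn -exprMn.
    by rewrite lerXn2r// nnegrE ?normc_ge0// (le_trans _ vB)// normc_ge0.
  by rewrite normcM nC mulrC ler_wpM2r// invr_ge0 ltW.
apply: (@le_trans _ _ (n%:R * expR (B / n%:R) ^+ n.-1 *
    ((16 * B ^+ 2 / n%:R + eta) / n%:R))).
  by apply: ler_wpM2l => //; apply: mulr_ge0; rewrite ?ler0n// exprn_ge0// expR_ge0.
have eta0 : 0 <= eta by apply: le_trans sp; exact: normc_ge0.
have X0 : 0 <= 16 * B ^+ 2 / n%:R + eta.
  apply: addr_ge0 => //; apply: divr_ge0; last exact: ltW.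
  by apply: mulr_ge0 => //; exact: sqr_ge0.
rewrite (_ : n%:R * _ * _ = expR (B / n%:R) ^+ n.-1 * (16 * B ^+ 2 / n%:R + eta)).
  apply: ler_wpM2r => //; rewrite -eB.
  by apply: ler_weXn2l => //; exact: leq_pred.
by field; rewrite gt_eqF.
Qed.

End ComplexExponential.

(** * Analytic functions as locally uniform limits of polynomials *)

Section AnalyticFunctions.
Variable R : realType.
Local Notation C := R[i].
Local Notation circle := (@circle R).
Implicit Types (c : nat -> C) (z w : C) (F G : C -> C) (p q : {poly C}) (s e : R).

Definition psum c n z : C := \sum_(k < n) c k * z ^+ k.

Definition power_series_of F c := forall z, normc z < 1 ->
  (fun n => normc (F z - psum c n z)) @ \oo --> (0 : R).

Lemma normc_cvg0P (u : nat -> C) l :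
  (fun n => normc (l - u n)) @ \oo --> (0 : R) <->
  (forall e, 0 < e -> exists N, forall n, (N <= n)%N -> normc (l - u n) <= e).
Proof.
split=> [/cvgrPdist_le H e /H[N _ HN]|H].
  by exists N => n Nn; have := HN n Nn; rewrite /= sub0r normrN ger0_norm// normc_ge0.
apply/cvgrPdist_le => e /H[N HN]; exists N => // n /= Nn.
by rewrite sub0r normrN ger0_norm ?normc_ge0// HN.
Qed.

Lemma exp_cvg0 (x A e : R) : 0 <= x < 1 -> 0 <= A -> 0 < e ->
  exists N, forall n, (N <= n)%N -> A * x ^+ n <= e.
Proof.
move=> /andP[x0 x1] A0 e0.
have : (fun n => A * x ^+ n) @ \oo --> (0 : R).
  rewrite -[X in _ --> X](mulr0 A); apply: cvgMr.
  by apply: cvg_expr; rewrite ger0_norm.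
move=> /cvgrPdist_le/(_ e e0)[N _ HN]; exists N => n Nn.
by have := HN n Nn; rewrite /= sub0r normrN; apply: le_trans; exact: ler_norm.
Qed.

Lemma psumS c n z : psum c n.+1 z = psum c n z + c n * z ^+ n.
Proof. by rewrite /psum big_ord_recr. Qed.

Lemma psumB_le c z (a : nat -> R) m n : (m <= n)%N ->
  (forall k, normc (c k * z ^+ k) <= a k) ->
  normc (psum c n z - psum c m z) <= \sum_(m <= i < n) a i.
Proof.
move=> mn H; apply: (normc_telescope (u := fun n => psum c n z)) => // i.
by rewrite psumS addrAC subrr add0r.
Qed.

(** From the rank N on, a term is the difference of two partial sums that lie within 1 of F(s),
    hence at most 2 in modulus; the finitely many earlier terms are added to the bound. *)
Lemma power_series_coef_bound F c s : power_series_of F c -> 0 <= s < 1 ->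
  exists M, 0 <= M /\ forall k, normc (c k) * s ^+ k <= M.
Proof.
move=> Fc /andP[s0 s1]; have sC : normc (s%:C%C : C) = s by rewrite normcR ger0_norm.
have /normc_cvg0P /(_ 1 ltr01)[N HN] : (fun n => normc (F s%:C%C - psum c n s%:C%C)) @ \oo --> (0 : R).
  by apply: Fc; rewrite sC.
exists (2 + \sum_(k < N) normc (c k) * s ^+ k); split.
  rewrite addr_ge0// sumr_ge0// => i _.
  by rewrite mulr_ge0 ?normc_ge0// exprn_ge0.
move=> k; have [kN|Nk] := ltnP k N.
  rewrite (bigD1 (Ordinal kN))//= addrCA lerDl addr_ge0// sumr_ge0// => i _.
  by rewrite mulr_ge0 ?normc_ge0// exprn_ge0.
apply: (@le_trans _ _ 2); last first.
  rewrite lerDl sumr_ge0// => i _.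
  by rewrite mulr_ge0 ?normc_ge0// exprn_ge0.
have -> : normc (c k) * s ^+ k = normc (psum c k.+1 s%:C%C - psum c k s%:C%C).
  by rewrite psumS addrAC subrr add0r normcM normcX sC.
rewrite -(subrK (F s%:C%C) (psum c k.+1 _)) -addrA.
rewrite (le_trans (normc_triangle _ _))//; rewrite (_ : 2 = 1 + 1 :> R)//.
rewrite lerD//; last exact: HN.
by rewrite normcB HN// ltnW.
Qed.

(** Comparison with a geometric series of ratio s / r, the coefficients being controlled at the
    intermediate radius r = (1 + s) / 2. *)
Lemma power_series_unif F c s : power_series_of F c -> 0 <= s < 1 ->
  exists A x : R, [/\ 0 <= A, 0 <= x < 1 &
    forall n z, normc z <= s -> normc (F z - psum c n z) <= A * x ^+ n].
Proof.
move=> Fc /andP[s0 s1]; pose r := (1 + s) / 2.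
have r0 : 0 < r by rewrite /r; lra.
have r1 : r < 1 by rewrite /r; lra.
have sr : s < r by rewrite /r; lra.
have [|M [M0 HM]] := power_series_coef_bound Fc (s := r).
  by rewrite ltW.
have x01 : 0 <= s / r < 1.
  by apply/andP; split; [apply: divr_ge0 => //; exact: ltW|rewrite ltr_pdivrMr// mul1r].
exists (M / (1 - s / r)), (s / r); split => //.
  by rewrite divr_ge0// subr_ge0; case/andP: x01 => _ /ltW.
move=> n z zs; have z1 : normc z < 1 by exact: le_lt_trans zs s1.
have bd k : normc (c k * z ^+ k) <= M * (s / r) ^+ k.
  rewrite normcM normcX expr_div_n mulrA ler_pdivlMr ?exprn_gt0//.
  rewrite mulrAC; apply: ler_pM => //.
  - by rewrite mulr_ge0 ?normc_ge0// exprn_ge0// ltW.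
  - by rewrite exprn_ge0// normc_ge0.
  - by rewrite lerXn2r// nnegrE normc_ge0.
have hc : (fun m => normc (psum c m z - F z)) @ \oo --> (0 : R).
  by under eq_fun do rewrite normcB; exact: Fc.
apply: (normc_cvg_le hc); exists n => // m /= nm.
apply: le_trans (psumB_le nm bd) _; rewrite -mulr_sumr mulrAC -mulrA.
by apply: ler_wpM2l => //; rewrite geometric_sum_le.
Qed.

Definition locunif (P : nat -> C -> C) F := forall s e, 0 <= s < 1 -> 0 < e ->
  exists N, forall n z, (N <= n)%N -> normc z <= s -> normc (P n z - F z) <= e.

Lemma psum_poly c n z : psum c n z = (\poly_(k < n) c k).[z].
Proof. by rewrite horner_poly. Qed.

Lemma power_series_locunif F c : power_series_of F c -> locunif (psum c) F.
Proof.
move=> Fc s e s01 e0; have [A [x [A0 x01 H]]] := power_series_unif Fc s01.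
have [N HN] := exp_cvg0 x01 A0 e0; exists N => n z Nn zs.
by rewrite normcB (le_trans (H _ _ zs))// HN.
Qed.

Lemma horner_psum p n z : (size p <= n)%N -> p.[z] = psum (fun k => p`_k) n z.
Proof. by move=> h; rewrite (horner_coef_wide _ h). Qed.

Lemma dilate_horner p (r : R) :
  dilate (horner p) r = trig (fun k => p`_k * r%:C%C ^+ k) (size p).
Proof.
apply/funext => t; rewrite /dilate horner_coef; apply: eq_bigr => k _.
by rewrite exprMn mulrA.
Qed.

Lemma rnorm2_le (f : R -> C) (S : R) : L2 f -> (forall t, normc (f t) <= S) ->
  rnorm2 f <= pi *+ 2 * S ^+ 2.
Proof.
move=> Lf fS; have := @Rintegral_cst _ _ _ (@lebesgue_measure R) _ (@measurable_circle R) (S ^+ 2).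
rewrite -[X in _ = _ * fine X]/(lebesgue_measure circle) mu_circle /= mulrC => <-.
apply: le_Rint; [exact: L2_int1|exact: int1_cst|].
apply: aeT_W => t _; rewrite lerXn2r// nnegrE ?normc_ge0//.
by rewrite (le_trans _ (fS 0))// normc_ge0.
Qed.

(** On the circle of radius r, p_k r^k is a Fourier coefficient of the polynomial, so Bessel's
    inequality takes the place of a contour integral. *)
Lemma cauchy_estimate p (r S : R) k : 0 <= r ->
  (forall z, normc z = r -> normc p.[z] <= S) -> normc p`_k * r ^+ k <= S.
Proof.
move=> r0 H; have Ld : L2 (dilate (horner p) r) by rewrite dilate_horner; exact: L2_trig.
have nr (t : R) : normc (r%:C%C * cis t) = r by rewrite normcM normc_cis mulr1 normcR ger0_norm.
have S0 : 0 <= S by apply: le_trans (H (r%:C%C * cis 0) (nr 0)); exact: normc_ge0.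
have h1 : fcoef (dilate (horner p) r) k = p`_k * r%:C%C ^+ k.
  rewrite dilate_horner fcoef_trig; case: ltnP => // h.
  by rewrite nth_default ?mul0r.
have := le_trans (normc_fcoef k Ld) (rnorm2_le Ld (fun t => H _ (nr t))).
rewrite ler_pM2l ?pi2_gt0// h1 => h; apply: ler_sqr_le => //.
by move: h; rewrite normcM normcX normcR (ger0_norm r0).
Qed.

(** Weierstrass's theorem. Cauchy estimates on the differences p_m - p_n make each coefficient a
    Cauchy sequence in n; the limits are the coefficients of F. *)
Lemma analytic_of_locunif (p : nat -> {poly C}) F :
  locunif (fun n => horner (p n)) F -> analytic_disc F.
Proof.
move=> pF.
have est (r e : R) : 0 <= r < 1 -> 0 < e -> exists N, forall m n k, (N <= m)%N -> (N <= n)%N ->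
    normc ((p m)`_k - (p n)`_k) * r ^+ k <= e.
  move=> r01 e0; have [N HN] := pF r (e / 2) r01 (divr_gt0 e0 (ltr0Sn _ _)).
  exists N => m n k Nm Nn; rewrite -coefB; apply: cauchy_estimate.
    by case/andP: r01.
  move=> z zr; rewrite hornerD hornerN -(subrK (F z) (p m).[z]) -addrA.
  have zr' : normc z <= r by rewrite zr.
  rewrite (le_trans (normc_triangle _ _))// (splitr e) lerD ?HN//.
  by rewrite normcB HN.
have [c Hc] : exists c : nat -> C, forall k,
    (fun n => normc ((p n)`_k - c k)) @ \oo --> (0 : R).
  suff h k : exists l, (fun n => normc ((p n)`_k - l)) @ \oo --> (0 : R).
    by have [c Hc] := choice h; exists c.
  apply: complex_cauchy => e e0.
  have h2 : 0 < (1 / 2) ^+ k :> R by rewrite exprn_gt0.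
  have [||N HN] := est (1 / 2) (e * (1 / 2) ^+ k); first by apply/andP; split; lra.
    exact: mulr_gt0.
  exists N => m n Nm Nn; have := HN m n k Nm Nn.
  by rewrite ler_pM2r.
exists c => z z1; apply/normc_cvg0P => e e0.
pose s := normc z; pose r := (1 + s) / 2.
have s0 : 0 <= s by exact: normc_ge0.
have r0 : 0 < r by rewrite /r; lra.
have r1 : r < 1 by rewrite /r /s; move: z1; rewrite -/s; lra.
have sr : s < r by rewrite /r; move: z1; rewrite -/s; lra.
have r01 : 0 <= r < 1 by rewrite ltW.
have x01 : 0 <= s / r < 1.
  by apply/andP; split; [apply: divr_ge0 => //; exact: ltW|rewrite ltr_pdivrMr// mul1r].
have x1 : 0 < 1 - s / r by rewrite subr_gt0; case/andP: x01.
have e2 : 0 < e / 2 by rewrite divr_gt0.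
have [N1 HN1] := pF r (e / 2) r01 e2.
have [N2 HN2] := est r (e / 2 * (1 - s / r)) r01 (mulr_gt0 e2 x1).
(* One polynomial p_n, close to F on the disc of radius r and with coefficients close to c; beyond
   its size it coincides with its own partial sums, and F is compared with the partial sums of c
   through it. *)
pose n := maxn N1 N2.
have cn k : normc (c k - (p n)`_k) * r ^+ k <= e / 2 * (1 - s / r).
  rewrite -ler_pdivlMr ?exprn_gt0//; apply: (normc_cvg_le (Hc k)).
  exists N2 => // m /= Nm; rewrite ler_pdivlMr ?exprn_gt0//.
  by apply: HN2 => //; exact: leq_maxr.
exists (size (p n)) => K nK.
rewrite -/(psum c K z) -(subrK (p n).[z] (F z)) -addrA (splitr e).
rewrite (le_trans (normc_triangle _ _))//; apply: lerD.
  by rewrite normcB HN1 ?leq_maxl// ltW.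
rewrite (horner_psum _ nK) /psum -sumrB.
apply: le_trans (normc_sum _ _ _) _.
apply: (@le_trans _ _ (\sum_(0 <= k < K) (e / 2 * (1 - s / r)) * (s / r) ^+ k)).
  rewrite big_mkord; apply: ler_sum => k _.
  rewrite -mulrBl normcM normcX -/s expr_div_n mulrA ler_pdivlMr ?exprn_gt0//.
  rewrite mulrAC ler_wpM2r ?exprn_ge0// normcB; exact: cn.
rewrite -mulr_sumr; apply: (@le_trans _ _ (e / 2 * (1 - s / r) * ((s / r) ^+ 0 / (1 - s / r)))).
  apply: ler_wpM2l; first by rewrite mulr_ge0 ?ltW.
  exact: geometric_sum_le.
by rewrite expr0 mul1r -mulrA mulfV ?mulr1// gt_eqF.
Qed.

(** In this form analyticity is visibly stable under sums, products and the exponential, without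
    Cauchy products or rearrangements of series. *)
Lemma analyticP F : analytic_disc F <->
  exists p : nat -> {poly C}, locunif (fun n => horner (p n)) F.
Proof.
split=> [[c Fc]|[p pF]]; last exact: analytic_of_locunif pF.
exists (fun n => \poly_(k < n) c k).
have := power_series_locunif Fc; rewrite (_ : psum c = (fun n => horner (\poly_(k < n) c k)))//.
by apply/funext => n; apply/funext => z; rewrite psum_poly.
Qed.

Lemma normc_horner_le p z : normc z <= 1 -> normc p.[z] <= \sum_(k < size p) normc p`_k.
Proof.
move=> z1; rewrite horner_coef; apply: le_trans (normc_sum _ _ _) _.
apply: ler_sum => k _; rewrite normcM normcX ler_piMr ?normc_ge0//.
by rewrite exprn_ile1// normc_ge0.
Qed.

Lemma locunif_bound (p : nat -> {poly C}) F s :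
  locunif (fun n => horner (p n)) F -> 0 <= s < 1 ->
  exists B N, [/\ 0 <= B, forall z, normc z <= s -> normc (F z) <= B &
    forall n z, (N <= n)%N -> normc z <= s -> normc (p n).[z] <= B].
Proof.
move=> pF s01; have [N HN] := pF s 1 s01 ltr01.
pose S : R := \sum_(k < size (p N)) normc (p N)`_k.
have S0 : 0 <= S by apply: sumr_ge0 => i _; exact: normc_ge0.
have FS z : normc z <= s -> normc (F z) <= S + 1.
  move=> zs; rewrite -(subrK (p N).[z] (F z)) addrC (le_trans (normc_triangle _ _))//.
  rewrite lerD//; last by rewrite normcB HN.
  by apply: normc_horner_le; rewrite (le_trans zs)//; case/andP: s01 => _ /ltW.
exists (S + 2), N; split => [|z zs|n z Nn zs]; first exact: addr_ge0.
  by rewrite (le_trans (FS _ zs))// lerD2l ler1n.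
rewrite -(subrK (F z) (p n).[z]) addrC (le_trans (normc_triangle _ _))//.
rewrite (_ : S + 2 = (S + 1) + 1); last by ring.
by rewrite lerD ?FS// HN.
Qed.

Lemma analytic_bound F s : analytic_disc F -> 0 <= s < 1 ->
  exists B, 0 <= B /\ forall z, normc z <= s -> normc (F z) <= B.
Proof.
move=> /analyticP[p pF] /(locunif_bound pF)[B [N [B0 H _]]].
by exists B.
Qed.

Lemma analytic_cst z : analytic_disc (fun=> z).
Proof.
apply/analyticP; exists (fun=> z%:P) => s e _ e0; exists 0%N => n w _ _.
by rewrite hornerC subrr normc0 ltW.
Qed.

Lemma analyticD F G : analytic_disc F -> analytic_disc G ->
  analytic_disc (fun z => F z + G z).
Proof.
move=> /analyticP[p pF] /analyticP[q qG]; apply/analyticP.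
exists (fun n => p n + q n) => s e s01 e0.
have e2 : 0 < e / 2 by rewrite divr_gt0.
have [N1 H1] := pF s _ s01 e2; have [N2 H2] := qG s _ s01 e2.
exists (maxn N1 N2) => n z; rewrite geq_max => /andP[n1 n2] zs.
rewrite hornerD opprD addrACA (splitr e) (le_trans (normc_triangle _ _))//.
by rewrite lerD ?H1 ?H2.
Qed.

Lemma analyticM F G : analytic_disc F -> analytic_disc G ->
  analytic_disc (fun z => F z * G z).
Proof.
move=> /analyticP[p pF] /analyticP[q qG]; apply/analyticP.
exists (fun n => p n * q n) => s e s01 e0.
have [B1 [M1 [B10 bF bp]]] := locunif_bound pF s01.
have [B2 [M2 [B20 bG bq]]] := locunif_bound qG s01.
have e2 (B : R) : 0 <= B -> 0 < e / 2 / (B + 1) by move=> B0; rewrite !divr_gt0// ltr_wpDl.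
have [N1 H1] := pF s _ s01 (e2 _ B20); have [N2 H2] := qG s _ s01 (e2 _ B10).
have half (B : R) : 0 <= B -> B * (e / 2 / (B + 1)) <= e / 2.
  move=> B0; rewrite mulrCA ger_pMr ?divr_gt0// ler_pdivrMr ?ltr_wpDl//.
  by rewrite mul1r lerDl.
exists (maxn M1 (maxn N1 N2)) => n z; rewrite !geq_max => /and3P[m1 n1 n2] zs.
rewrite hornerM.
have -> : (p n).[z] * (q n).[z] - F z * G z =
    (p n).[z] * ((q n).[z] - G z) + G z * ((p n).[z] - F z) by ring.
rewrite (splitr e) (le_trans (normc_triangle _ _))// !normcM.
apply: lerD.
- apply: le_trans (half _ B10); apply: ler_pM; rewrite ?normc_ge0//; first exact: bp.
  exact: H2.
- apply: le_trans (half _ B20); apply: ler_pM; rewrite ?normc_ge0//; first exact: bG.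
  exact: H1.
Qed.

(** The polynomials (1 + p_n / n)^n converge locally uniformly to exp F when the p_n converge to
    F. *)
Lemma analytic_cexp F : analytic_disc F -> analytic_disc (fun z => cexp (F z)).
Proof.
move=> /analyticP[p pF]; apply/analyticP.
exists (fun n => (1 + (n%:R^-1)%:P * p n) ^+ n) => s e s01 e0.
have [B [M [B0 bF bp]]] := locunif_bound pF s01.
have E0 := expR_gt0 B.
have e1 : 0 < e / 2 / expR B by rewrite !divr_gt0.
have [N1 H1] := pF s _ s01 e1.
have Q0 : 0 <= 32 * B ^+ 2 * expR B / e.
  by apply: divr_ge0; [apply: mulr_ge0; [apply: mulr_ge0 => //; exact: sqr_ge0|exact: ltW]|exact: ltW].
have QB : 0 <= 2 * B + 32 * B ^+ 2 * expR B / e.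
  by apply: addr_ge0 => //; exact: mulr_ge0.
(* The term 2 B is the condition on n in [cexp_pow_approx]; the other one makes its error term 16
   B^2 exp(B) / n at most e / 2. *)
pose N2 := Num.bound (2 * B + 32 * B ^+ 2 * expR B / e).
exists (maxn M (maxn N1 N2.+1)) => n z; rewrite !geq_max => /and3P[m1 n1 n2] zs.
have nN : 2 * B + 32 * B ^+ 2 * expR B / e <= n%:R.
  apply: le_trans (ltW (archi_boundP QB)) _.
  by rewrite ler_nat (leq_trans _ n2).
have n0 : (0 < n)%N by exact: leq_trans n2.
rewrite horner_exp hornerD hornerM !hornerC normcB.
apply: (le_trans (cexp_pow_approx (eta := e / 2 / expR B) B0 n0 _ _ _ _)).
- by rewrite (le_trans _ nN)// lerDl.
- exact: bF.
- exact: bp.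
- by rewrite normcB H1.
rewrite mulrDr [leRHS](splitr e); apply: lerD; last first.
  by rewrite [expR B * _]mulrC divfK ?gt_eqF.
have nR : 0 < n%:R :> R by rewrite ltr0n.
rewrite mulrA ler_pdivrMr//.
have : 32 * B ^+ 2 * expR B / e <= n%:R by rewrite (le_trans _ nN)// lerDr mulr_ge0.
rewrite ler_pdivrMr//; lra.
Qed.

End AnalyticFunctions.

(** * Boundary functions and the Fourier description of H^2 *)

Section BoundaryValues.
Variable R : realType.
Local Notation mu := (@lebesgue_measure R).
Local Notation C := R[i].
Local Notation circle := (@circle R).
Implicit Types (f g : R -> C) (c : nat -> C) (z w : C) (F G : C -> C) (r s e : R).
Let mcircle := @measurable_circle R.
#[local] Hint Resolve mcircle : core.

Lemma boundaryP F f : boundary_function F f <-> cvgL2 (1 : R)^'- (dilate F) f.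
Proof. by rewrite cvgL2_sqnorm0. Qed.

Lemma near_left1 : \forall r \near (1 : R)^'-, 0 <= r < 1.
Proof.
near=> r; apply/andP; split; last by near: r; exact: nbhs_left_lt.
by apply: ltW; near: r; apply: nbhs_left_gt.
Unshelve. all: by end_near. Qed.

Lemma normc_rcis r (t : R) : 0 <= r -> normc (r%:C%C * cis t) = r.
Proof. by move=> r0; rewrite normcM normc_cis mulr1 normcR ger0_norm. Qed.

Lemma psum_trig c n r t : psum c n (r%:C%C * cis t) = trig (fun k => c k * r%:C%C ^+ k) n t.
Proof. by apply: eq_bigr => k _; rewrite exprMn mulrA. Qed.

Lemma sqnorm_le_cst f e : measurableC f -> 0 <= e -> (forall t, circle t -> normc (f t) <= e) ->
  (sqnorm f <= (pi *+ 2 * e ^+ 2)%:E)%E.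
Proof.
move=> mf e0 fe; apply: (@le_trans _ _ (sqnorm (fun=> e%:C%C : C))).
  apply: le_sqnorm => //.
  by apply: aeT_W => t /fe; rewrite normcR (ger0_norm e0).
rewrite sqnorm_rnorm2; last exact: L2_cst.
rewrite lee_fin; apply: rnorm2_le; first exact: L2_cst.
by move=> t; rewrite normcR ger0_norm.
Qed.

Lemma cvgL2_unif (f_ : nat -> R -> C) f : (forall n, measurableC (f_ n)) -> measurableC f ->
  (forall e, 0 < e -> exists N, forall n t, (N <= n)%N -> circle t -> normc (f_ n t - f t) <= e) ->
  cvgL2 \oo f_ f.
Proof.
move=> mf_ mf H e e0; pose d := Num.sqrt (e / (pi *+ 2)).
have d0 : 0 < d by rewrite sqrtr_gt0 divr_gt0// pi2_gt0.
have [N HN] := H d d0; exists N => // n /= Nn.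
apply: (@le_trans _ _ (pi *+ 2 * d ^+ 2)%:E).
  apply: sqnorm_le_cst; [exact: measurableCB|exact: ltW|].
  by move=> t; exact: HN.
have p0 := pi2_gt0 R.
rewrite lee_fin sqr_sqrtr; last by apply: divr_ge0; exact: ltW.
by rewrite mulrC divfK// gt_eqF.
Qed.

(** The factor 2 is the price of the squared triangle inequality; only the existence of some bound
    is used later. *)
Lemma cvgL2_sqnorm_le (I : Type) (U : set_system I) {FU : ProperFilter U}
    (f_ : I -> R -> C) f (M : R) :
  U [set i | measurableC (f_ i) /\ (sqnorm (f_ i) <= M%:E)%E] -> measurableC f ->
  cvgL2 U f_ f -> (sqnorm f <= (2 * M)%:E)%E.
Proof.
move=> H mf cf; apply/lee_addgt0Pr => e e0.
have e2 : 0 < e / 2 by rewrite divr_gt0.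
have [i /= [[mi Mi] h]] := @filter_ex _ _ FU _ (filterI H (cf _ e2)).
have -> : f = (fun t => f_ i t + (f t - f_ i t)) by apply/funext => t; ring.
apply: (le_trans (sqnormD mi (measurableCB mf mi))).
rewrite sqnormBC (@le_trans _ _ (2%:E * M%:E + 2%:E * (e / 2)%:E)%E)//.
  by apply: leeD; apply: lee_wpmul2l.
by rewrite -!EFinM -EFinD lee_fin; lra.
Qed.

Lemma cvgL2_fcoef (I : Type) (U : set_system I) {FU : ProperFilter U}
    (f_ : I -> R -> C) f k e : U [set i | L2 (f_ i)] -> L2 f ->
  cvgL2 U f_ f -> 0 < e -> U [set i | normc (fcoef (f_ i) k - fcoef f k) <= e].
Proof.
move=> Lf_ Lf cf e0; have e1 : 0 < pi *+ 2 * e ^+ 2 by rewrite mulr_gt0 ?pi2_gt0 ?exprn_gt0.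
apply: filterS2 Lf_ (cf _ e1) => i /= Li.
rewrite sqnorm_rnorm2 ?lee_fin; last exact: L2B.
move=> /(le_trans (normc_fcoef k (L2B Li Lf))).
rewrite ler_pM2l ?pi2_gt0// fcoefB// => h.
by apply: ler_sqr_le => //; exact: ltW.
Qed.

Lemma measurable_dilate F r : analytic_disc F -> 0 <= r < 1 -> measurableC (dilate F r).
Proof.
move=> [c Fc] /andP[r0 r1]; apply: (measurableC_cvg (f_ := trig (fun k => c k * r%:C%C ^+ k))).
  by move=> n; exact: L2_meas (L2_trig _ _).
move=> t _; have := Fc (r%:C%C * cis t); rewrite normc_rcis// => /(_ r1).
by under [X in X @ _ --> _]eq_fun do rewrite -/(psum _ _ _) psum_trig normcB.
Qed.

Lemma L2_dilate F r : analytic_disc F -> 0 <= r < 1 -> L2 (dilate F r).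
Proof.
move=> aF r01; have [B [B0 FB]] := analytic_bound aF r01; apply: Linfty_L2; split.
  exact: measurable_dilate.
exists B; apply: aeT_W => t _; apply: FB; rewrite normc_rcis//.
by case/andP: r01.
Qed.

Lemma dilate_series F c r : power_series_of F c -> 0 <= r < 1 ->
  cvgL2 \oo (trig (fun k => c k * r%:C%C ^+ k)) (dilate F r).
Proof.
move=> Fc r01; apply: cvgL2_unif.
- by move=> n; exact: L2_meas (L2_trig _ _).
- by apply: measurable_dilate => //; exists c.
- move=> e e0; have [N HN] := power_series_locunif Fc r01 e0; exists N => n t Nn _.
  by rewrite -psum_trig; apply: HN => //; rewrite normc_rcis//; case/andP: r01.
Qed.

Lemma fcoef_dilate F c r k : power_series_of F c -> 0 <= r < 1 ->
  fcoef (dilate F r) k = c k * r%:C%C ^+ k.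
Proof.
move=> Fc r01; have aF : analytic_disc F by exists c.
apply/eqP; rewrite -subr_eq0 -normc_eq0 eq_le normc_ge0 andbT.
apply/ler_addgt0Pr => e e0; rewrite add0r.
have hL : \forall n \near \oo, L2 (trig (fun k => c k * r%:C%C ^+ k) n).
  by apply: nearW => n; exact: L2_trig.
have [n] := filter_ex (filterI (cvgL2_fcoef k hL (L2_dilate aF r01) (dilate_series Fc r01) e0)
   (nbhs_infty_gt k)).
by move=> [+ kn]; rewrite /mkset fcoef_trig kn normcB.
Qed.

Lemma sqnorm_dilate_le F c r (S : R) : power_series_of F c -> 0 <= r < 1 ->
  (forall n, \sum_(k < n) normc (c k) ^+ 2 <= S) ->
  (sqnorm (dilate F r) <= (2 * (pi *+ 2 * S))%:E)%E.
Proof.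
move=> Fc r01 cS; have aF : analytic_disc F by exists c.
apply: cvgL2_sqnorm_le (dilate_series Fc r01); last exact: measurable_dilate.
exists 0%N => // n _ /=; split; first exact: L2_meas (L2_trig _ _).
rewrite sqnorm_rnorm2; last exact: L2_trig.
rewrite lee_fin rnorm2_trig ler_pM2l ?pi2_gt0//.
apply: le_trans (cS n); apply: ler_sum => k _.
case/andP: r01 => r0 r1; rewrite normcM normcX normcR (ger0_norm r0) exprMn.
by rewrite ler_piMr ?sqr_ge0// -exprM exprn_ile1// ltW.
Qed.

Lemma bernoulli r k : 0 <= r <= 1 -> 1 - r ^+ k <= k%:R * (1 - r).
Proof.
move=> /andP[r0 r1]; elim: k => [|k IH]; first by rewrite subrr mul0r.
have -> : 1 - r ^+ k.+1 = (1 - r) + r * (1 - r ^+ k) by rewrite exprS; ring.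
rewrite -natr1 mulrDl mul1r [leRHS]addrC lerD2l; apply: le_trans IH.
by apply: ler_piMl => //; rewrite subr_ge0 exprn_ile1.
Qed.

Lemma trig_dilate_unif c n r t : 0 <= r < 1 ->
  normc (trig (fun k => c k * r%:C%C ^+ k) n t - trig c n t) <=
  (\sum_(k < n) normc (c k) * k%:R) * (1 - r).
Proof.
move=> /andP[r0 r1]; rewrite /trig -sumrB; apply: le_trans (normc_sum _ _ _) _.
rewrite mulr_suml; apply: ler_sum => k _.
have -> : c k * r%:C%C ^+ k * cis t ^+ k - c k * cis t ^+ k =
   c k * ((r ^+ k - 1)%:C%C * cis t ^+ k).
  by rewrite rmorphB rmorphXn/=; ring.
rewrite !normcM normcX normc_cis expr1n mulr1 normcR -mulrA.
apply: ler_wpM2l; first exact: normc_ge0.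
rewrite distrC ger0_norm; last by rewrite subr_ge0 exprn_ile1// ltW.
by apply: bernoulli; rewrite r0 ltW.
Qed.

Lemma bounded_sums_cauchy (a : nat -> R) (S : R) : (forall k, 0 <= a k) ->
  (forall n, \sum_(k < n) a k <= S) ->
  forall e, 0 < e -> exists N, forall m n, (N <= m)%N -> (m <= n)%N ->
    \sum_(m <= k < n) a k <= e.
Proof.
move=> a0 aS e e0; pose u n := \sum_(0 <= k < n) a k.
have nd : nondecreasing_seq u.
  by apply/nondecreasing_seqP => n; rewrite /u big_nat_recr//= lerDl.
have cu : cvgn u.
  apply: nondecreasing_is_cvgn => //; exists S => _ [n _ <-].
  by rewrite /u big_mkord.
have /cvgrPdist_le /(_ _ (divr_gt0 e0 (ltr0Sn _ 1)))[N _ HN] : u @ \oo --> limn u by [].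
exists N => m n Nm mn; have -> : \sum_(m <= k < n) a k = u n - u m.
  by rewrite /u (@big_cat_nat _ _ _ m 0 n)//=; ring.
have h1 := HN m Nm; have h2 := HN n (leq_trans Nm mn).
rewrite /= distrC in h1; rewrite /= distrC in h2.
rewrite (splitr e) -(subrK (limn u) (u n)) -addrA lerD//.
  exact: le_trans (ler_norm _) h2.
by rewrite -opprB lerNl; move: h1; rewrite ler_norml => /andP[+ _].
Qed.

Lemma trigS c n t : trig c n.+1 t = trig c n t + c n * cis t ^+ n.
Proof. by rewrite /trig big_ord_recr. Qed.

Lemma trigB_lt c m n t : (m <= n)%N ->
  trig c n t - trig c m t = trig (fun k => if (k < m)%N then 0 else c k) n t.
Proof.
move=> mn; rewrite -(subnKC mn); elim: (n - m)%N => [|k IH].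
  rewrite addn0 subrr /trig big1// => k _; by rewrite ltn_ord mul0r.
by rewrite addnS !trigS -IH ltnNge leq_addr addrAC.
Qed.

Lemma sum_tail (a : nat -> R) m n : (m <= n)%N ->
  \sum_(k < n) (if (k < m)%N then 0 else a k) = \sum_(m <= k < n) a k.
Proof.
move=> mn; rewrite -(big_mkord xpredT (fun k => if (k < m)%N then 0 else a k)).
rewrite (@big_cat_nat _ _ _ m)//= big_nat big1 ?add0r.
  by rewrite big_nat [RHS]big_nat; apply: eq_bigr => k /andP[mk _]; rewrite ltnNge mk.
by move=> k /andP[_ ->].
Qed.

Lemma sqnorm_trigB c m n : (m <= n)%N ->
  sqnorm (fun t => trig c n t - trig c m t) =
  (pi *+ 2 * \sum_(m <= k < n) normc (c k) ^+ 2)%:E.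
Proof.
move=> mn; under [X in sqnorm X]eq_fun do rewrite trigB_lt//.
rewrite sqnorm_rnorm2; last exact: L2_trig.
rewrite rnorm2_trig -sum_tail//; congr (_ * _)%:E; apply: eq_bigr => k _.
by case: ifP => _; rewrite ?normc0 ?expr0n.
Qed.

Lemma trig_cvg c (S : R) : (forall n, \sum_(k < n) normc (c k) ^+ 2 <= S) ->
  exists f, L2 f /\ cvgL2 \oo (trig c) f.
Proof.
move=> cS; apply: L2_complete => [n|e e0]; first exact: L2_trig.
have p0 := pi2_gt0 R.
have [N HN] := bounded_sums_cauchy (fun k => sqr_ge0 (normc (c k))) cS (divr_gt0 e0 p0).
have h m n : (N <= m)%N -> (m <= n)%N ->
    (sqnorm (fun t => trig c n t - trig c m t)%R <= e%:E)%E.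
  move=> Nm mn; rewrite sqnorm_trigB// lee_fin.
  by rewrite mulrC -ler_pdivlMr//; exact: HN.
exists N => m n Nm Nn; have [mn|/ltnW nm] := leqP m n; last exact: h.
by rewrite sqnormBC; exact: h.
Qed.

Lemma power_series_tail F c N : power_series_of F c ->
  power_series_of (fun z => F z - psum c N z) (fun k => if (k < N)%N then 0 else c k).
Proof.
move=> Fc z z1; have := Fc z z1 => /cvgrPdist_le H; apply/cvgrPdist_le => e /H.
move=> h; near=> n; have -> : F z - psum c N z - psum (fun k => if (k < N)%N then 0 else c k) n z =
   F z - psum c n z.
  rewrite -addrA -opprD; congr (_ - _).
  have Nn : (N <= n)%N by near: n; exact: nbhs_infty_ge.
  rewrite /psum -!(big_mkord xpredT (fun k => (if (k < N)%N then 0 else c k) * z ^+ k)).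
  rewrite -!(big_mkord xpredT (fun k => c k * z ^+ k)).
  rewrite (@big_cat_nat _ _ _ N 0 n)//= [in RHS](@big_cat_nat _ _ _ N 0 n)//=.
  congr (_ + _); rewrite big_nat big1 ?add0r.
    by rewrite big_nat [RHS]big_nat; apply: eq_bigr => k /andP[mk _]; rewrite ltnNge mk.
  by move=> k /andP[_ ->]; rewrite mul0r.
by near: n.
Unshelve. all: by end_near. Qed.

(** An L^2 form of Abel's theorem. Beyond a rank N the tail of the series has small norm uniformly
    in r, while the polynomial part converges uniformly as r tends to 1. *)
Lemma boundary_of_trig F c f (S : R) : power_series_of F c ->
  (forall n, \sum_(k < n) normc (c k) ^+ 2 <= S) ->
  L2 f -> cvgL2 \oo (trig c) f -> boundary_function F f.
Proof.
move=> Fc cS Lf cf; apply/boundaryP => e e0; have aF : analytic_disc F by exists c.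
have p0 := pi2_gt0 R.
have e1 : 0 < e / 16 / (pi *+ 2) by rewrite !divr_gt0.
have [N1 HN1] := bounded_sums_cauchy (fun k => sqr_ge0 (normc (c k))) cS e1.
have [N2 _ HN2] := cf _ (divr_gt0 e0 (ltr0Sn _ 15)).
pose N := maxn N1 N2.
have tailS n : \sum_(k < n) normc (if (k < N)%N then 0 else c k) ^+ 2 <= e / 16 / (pi *+ 2).
  have [Nn|nN] := leqP N n.
    rewrite (eq_bigr (fun k : 'I_n => if (k < N)%N then 0 else normc (c k) ^+ 2)).
      rewrite (sum_tail (fun k => normc (c k) ^+ 2) Nn).
      by apply: HN1 => //; exact: leq_maxl.
    by move=> k _; case: ifP => _ //; rewrite normc0 expr0n.
  rewrite big1 ?ltW// => k _; rewrite (ltn_trans (ltn_ord k) nN) normc0 expr0n//.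
(* A Lipschitz constant in r for the polynomial part, by 1 - r^k <= k (1 - r). *)
pose A := \sum_(k < N) normc (c k) * k%:R.
have A0 : 0 <= A by apply: sumr_ge0 => k _; rewrite mulr_ge0 ?normc_ge0.
have AB0 : 0 < Num.sqrt (e / 16 / (pi *+ 2)) / (A + 1).
  by rewrite divr_gt0// ?sqrtr_gt0// ltr_wpDl.
near=> r; have r01 : 0 <= r < 1 by near: r; exact: near_left1.
pose g t := trig (fun k => c k * r%:C%C ^+ k) N t.
have mg : measurableC g by exact: L2_meas (L2_trig _ _).
have mF := measurable_dilate aF r01.
have mt : measurableC (trig c N) by exact: L2_meas (L2_trig _ _).
have h1 : (sqnorm (fun t => dilate F r t - g t)%R <= (2 * (pi *+ 2 * (e / 16 / (pi *+ 2))))%:E)%E.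
  have -> : (fun t => dilate F r t - g t) = dilate (fun z => F z - psum c N z) r.
    by apply/funext => t; rewrite /dilate psum_trig.
  exact: sqnorm_dilate_le (power_series_tail N Fc) r01 tailS.
have h2 : (sqnorm (fun t => g t - trig c N t)%R <= (e / 16)%:E)%E.
  apply: (@le_trans _ _ (pi *+ 2 * (A * (1 - r)) ^+ 2)%:E).
    apply: sqnorm_le_cst; first exact: measurableCB.
      by rewrite mulr_ge0// subr_ge0 ltW//; case/andP: r01.
    by move=> t _; exact: trig_dilate_unif.
  have h : A * (1 - r) <= Num.sqrt (e / 16 / (pi *+ 2)).
    have B0 : 0 < A + 1 by rewrite ltr_wpDl.
    apply: (@le_trans _ _ ((A + 1) * (1 - r))).
      by rewrite ler_wpM2r ?lerDl// subr_ge0 ltW//; case/andP: r01.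
    rewrite mulrC -ler_pdivlMr// lerBlDr -lerBlDl; apply: ltW; near: r.
    by apply: nbhs_left_gt; rewrite ltrBlDr ltrDl.
  rewrite lee_fin mulrC -ler_pdivlMr//.
  apply: (@le_trans _ _ (Num.sqrt (e / 16 / (pi *+ 2)) ^+ 2)).
    apply: lerXn2r => //; rewrite nnegrE ?sqrtr_ge0//.
    by apply: mulr_ge0 => //; rewrite subr_ge0 ltW//; case/andP: r01.
  by rewrite sqr_sqrtr// ltW.
have h3 : (sqnorm (fun t => trig c N t - f t)%R <= (e / 16)%:E)%E.
  by apply: HN2; exact: leq_maxr.
apply: (le_trans (sqnorm_triangle mF mg (L2_meas Lf))).
apply: (@le_trans _ _ (2%:E * (2 * (pi *+ 2 * (e / 16 / (pi *+ 2))))%:E +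
    2%:E * (2%:E * (e / 16)%:E + 2%:E * (e / 16)%:E))%E).
  apply: leeD; apply: lee_wpmul2l => //.
  apply: (le_trans (sqnorm_triangle mg mt (L2_meas Lf))).
  by apply: leeD; apply: lee_wpmul2l.
rewrite -!EFinM -EFinD lee_fin.
have -> : pi *+ 2 * (e / 16 / (pi *+ 2)) = e / 16.
  by rewrite mulrCA mulfV ?mulr1// gt_eqF.
lra.
Unshelve. all: by end_near. Qed.

(** The k-th coefficient of [dilate F r] is c_k r^k, and coefficients are continuous for L^2
    convergence; r tends to 1. *)
Lemma boundary_fcoef F c f k : power_series_of F c -> L2 f -> boundary_function F f ->
  fcoef f k = c k.
Proof.
move=> Fc Lf /boundaryP bf; have aF : analytic_disc F by exists c.
apply/eqP; rewrite -subr_eq0 -normc_eq0 eq_le normc_ge0 andbT.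
apply/ler_addgt0Pr => e e0; rewrite add0r.
have e2 : 0 < e / 2 by rewrite divr_gt0.
have hL : \forall r \near (1 : R)^'-, L2 (dilate F r).
  by apply: filterS near_left1 => r; exact: L2_dilate.
have H1 : \forall r \near (1 : R)^'-, normc (fcoef (dilate F r) k - fcoef f k) <= e / 2.
  exact: (@cvgL2_fcoef _ (1 : R)^'- _ (dilate F) f k (e / 2) hL Lf bf e2).
pose A := normc (c k) * k%:R + 1.
have A0 : 0 < A by rewrite ltr_wpDl// mulr_ge0// normc_ge0.
have H2 : \forall r \near (1 : R)^'-, 1 - e / 2 / A < r.
  by apply: nbhs_left_gt; rewrite ltrBlDr ltrDl divr_gt0.
have [r [[h1 r01] h2]] := @filter_ex _ _ (at_left_proper_filter (1 : R)) _ (filterI (filterI H1 near_left1) H2).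
move: h1; rewrite (fcoef_dilate _ Fc r01) => h1.
have -> : fcoef f k - c k = - (c k * r%:C%C ^+ k - fcoef f k) - c k * (1 - r ^+ k)%:C%C.
  by rewrite rmorphB rmorphXn/=; ring.
rewrite (le_trans (normc_triangle _ _))// !normcN (splitr e) lerD//.
case/andP: r01 => r0 r1; rewrite normcM normcR ger0_norm; last first.
  by rewrite subr_ge0 exprn_ile1// ltW.
apply: (@le_trans _ _ (A * (1 - r))).
  apply: (@le_trans _ _ (normc (c k) * (k%:R * (1 - r)))).
    by rewrite ler_wpM2l ?normc_ge0// bernoulli// r0 ltW.
  rewrite mulrA; apply: ler_wpM2r; first by rewrite subr_ge0 ltW.
  by rewrite /A lerDl.
by rewrite mulrC -ler_pdivlMr//; move: h2; rewrite ltrBlDr -ltrBlDl => /ltW.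
Qed.

Lemma fcoef_sum_le f n : L2 f -> \sum_(k < n) normc (fcoef f k) ^+ 2 <= (pi *+ 2)^-1 * rnorm2 f.
Proof.
by move=> Lf; rewrite mulrC ler_pdivlMr ?pi2_gt0// mulrC; exact: bessel.
Qed.

Lemma power_series_exists c (M : R) : (forall k, normc (c k) <= M) ->
  exists F, power_series_of F c.
Proof.
move=> cM; have M0 : 0 <= M by apply: le_trans (cM 0%N); exact: normc_ge0.
suff h z : exists l, normc z < 1 -> (fun n => normc (l - psum c n z)) @ \oo --> (0 : R).
  by have [F HF] := choice h; exists F.
have [z1|z1] := ltP (normc z) 1; last by exists 0.
suff [l hl] : exists l, (fun n => normc (psum c n z - l)) @ \oo --> (0 : R).
  by exists l => _; under [X in X @ _ --> _]eq_fun do rewrite normcB.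
have x01 : 0 <= normc z < 1 by rewrite normc_ge0.
have y0 : 0 < 1 - normc z by rewrite subr_gt0.
apply: complex_cauchy => e e0.
have [N HN] := exp_cvg0 x01 (divr_ge0 M0 (ltW y0)) e0.
have h m n : (N <= m)%N -> (m <= n)%N -> normc (psum c n z - psum c m z) <= e.
  move=> Nm mn; have bd k : normc (c k * z ^+ k) <= M * normc z ^+ k.
    by rewrite normcM normcX ler_wpM2r// exprn_ge0// normc_ge0.
  apply: le_trans (psumB_le mn bd) _; rewrite -mulr_sumr.
  apply: le_trans (HN m Nm); rewrite mulrAC -mulrA ler_wpM2l//.
  exact: geometric_sum_le.
exists N => m n Nm Nn; have [mn|/ltnW nm] := leqP m n; last exact: h.
by rewrite normcB h.
Qed.

Lemma H2plus_trig f : L2 f -> cvgL2 \oo (trig (fcoef f)) f -> H2plus f.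
Proof.
move=> Lf cf; have cS n := fcoef_sum_le n Lf.
have [k|F HF] := @power_series_exists (fcoef f) (Num.sqrt ((pi *+ 2)^-1 * rnorm2 f)).
  have h : normc (fcoef f k) ^+ 2 <= (pi *+ 2)^-1 * rnorm2 f.
    by rewrite [leRHS]mulrC ler_pdivlMr ?pi2_gt0// mulrC; exact: normc_fcoef.
  apply: (@ler_sqr_le _ (normc (fcoef f k))); first exact: sqrtr_ge0.
  by rewrite [leRHS]sqr_sqrtr// (le_trans _ h)// sqr_ge0.
split => //; exists F; split.
  split; first by exists (fcoef f).
  by exists (2 * (pi *+ 2 * ((pi *+ 2)^-1 * rnorm2 f))) => r r01; exact: sqnorm_dilate_le HF r01 cS.
exact: boundary_of_trig HF cS Lf cf.
Qed.

(** By Bessel's inequality and completeness the partial sums converge to some g in L^2. By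
    [boundary_of_trig] g is also a boundary function of F, hence equal to f almost everywhere. *)
Lemma trig_boundary F f : analytic_disc F -> L2 f -> boundary_function F f ->
  cvgL2 \oo (trig (fcoef f)) f.
Proof.
move=> [c Fc] Lf bf; have E k := boundary_fcoef k Fc Lf bf.
have Ec : fcoef f = c by apply/funext => k; exact: E.
have cS n := fcoef_sum_le n Lf; rewrite Ec in cS *.
have [g [Lg cg]] := trig_cvg cS.
have bg := boundary_of_trig Fc cS Lg cg.
have fg : aeT g f.
  move/boundaryP : bf => bf; move/boundaryP : bg => bg.
  apply: (cvgL2_unique _ (L2_meas Lg) (L2_meas Lf) bg bf).
  by apply: filterS near_left1 => r; apply: measurable_dilate; exists c.
move=> e e0; apply: filterS (cg e e0) => n /=.
rewrite (sqnorm_aeT (g := fun t => trig c n t - f t))//.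
- by apply: measurableCB; [exact: L2_meas (L2_trig _ _)|exact: L2_meas].
- by apply: measurableCB; [exact: L2_meas (L2_trig _ _)|exact: L2_meas].
- by apply: aeT_imp fg _ => t _ ->.
Qed.

Lemma H2plus_boundary F f : analytic_disc F -> L2 f -> boundary_function F f -> H2plus f.
Proof. by move=> aF Lf bf; apply: H2plus_trig => //; exact: trig_boundary bf. Qed.

(** From right to left, Bessel's inequality for f bounds the mean squares over the circles of radius
    r < 1, which gives an extension in [H2_disc]. *)
Lemma H2plusP f : H2plus f <->
  L2 f /\ exists F, analytic_disc F /\ boundary_function F f.
Proof.
split=> [[Lf [F [[aF _] bf]]]|[Lf [F [aF bf]]]]; first by split => //; exists F.
exact: H2plus_boundary bf.
Qed.

(** The description behind closedness, the backward shift and the approximation of |h| by Lipschitz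
    functions. *)
Lemma H2plus_trigP f : H2plus f <-> L2 f /\ cvgL2 \oo (trig (fcoef f)) f.
Proof.
split=> [/H2plusP[Lf [F [aF bf]]]|[]]; last exact: H2plus_trig.
by split => //; exact: trig_boundary bf.
Qed.

End BoundaryValues.

(** * Operations on Hardy spaces and the description of the kernels *)

Section HardySpaces.
Variable R : realType.
Local Notation mu := (@lebesgue_measure R).
Local Notation C := R[i].
Local Notation circle := (@circle R).
Implicit Types (f g h m a b : R -> C) (c : nat -> C) (z w : C) (F G : C -> C) (r s e : R).
Let mcircle := @measurable_circle R.
#[local] Hint Resolve mcircle : core.

Lemma at_left1_unit : (1 : R)^'- [set r : R | 0 <= r < 1].
Proof. exact: near_left1. Qed.

Lemma boundary_aeT F f g : analytic_disc F -> measurableC f -> measurableC g -> aeT f g ->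
  boundary_function F f -> boundary_function F g.
Proof.
move=> aF mf mg fg /boundaryP bf; apply/boundaryP => e e0.
apply: filterS2 at_left1_unit (bf e e0) => r r01 /=; have mF := measurable_dilate aF r01.
rewrite (sqnorm_aeT (g := fun t => dilate F r t - g t))//.
- exact: measurableCB.
- exact: measurableCB.
- by apply: aeT_imp fg _ => t _ ->.
Qed.

Lemma near_meas_dilate F : analytic_disc F ->
  (1 : R)^'- [set r | measurableC (dilate F r)].
Proof. by move=> aF; apply: filterS at_left1_unit => r; exact: measurable_dilate. Qed.

Lemma boundary_unique F f g : analytic_disc F -> measurableC f -> measurableC g ->
  boundary_function F f -> boundary_function F g -> aeT f g.
Proof.
move=> aF mf mg /boundaryP bf /boundaryP bg.
exact: cvgL2_unique (near_meas_dilate aF) mf mg bf bg.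
Qed.

Lemma power_series_eq F G c : power_series_of F c -> power_series_of G c ->
  forall z, normc z < 1 -> F z = G z.
Proof.
move=> Fc Gc z z1; apply/eqP; rewrite -subr_eq0 -normc_eq0 eq_le normc_ge0 andbT.
apply/ler_addgt0Pr => e e0; have e2 : 0 < e / 2 by rewrite divr_gt0.
have [N1 H1] := (normc_cvg0P _ _).1 (Fc z z1) _ e2.
have [N2 H2] := (normc_cvg0P _ _).1 (Gc z z1) _ e2.
rewrite add0r -(subrK (psum c (maxn N1 N2) z) (F z)) -addrA (splitr e).
rewrite (le_trans (normc_triangle _ _))// lerD ?H1 ?leq_maxl//.
by rewrite normcB H2 ?leq_maxr.
Qed.

(** The boundary function determines the Taylor coefficients. This carries a bound known for one
    extension over to any other. *)
Lemma boundary_disc_eq F G f g : analytic_disc F -> analytic_disc G -> L2 f -> L2 g ->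
  boundary_function F f -> boundary_function G g -> aeT f g ->
  forall z, normc z < 1 -> F z = G z.
Proof.
move=> [c Fc] [d Gd] Lf Lg bf bg fg; apply: (power_series_eq Fc).
suff -> : c = d by [].
apply/funext => k; rewrite -(boundary_fcoef k Fc Lf bf) -(boundary_fcoef k Gd Lg bg).
by apply: inner_aeT fg; [exact: L2_meas|exact: L2_meas|exact: L2_meas (L2_cisX _ _)].
Qed.

Lemma power_series_at0 F c : power_series_of F c -> F 0 = c 0%N.
Proof.
move=> Fc; apply/eqP; rewrite -subr_eq0 -normc_eq0 eq_le normc_ge0 andbT.
apply/ler_addgt0Pr => e e0; rewrite add0r.
have z1 : normc (0 : C) < 1 by rewrite normc0 ltr01.
have [N /(_ N.+1 (leqnSn _))] := (normc_cvg0P _ _).1 (Fc 0 z1) _ e0.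
by rewrite /psum big_ord_recl/= expr0 mulr1 big1 ?addr0// => i _; rewrite expr0n mulr0.
Qed.

Lemma boundary_at0 F f : analytic_disc F -> L2 f -> boundary_function F f ->
  fcoef f 0 = F 0.
Proof. by move=> [c Fc] Lf bf; rewrite (boundary_fcoef 0 Fc Lf bf) (power_series_at0 Fc). Qed.

Lemma H2plus_L2 f : H2plus f -> L2 f. Proof. by case. Qed.

Lemma H2plus_aeT f g : measurableC g -> aeT f g -> H2plus f -> H2plus g.
Proof.
move=> mg fg /H2plusP[Lf [F [aF bf]]]; apply/H2plusP; split; first exact: L2_aeT fg Lf.
by exists F; split => //; apply: boundary_aeT fg bf => //; exact: L2_meas.
Qed.

Lemma H2plusD f g : H2plus f -> H2plus g -> H2plus (fun t => f t + g t).
Proof.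
move=> /H2plusP[Lf [F [aF bf]]] /H2plusP[Lg [G [aG bg]]]; apply/H2plusP.
split; first exact: L2D.
exists (fun z => F z + G z); split; first exact: analyticD.
move/boundaryP: bf => bf; move/boundaryP: bg => bg; apply/boundaryP.
apply: cvgL2D bf bg; by [exact: near_meas_dilate|exact: L2_meas].
Qed.

Lemma boundary_cst z : boundary_function (fun=> z) (fun=> z).
Proof.
apply/boundaryP => e e0; apply: filterS at_left1_unit => r _ /=.
have -> : (fun t => dilate (fun=> z) r t - z) = (fun=> 0).
  by apply/funext => t; rewrite /dilate subrr.
apply: le_trans (sqnorm_le_cst (measurableC_cst _) (lexx 0) _) _ => [t _|].
  by rewrite normc0.
by rewrite expr0n mulr0 lee_fin ltW.
Qed.

Lemma boundaryM F G f g (M : R) : analytic_disc F -> analytic_disc G ->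
  (forall z, normc z < 1 -> normc (G z) <= M) -> L2 f -> measurableC g ->
  boundary_function F f -> boundary_function G g ->
  boundary_function (fun z => G z * F z) (fun t => g t * f t).
Proof.
move=> aF aG GM Lf mg /boundaryP bf /boundaryP bg; apply/boundaryP.
have M0 : 0 <= M.
  by apply: le_trans (GM 0 _); [exact: normc_ge0|rewrite normc0 ltr01].
apply: (cvgL2M M0 (near_meas_dilate aF) _ Lf mg bf bg).
apply: filterS at_left1_unit => r r01; split; first exact: measurable_dilate.
by apply: aeT_W => t _; apply: GM; case/andP: r01 => r0 r1; rewrite normc_rcis.
Qed.

Lemma boundary_ae_le G g (M : R) : analytic_disc G ->
  (forall z, normc z < 1 -> normc (G z) <= M) -> measurableC g ->
  boundary_function G g -> almost_everywhereT (fun t => normc (g t) <= M).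
Proof.
move=> aG GM mg /boundaryP bg.
apply: (cvgL2_ae_le _ (@measurable_cst _ _ _ _ _ M) mg bg).
apply: filterS at_left1_unit => r r01; split; first exact: measurable_dilate.
by apply: aeT_W => t _; apply: GM; case/andP: r01 => r0 r1; rewrite normc_rcis.
Qed.

(** Fatou's theorem in mean square: Bessel's inequality on the circle of radius r bounds the sum of
    |c_k|^2 r^(2k) by M^2, and r -> 1 gives a square-summable sequence, whose trigonometric series
    converges in L^2. *)
Lemma boundary_exists G (M : R) : analytic_disc G ->
  (forall z, normc z < 1 -> normc (G z) <= M) ->
  exists g, [/\ Linfty g, almost_everywhereT (fun t => normc (g t) <= M) & boundary_function G g].
Proof.
move=> aG GM; have [c Gc] := aG.
have M0 : 0 <= M.
  by apply: le_trans (GM 0 _); [exact: normc_ge0|rewrite normc0 ltr01].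
have cS n : \sum_(k < n) normc (c k) ^+ 2 <= M ^+ 2.
  apply/ler_addgt0Pr => e e0.
  have H (r : R) : 0 <= r < 1 -> \sum_(k < n) normc (c k) ^+ 2 * r ^+ k.*2 <= M ^+ 2.
    move=> /[dup] r01 /andP[r0 r1]; have Ld := L2_dilate aG r01.
    have := le_trans (bessel n Ld) (rnorm2_le Ld (S := M) _).
    rewrite ler_pM2l ?pi2_gt0// => H.
    apply: le_trans (H _) => [|t]; last by apply: GM; rewrite normc_rcis.
    apply: ler_sum => k _; rewrite (fcoef_dilate _ Gc r01) normcM normcX normcR.
    by rewrite (ger0_norm r0) exprMn -exprM muln2.
  pose A := \sum_(k < n) normc (c k) ^+ 2 * (k.*2)%:R + 1.
  have A0 : 0 < A.
    by rewrite ltr_wpDl// sumr_ge0// => k _; rewrite mulr_ge0// sqr_ge0.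
  have eA : 0 < e / A by rewrite divr_gt0.
  have H2 : \forall r \near (1 : R)^'-, 1 - e / A < r.
    by apply: nbhs_left_gt; rewrite ltrBlDr ltrDl.
  have [r [r01 h2]] := @filter_ex _ _ (at_left_proper_filter (1 : R)) _ (filterI (near_left1 R) H2).
  have /andP[r0 r1] := r01.
  rewrite -lerBlDr; apply: le_trans (H r r01).
  rewrite lerBlDl -lerBlDr -sumrB.
  apply: (@le_trans _ _ (A * (1 - r))).
    rewrite /A mulrDl mul1r mulr_suml -[leLHS]addr0 lerD ?subr_ge0 ?(ltW r1)//.
    apply: ler_sum => k _; rewrite -{1}(mulr1 (normc _ ^+ 2)) -mulrBr -mulrA.
    by apply: ler_wpM2l; rewrite ?sqr_ge0// bernoulli// r0 ltW.
  by rewrite mulrC -ler_pdivlMr//; move: h2; rewrite ltrBlDr -ltrBlDl => /ltW.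
have [g [Lg cg]] := trig_cvg cS.
have bg := boundary_of_trig Gc cS Lg cg; have mg := L2_meas Lg.
have gM := boundary_ae_le aG GM mg bg.
by exists g; split => //; split => //; exists M.
Qed.

Lemma Hinfty_L2 h : Hinfty h -> L2 h. Proof. by case=> /Linfty_L2. Qed.

Lemma Hinfty_meas h : Hinfty h -> measurableC h. Proof. by move=> /Hinfty_L2/L2_meas. Qed.

Lemma H2plusM_Hinfty h f : Hinfty h -> H2plus f -> H2plus (fun t => h t * f t).
Proof.
move=> Hh /H2plusP[Lf [F [aF bf]]].
have [Lh [G [[aG [M GM]] bh]]] := Hh; apply/H2plusP; split; first exact: L2M_Linfty.
exists (fun z => G z * F z); split; first exact: analyticM.
exact: boundaryM GM Lf (L2_meas (Linfty_L2 Lh)) bf bh.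
Qed.

Lemma H2plusZ (k : C) f : H2plus f -> H2plus (fun t => k * f t).
Proof.
move=> /H2plusP[Lf [F [aF bf]]]; apply/H2plusP; split; first exact: L2Z.
exists (fun z => k * F z); split; first by apply: analyticM => //; exact: analytic_cst.
apply: (@boundaryM F (fun=> k) f (fun=> k) (normc k)) => //.
- exact: analytic_cst.
- exact: boundary_cst.
Qed.

Lemma H2plusB f g : H2plus f -> H2plus g -> H2plus (fun t => f t - g t).
Proof.
move=> Hf Hg; have -> : (fun t => f t - g t) = (fun t => f t + -1 * g t).
  by apply/funext => t; rewrite mulN1r.
by apply: H2plusD => //; exact: H2plusZ.
Qed.

(** The partial sums of f and of f_N differ by those of f - f_N, which Bessel's inequality bounds
    uniformly in the rank. *)
Lemma H2plus_closed (f_ : nat -> R -> C) f : (forall n, H2plus (f_ n)) -> L2 f ->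
  cvgL2 \oo f_ f -> H2plus f.
Proof.
move=> Hf_ Lf cf; apply: H2plus_trig => // e e0.
have Lf_ n : L2 (f_ n) by exact: H2plus_L2.
have mt c n : measurableC (trig c n) by exact: L2_meas (L2_trig _ _).
have [N _ /(_ N (leqnn N)) /= hN] := cf _ (divr_gt0 e0 (ltr0Sn _ 9)).
have [_ cN] := (H2plus_trigP (f_ N)).1 (Hf_ N).
apply: filterS (cN _ (divr_gt0 e0 (ltr0Sn _ 9))) => n /= h.
apply: (le_trans (sqnorm_triangle (mt _ n) (mt (fcoef (f_ N)) n) (L2_meas Lf))).
apply: (@le_trans _ _ (2%:E * (e / 10)%:E + 2%:E * (2%:E * (e / 10)%:E + 2%:E * (e / 10)%:E))%E).
  apply: leeD; apply: lee_wpmul2l => //; last first.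
    apply: (le_trans (sqnorm_triangle (mt _ n) (L2_meas (Lf_ N)) (L2_meas Lf))).
    by apply: leeD; apply: lee_wpmul2l.
  apply: le_trans hN; rewrite sqnormBC.
  have -> : (fun t => trig (fcoef (f_ N)) n t - trig (fcoef f) n t) =
      trig (fcoef (fun t => f_ N t - f t)) n.
    apply/funext => t; rewrite /trig -sumrB; apply: eq_bigr => k _.
    by rewrite fcoefB// mulrBl.
  have LB : L2 (fun t => f_ N t - f t) by exact: L2B.
  rewrite !sqnorm_rnorm2//; last exact: L2_trig.
  by rewrite lee_fin rnorm2_trig; exact: bessel.
by rewrite -!EFinM -EFinD lee_fin; lra.
Qed.

(** Bernoulli's inequality: x^n >= 1 + n (x - 1) if x > 1. *)
Lemma unbounded_powers (x B : R) : (forall n, x ^+ n <= B) -> x <= 1.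
Proof.
move=> H; rewrite leNgt; apply/negP => x1; have y0 : 0 < x - 1 by rewrite subr_gt0.
have xn n : 1 + n%:R * (x - 1) <= x ^+ n.
  elim: n => [|n IH]; first by rewrite mul0r addr0.
  have n0 : 0 <= n%:R :> R by [].
  by rewrite exprS -natr1; have := mulr_ge0 n0 (mulr_ge0 (ltW y0) (ltW y0)); nra.
have B0 : 0 <= B / (x - 1).
  by rewrite divr_ge0 ?(ltW y0)// (le_trans _ (H 0%N))// expr0.
have := le_trans (xn _) (H (Num.bound (B / (x - 1)))).
have := archi_boundP B0; rewrite ltr_pdivrMr// => h1 h2.
by move: (lt_le_trans h1 (lexx _)); lra.
Qed.

Lemma power_series_coef1_bound F c z : power_series_of F c -> normc z < 1 ->
  (forall k, normc (c k) <= 1) -> normc (F z) <= (1 - normc z)^-1.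
Proof.
move=> Fc z1 c1; rewrite -[F z]subr0.
have hc : (fun n => normc (psum c n z - F z)) @ \oo --> (0 : R).
  by under eq_fun do rewrite normcB; exact: Fc.
apply: (normc_cvg_le hc); exists 0%N => // n _.
rewrite subr0 -[(1 - _)^-1]mul1r -[X in X / _](expr0 (normc z)).
rewrite (le_trans _ (@geometric_sum_le _ (normc z) 0 n _)) ?normc_ge0//.
rewrite big_mkord; apply: le_trans (normc_sum _ _ _) _; apply: ler_sum => k _.
by rewrite normcM normcX ler_piMl// exprn_ge0// normc_ge0.
Qed.

(* If |f| <= 1 a.e. then all the powers F^n have coefficients bounded by 1, so
   that |F z|^n is bounded independently of n. *)
Lemma boundary_maximum F f (M : R) : analytic_disc F ->
  (forall z, normc z < 1 -> normc (F z) <= M) -> L2 f -> boundary_function F f ->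
  almost_everywhereT (fun t => normc (f t) <= 1) ->
  forall z, normc z < 1 -> normc (F z) <= 1.
Proof.
move=> aF FM Lf bf f1 z z1.
have H n : [/\ analytic_disc (fun z => F z ^+ n), L2 (fun t => f t ^+ n) &
    boundary_function (fun z => F z ^+ n) (fun t => f t ^+ n)].
  elim: n => [|n [an Ln bn]].
    by split; [exact: analytic_cst|exact: L2_cst|exact: boundary_cst].
  have E1 : (fun z => F z ^+ n.+1) = (fun z => F z * F z ^+ n) by apply/funext => w; rewrite exprS.
  have E2 : (fun t => f t ^+ n.+1) = (fun t => f t * f t ^+ n) by apply/funext => t; rewrite exprS.
  rewrite E1 E2; split; first exact: analyticM.
    apply: L2M_Linfty => //; split; first exact: L2_meas.
    by exists 1.
  exact: boundaryM FM Ln (L2_meas Lf) bn bf.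
apply: (@unbounded_powers _ ((1 - normc z)^-1)) => n; rewrite -normcX.
have [[c Fc] Ln bn] := H n; apply: (power_series_coef1_bound Fc z1) => k.
rewrite -(boundary_fcoef k Fc Ln bn).
have h := normc_fcoef k Ln.
have h2 : rnorm2 (fun t => f t ^+ n) <= pi *+ 2 * 1.
  have := @Rintegral_cst _ _ _ mu _ mcircle 1.
  rewrite -[X in _ = _ * fine X]/(mu circle) mu_circle /= mul1r mulr1 => <-.
  apply: le_Rint; [exact: L2_int1|exact: int1_cst|].
  apply: aeT_imp f1 _ => t _ ft; rewrite normcX -exprM.
  by rewrite exprn_ile1// normc_ge0.
have := le_trans h h2; rewrite ler_pM2l ?pi2_gt0// => h3.
by apply: (@ler_sqr_le _ (normc (fcoef (fun t => f t ^+ n) k))); rewrite ?expr1n.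
Qed.

Lemma rnorm2_eq0 f : L2 f -> rnorm2 f = 0 -> aeT f (cst 0).
Proof.
move=> Lf f0; apply: sqnorm0_ae; first exact: L2_meas.
by rewrite sqnorm_rnorm2// f0.
Qed.

Lemma H2minus_L2 m : H2minus m -> L2 m. Proof. by case. Qed.

(** The difference of two projections lies in H^2 and is orthogonal to itself. The lemma identifies
    the projection in [kerplus] with the one inside [paired]. *)
Lemma orth_proj_H2plus_unique g f f' : L2 g -> orth_proj (@H2plus R) g f ->
  orth_proj (@H2plus R) g f' -> aeT f f'.
Proof.
move=> Lg [Hf Of] [Hf' Of']; have Lf := H2plus_L2 Hf; have Lf' := H2plus_L2 Hf'.
have Hd := H2plusB Hf Hf'; have Ld := H2plus_L2 Hd.
have E : inner (fun t => f t - f' t) (fun t => f t - f' t) = 0.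
  have EB : (fun t => f t - f' t) = (fun t => (g t - f' t) - (g t - f t)).
    by apply/funext => t; ring.
  by rewrite [X in inner X _]EB innerBl ?Of ?Of' ?subrr//; exact: L2B.
suff : aeT (fun t => f t - f' t) (cst 0).
  by move/aeT_imp; apply => t _ /eqP; rewrite subr_eq0 => /eqP.
apply: rnorm2_eq0 => //; move: E; rewrite inner_self// => /complexI /eqP.
by rewrite mulf_eq0 invr_eq0 gt_eqF ?pi2_gt0//= => /eqP.
Qed.

(** The only form in which the kernels are used below. From right to left the element of the kernel
    is f + m, with projections f and m. *)
Lemma kerplusP a b f : kerplus a b f <-> H2plus f /\
  exists m, H2minus m /\ aeT (fun t => a t * f t + b t * m t) (cst 0).
Proof.
split=> [[g [[Lg [fp [fm [Op [Hm Om] E]]]] Of]]|[Hf [m [Hm E]]]].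
  split; first by case: Of.
  exists fm; split => //; have ff := orth_proj_H2plus_unique Lg Of Op.
  by apply: aeT_imp2 E ff _ => t _ /= E' ->; rewrite -E'.
have Lf := H2plus_L2 Hf; have Lm := H2minus_L2 Hm.
have Of : orth_proj (@H2plus R) (fun t => f t + m t) f.
  split => // g Hg; have -> : (fun t => f t + m t - f t) = m.
    by apply/funext => t; ring.
  exact: Hm.2.
have Om : orth_proj (@H2minus R) (fun t => f t + m t) m.
  split => // g Hg; have Lg := H2minus_L2 Hg.
  rewrite (_ : (fun t => _) = f); last by apply/funext => t; ring.
  by rewrite (innerC Lg Lf) Hg.2// conjc0.
exists (fun t => f t + m t); split => //; split; first exact: L2D.
by exists f, m; split => //; exact: aeT_sym.
Qed.

(** Multiplication by conj(h) is the adjoint of multiplication by h, which preserves H^2. *)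
Lemma H2minusM_conj h m : Hinfty h -> H2minus m -> H2minus (fun t => conjc (h t) * m t).
Proof.
move=> Hh [Lm Om]; split; first by apply: L2M_Linfty => //; apply: LinftyJ; case: Hh.
move=> g Hg; rewrite -[RHS](Om _ (H2plusM_Hinfty Hh Hg)) /inner.
congr (_ * cintegral _); apply/funext => t.
by rewrite conjcM mulrCA mulrA.
Qed.

End HardySpaces.

(** * The Herglotz and Poisson integrals *)

Section HerglotzTransform.
Variable R : realType.
Local Notation mu := (@lebesgue_measure R).
Local Notation C := R[i].
Local Notation circle := (@circle R).
Local Notation int1 f := (mu.-integrable circle (EFin \o f)).
Implicit Types (f g h : R -> C) (u v : R -> R) (c : nat -> C) (z w : C) (F G : C -> C) (r s t e : R).
Let mcircle := @measurable_circle R.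
#[local] Hint Resolve mcircle : core.

Definition hkernel z t : C := (cis t + z) / (cis t - z).

(** The Herglotz integral: its real part is the Poisson integral of u, and for u = ln |h| it is the
    exponent in the definition of [outer]. *)
Definition herg u z : C :=
  ((pi *+ 2)^-1)%:C%C * cintegral (fun t => hkernel z t * (u t)%:C%C).

(** The Taylor coefficients of (1 + w) / (1 - w); the kernel is this function at w = z conj(cis
    t). *)
Definition hcoef (k : nat) : C := if k is 0 then 1 else 2.

Lemma normc_cisB z t : normc z < 1 -> 0 < 1 - normc z <= normc (cis t - z).
Proof.
move=> z1; rewrite subr_gt0 z1/=.
rewrite -(normc_cis t); have := normc_dist (cis t) z.
exact: le_trans (ler_norm _).
Qed.

Lemma cisB_neq0 z t : normc z < 1 -> cis t - z != 0.
Proof. by move=> /(@normc_cisB _ t)/andP[h1 h2]; rewrite -normc_gt0 (lt_le_trans h1). Qed.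

Lemma hkernel_sum z t n : normc z < 1 ->
  hkernel z t - \sum_(k < n.+1) hcoef k * (z * conjc (cis t)) ^+ k =
  2 * (z * conjc (cis t)) ^+ n.+1 * (cis t / (cis t - z)).
Proof.
move=> z1; have d0 := cisB_neq0 t z1; apply: (mulIf d0).
set w := z * conjc (cis t).
have -> : 2 * w ^+ n.+1 * (cis t / (cis t - z)) * (cis t - z) = 2 * w ^+ n.+1 * cis t.
  by rewrite -[LHS]mulrA divfK.
rewrite mulrBl /hkernel divfK//.
have zE : z = w * cis t by rewrite /w -mulrA [conjc _ * _]mulrC cis_mulJ mulr1.
have -> : cis t - z = (1 - w) * cis t by rewrite mulrBl mul1r -zE.
have -> : cis t + z = (1 + w) * cis t by rewrite mulrDl mul1r -zE.
rewrite mulrA -mulrBl; congr (_ * _).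
elim: n => [|n IH]; first by rewrite big_ord1 expr0 expr1 [hcoef _]/=; ring.
by rewrite big_ord_recr/= mulrDl opprD addrA IH [in RHS]exprS; ring.
Qed.

Lemma normc_mulJ_cis z t : normc (z * conjc (cis t)) = normc z.
Proof. by rewrite normcM normcJ normc_cis mulr1. Qed.

Lemma hkernel_approx z t n : normc z < 1 ->
  normc (hkernel z t - \sum_(k < n.+1) hcoef k * (z * conjc (cis t)) ^+ k) <=
  2 / (1 - normc z) * normc z ^+ n.+1.
Proof.
move=> z1; have /andP[h1 h2] := normc_cisB t z1.
rewrite hkernel_sum// !normcM normcV normcX normc_mulJ_cis normc_cis mul1r.
have -> : normc (2 : C) = 2.
  by rewrite -[2](rmorph_nat (real_complex R)) normcR ger0_norm.
rewrite mulrAC; apply: ler_wpM2r; first by rewrite exprn_ge0// normc_ge0.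
by rewrite ler_wpM2l// lef_pV2// posrE// (lt_le_trans h1).
Qed.

Lemma normc_hkernel z t : normc z < 1 -> normc (hkernel z t) <= 2 / (1 - normc z).
Proof.
move=> z1; have /andP[h1 h2] := normc_cisB t z1.
rewrite /hkernel normcM normcV; apply: ler_pM; rewrite ?invr_ge0 ?normc_ge0//.
  by rewrite (le_trans (normc_triangle _ _))// normc_cis; move: (ltW z1); lra.
by rewrite lef_pV2// posrE// (lt_le_trans h1).
Qed.

Lemma measurableC_hkernel z : normc z < 1 -> measurableC (hkernel z).
Proof.
move=> z1; apply: (measurableC_cvg
  (f_ := fun n t => \sum_(k < n.+1) hcoef k * (z * conjc (cis t)) ^+ k)).
  move=> n; apply: measurableC_sum => k; apply: measurableCM; first exact: measurableC_cst.
  apply: measurableCX; apply: measurableCM; first exact: measurableC_cst.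
  by apply: measurableCJ; exact: measurableC_cis.
move=> t _; apply/cvgrPdist_le => e e0.
have d0 : 0 <= 2 / (1 - normc z) by rewrite divr_ge0// subr_ge0 ltW.
have z01 : 0 <= normc z < 1 by rewrite normc_ge0.
have [N HN] := exp_cvg0 z01 d0 e0; exists N => // n /= Nn.
rewrite sub0r normrN ger0_norm ?normc_ge0// normcB (le_trans (hkernel_approx _ _ z1))//.
exact: HN (leqW Nn).
Qed.

Lemma invcE z : z != 0 -> z^-1 = conjc z * ((normc z ^+ 2)^-1)%:C%C.
Proof.
move=> z0; apply: (mulfI z0); rewrite mulfV// mulrA mulcJ -rmorphM/= mulfV//.
by rewrite expf_eq0/= normc_eq0.
Qed.

Definition poisson z t : R := complex.Re (hkernel z t).

Lemma poissonE z t : normc z < 1 -> poisson z t = (1 - normc z ^+ 2) / normc (cis t - z) ^+ 2.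
Proof.
move=> z1; have d0 := cisB_neq0 t z1; rewrite /poisson /hkernel.
rewrite (invcE d0) mulrA ReM/= mulr0 subr0 mulrC [RHS]mulrC; congr (_ * _).
rewrite -(expr1n _ 2) -(normc_cis t) !normc_sqr.
by case: (cis t) z {z1 d0} => [a b] [x y] /=; ring.
Qed.

(** Harnack's lower bound (1 - |z|) / (1 + |z|), weakened. It lets the Poisson integral at one point
    control the whole integral of a nonnegative function. *)
Lemma poisson_ge z t : normc z < 1 -> (1 - normc z) / 2 <= poisson z t.
Proof.
move=> z1; have /andP[h1 h2] := normc_cisB t z1.
have n0 : 0 < normc (cis t - z) by exact: lt_le_trans h1 h2.
have n2 : normc (cis t - z) <= 1 + normc z.
  by rewrite (le_trans (normc_triangle _ _))// normc_cis normcN.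
rewrite poissonE// ler_pdivlMr ?exprn_gt0//.
have := normc_ge0 z.
have : normc (cis t - z) ^+ 2 <= (1 + normc z) ^+ 2.
  by rewrite lerXn2r// ?nnegrE ?normc_ge0// addr_ge0// normc_ge0.
move: z1; set x := normc z; set y := normc _ ^+ 2 => x1 yx x0.
have : y <= 2 * (1 + x) by nra.
nra.
Qed.

Lemma poisson_ge0 z t : normc z < 1 -> 0 <= poisson z t.
Proof.
move=> z1; apply: le_trans (poisson_ge t z1).
by rewrite divr_ge0// subr_ge0 ltW.
Qed.

Lemma measurable_real_of u : int1 u -> measurableC (fun t => (u t)%:C%C).
Proof. by move=> /int1_measurable; exact: measurableC_real. Qed.

Lemma int1_norm u : int1 u -> int1 (fun t => `|u t|).
Proof. by move=> iu; exact: (@integrable_norm _ _ _ mu). Qed.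

Lemma int1_bddM f u (M : R) : measurableC f -> (forall t, circle t -> normc (f t) <= M) -> int1 u ->
  int1 (fun t => normc (f t * (u t)%:C%C)).
Proof.
move=> mf fM iu; apply: (@int1_le _ _ (fun t => M * `|u t|)).
- by apply: measurable_normc; apply: measurableCM => //; exact: measurable_real_of.
- by apply: int1Z; exact: int1_norm.
- move=> t ct; rewrite normcM ger0_norm; last by rewrite mulr_ge0 ?normc_ge0.
  by rewrite normcR ler_wpM2r// fM.
Qed.

Lemma cint1_bddM f u (M : R) : measurableC f -> (forall t, circle t -> normc (f t) <= M) -> int1 u ->
  cint1 (fun t => f t * (u t)%:C%C).
Proof.
move=> mf fM iu; apply: cint1_normc; last exact: int1_bddM fM iu.
by apply: measurableCM => //; exact: measurable_real_of.
Qed.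

Lemma normc_cintegral_bddM f u (M : R) : measurableC f ->
  (forall t, circle t -> normc (f t) <= M) -> int1 u ->
  normc (cintegral (fun t => f t * (u t)%:C%C)) <=
  2 * M * \int[mu]_(t in circle) `|u t|.
Proof.
move=> mf fM iu.
apply: le_trans (normc_cintegral_le _ _) _.
- by apply: measurableCM => //; exact: measurable_real_of.
- exact: cint1_bddM fM iu.
- rewrite -mulrA ler_wpM2l// -(@RintegralZl _ _ _ mu)//; last exact: int1_norm.
  apply: le_Rint; [exact: int1_bddM fM iu|by apply: int1Z; exact: int1_norm|].
  by apply: aeT_W => t ct; rewrite normcM normcR ler_wpM2r// fM.
Qed.

Lemma cint1_hkernel u z : int1 u -> normc z < 1 -> cint1 (fun t => hkernel z t * (u t)%:C%C).
Proof.
move=> iu z1; apply: (cint1_bddM (M := 2 / (1 - normc z)) (measurableC_hkernel z1) _ iu).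
by move=> t _; exact: normc_hkernel.
Qed.

Definition rfcoef u (k : nat) : C := fcoef (fun t => (u t)%:C%C) k.

Lemma cint1_cisJ u k : int1 u -> cint1 (fun t => conjc (cis t ^+ k) * (u t)%:C%C).
Proof.
move=> iu; apply: (cint1_bddM (M := 1)) => //.
  by apply: measurableCJ; apply: measurableCX; exact: measurableC_cis.
by move=> t _; rewrite normcJ normcX normc_cis expr1n.
Qed.

(** Value and integrability are proved together because the induction step for the value splits an
    integral. *)
Lemma herg_psum u z n : int1 u ->
  cintegral (fun t => (\sum_(k < n) hcoef k * (z * conjc (cis t)) ^+ k) * (u t)%:C%C) =
  (pi *+ 2)%:C%C * psum (fun k => hcoef k * rfcoef u k) n z /\
  cint1 (fun t => (\sum_(k < n) hcoef k * (z * conjc (cis t)) ^+ k) * (u t)%:C%C).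
Proof.
move=> iu; elim: n => [|n [IH1 IH2]].
  have E : (fun t => (\sum_(k < 0) hcoef k * (z * conjc (cis t)) ^+ k) * (u t)%:C%C) = fun=> 0.
    by apply/funext => t; rewrite big_ord0 mul0r.
  by rewrite E cintegral_cst /psum big_ord0 mulr0; split => //; exact: cint1_cst.
have E : (fun t => (\sum_(k < n.+1) hcoef k * (z * conjc (cis t)) ^+ k) * (u t)%:C%C) =
  (fun t => (\sum_(k < n) hcoef k * (z * conjc (cis t)) ^+ k) * (u t)%:C%C +
     (hcoef n * z ^+ n) * (conjc (cis t ^+ n) * (u t)%:C%C)).
  by apply/funext => t; rewrite big_ord_recr/= conjcX exprMn; ring.
have ci := cint1_cisJ n iu.
rewrite E cintegralD//; last exact: cint1Z.
rewrite cintegralZ// IH1 psumS; split; last by apply: cint1D => //; exact: cint1Z.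
rewrite mulrDr; congr (_ + _).
have -> : cintegral (fun t => conjc (cis t ^+ n) * (u t)%:C%C) = (pi *+ 2)%:C%C * rfcoef u n.
  rewrite /rfcoef /fcoef /inner mulrA -rmorphM/= mulfV ?mul1r ?gt_eqF ?pi2_gt0//.
  by congr cintegral; apply/funext => t; rewrite mulrC.
ring.
Qed.

(** For fixed z the kernel is the uniform limit on the circle of its partial sums, so it may be
    integrated term by term against an integrable u. *)
Lemma herg_series u : int1 u -> power_series_of (herg u) (fun k => hcoef k * rfcoef u k).
Proof.
move=> iu z z1; apply/normc_cvg0P => e e0.
have p0 := pi2_gt0 R.
have d0 : 0 < 1 - normc z by rewrite subr_gt0.
pose A := (pi *+ 2)^-1 * (2 * (2 / (1 - normc z)) * \int[mu]_(t in circle) `|u t|).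
have I0 : 0 <= \int[mu]_(t in circle) `|u t| by exact: Rintegral_ge0.
have A0 : 0 <= A.
  apply: mulr_ge0; first by rewrite invr_ge0 ltW.
  by apply: mulr_ge0 => //; apply: mulr_ge0 => //; apply: divr_ge0 => //; exact: ltW.
have z01 : 0 <= normc z < 1 by rewrite normc_ge0.
have [N HN] := exp_cvg0 z01 A0 e0; exists N.+1 => -[//|n] Nn.
have [E1 E2] := herg_psum z n.+1 iu.
have -> : psum (fun k => hcoef k * rfcoef u k) n.+1 z = ((pi *+ 2)^-1)%:C%C *
   cintegral (fun t => (\sum_(k < n.+1) hcoef k * (z * conjc (cis t)) ^+ k) * (u t)%:C%C).
  by rewrite E1 mulrA -rmorphM/= mulVf ?mul1r// gt_eqF.
rewrite /herg -mulrBr normcM normcR gtr0_norm ?invr_gt0//.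
have -> : cintegral (fun t => hkernel z t * (u t)%:C%C) -
  cintegral (fun t => (\sum_(k < n.+1) hcoef k * (z * conjc (cis t)) ^+ k) * (u t)%:C%C) =
  cintegral (fun t => (hkernel z t - \sum_(k < n.+1) hcoef k * (z * conjc (cis t)) ^+ k) * (u t)%:C%C).
  rewrite -[X in _ + X]mulN1r -cintegralZ// -cintegralD//; last 2 first.
  - exact: cint1_hkernel.
  - exact: cint1Z.
  by congr cintegral; apply/funext => t; rewrite mulrBl mulN1r.
apply: le_trans (HN n.+1 (ltnW Nn)).
rewrite /A -(mulrA (pi *+ 2)^-1); apply: ler_wpM2l; first by rewrite invr_ge0 ltW.
rewrite mulrAC -(mulrA 2); apply: normc_cintegral_bddM => //.
  apply: measurableCB; first exact: measurableC_hkernel.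
  apply: measurableC_sum => k; apply: measurableCM; first exact: measurableC_cst.
  apply: measurableCX; apply: measurableCM; first exact: measurableC_cst.
  by apply: measurableCJ; exact: measurableC_cis.
by move=> t _; exact: hkernel_approx.
Qed.

Lemma analytic_herg u : int1 u -> analytic_disc (herg u).
Proof. by move=> iu; eexists; exact: herg_series. Qed.

Lemma hergD u v z : int1 u -> int1 v -> normc z < 1 ->
  herg (fun t => u t + v t) z = herg u z + herg v z.
Proof.
move=> iu iv z1; rewrite /herg -mulrDr -cintegralD; try exact: cint1_hkernel.
by congr (_ * cintegral _); apply/funext => t; rewrite rmorphD mulrDr.
Qed.

Lemma hergZ (k : R) u z : int1 u -> normc z < 1 ->
  herg (fun t => k * u t) z = k%:C%C * herg u z.
Proof.
move=> iu z1; rewrite /herg mulrCA -(cintegralZ k%:C%C); last exact: cint1_hkernel.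
by congr (_ * cintegral _); apply/funext => t; rewrite rmorphM/= mulrCA.
Qed.

Lemma hergB u v z : int1 u -> int1 v -> normc z < 1 ->
  herg (fun t => u t - v t) z = herg u z - herg v z.
Proof.
move=> iu iv z1; have -> : (fun t => u t - v t) = (fun t => u t + (-1) * v t).
  by apply/funext => t; rewrite mulN1r.
rewrite hergD//; last exact: int1Z.
by rewrite hergZ// rmorphN1 mulN1r.
Qed.

Lemma herg0 u : herg u 0 = ((pi *+ 2)^-1 * \int[mu]_(t in circle) u t)%:C%C.
Proof.
rewrite /herg rmorphM/=; congr (_ * _).
have -> : (fun t => hkernel 0 t * (u t)%:C%C) = (fun t => (u t)%:C%C).
  apply/funext => t; rewrite /hkernel addr0 subr0 divff ?mul1r//.
  by rewrite -normc_eq0 normc_cis oner_eq0.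
rewrite /cintegral /=; congr Complex.
by rewrite (@Rintegral_cst _ _ _ mu)// mul0r.
Qed.

Lemma Re_hergE u z : complex.Re (herg u z) =
  (pi *+ 2)^-1 * \int[mu]_(t in circle) (poisson z t * u t).
Proof.
rewrite /herg ReM/= mul0r subr0; congr (_ * _); apply: eq_Rintegral => t _.
by rewrite ReM/= mulr0 subr0.
Qed.

Lemma measurable_poisson z : normc z < 1 -> measurable_fun circle (poisson z).
Proof. by move=> /measurableC_hkernel[]. Qed.

Lemma poisson_le z t : normc z < 1 -> poisson z t <= 2 / (1 - normc z).
Proof.
move=> z1; apply: le_trans (normc_hkernel t z1).
exact: le_trans (ler_norm _) (normr_Re_le _).
Qed.

Lemma int1_poissonM u z : int1 u -> normc z < 1 -> int1 (fun t => poisson z t * u t).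
Proof.
move=> iu z1; apply: (@int1_le _ _ (fun t => 2 / (1 - normc z) * `|u t|)).
- by apply: measurable_funM; [exact: measurable_poisson|exact: int1_measurable].
- by apply: int1Z; exact: int1_norm.
- by move=> t _; rewrite normrM ger0_norm ?poisson_ge0// ler_wpM2r// poisson_le.
Qed.

Lemma herg_le u v z : int1 u -> int1 v -> normc z < 1 ->
  almost_everywhereT (fun t => u t <= v t) ->
  complex.Re (herg u z) <= complex.Re (herg v z).
Proof.
move=> iu iv z1 uv; rewrite !Re_hergE; apply: ler_wpM2l.
  by rewrite invr_ge0 ltW// pi2_gt0.
apply: le_Rint; try exact: int1_poissonM.
by apply: aeT_imp uv _ => t _ h; rewrite ler_wpM2l// poisson_ge0.
Qed.

Lemma herg_ge_avg u z : int1 u -> normc z < 1 -> almost_everywhereT (fun t => 0 <= u t) ->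
  (1 - normc z) / 2 * ((pi *+ 2)^-1 * \int[mu]_(t in circle) u t) <= complex.Re (herg u z).
Proof.
move=> iu z1 u0; rewrite Re_hergE mulrCA; apply: ler_wpM2l.
  by rewrite invr_ge0 ltW// pi2_gt0.
rewrite -(@RintegralZl _ _ _ mu)//; apply: le_Rint; [exact: int1Z|exact: int1_poissonM|].
by apply: aeT_imp u0 _ => t _ h; rewrite ler_wpM2r// poisson_ge.
Qed.

Lemma herg_cst (k : R) z : normc z < 1 -> herg (fun=> k) z = k%:C%C.
Proof.
move=> z1; have h := herg_series (int1_cst k).
suff Hc : power_series_of (fun=> k%:C%C) (fun j => hcoef j * rfcoef (fun=> k) j).
  exact: (power_series_eq h Hc z1).
have E j : rfcoef (fun=> k) j = k%:C%C * (j == 0%N)%:R.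
  rewrite /rfcoef /fcoef (_ : (fun=> k%:C%C) = fun t => k%:C%C * cis t ^+ 0); last first.
    by apply/funext => t; rewrite expr0 mulr1.
  by rewrite innerZl -/(fcoef _ j) ?fcoef_cisX 1?eq_sym//; exact: L2_cisX.
move=> w w1; apply/normc_cvg0P => e e0; exists 1%N => -[//|n] _.
rewrite /psum big_ord_recl/= E eqxx expr0 !mulr1 mul1r big1 ?addr0 ?subrr ?normc0 ?ltW//.
by move=> i _; rewrite E mulr0 mulr0 mul0r.
Qed.

(** Continuity in the L^1 norm at a fixed z, where the kernel is bounded; this allows the passage
    from truncated logarithms to ln |h|. *)
Lemma herg_lip u v z : int1 u -> int1 v -> normc z < 1 ->
  normc (herg u z - herg v z) <=
  (pi *+ 2)^-1 * (2 * (2 / (1 - normc z)) * \int[mu]_(t in circle) `|u t - v t|).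
Proof.
move=> iu iv z1; rewrite -hergB// normcM normcR gtr0_norm ?invr_gt0 ?pi2_gt0//.
apply: ler_wpM2l; first by rewrite invr_ge0 ltW// pi2_gt0.
apply: normc_cintegral_bddM; [exact: measurableC_hkernel| |exact: int1B].
by move=> t _; exact: normc_hkernel.
Qed.

Lemma L2_int1_real u : L2 (fun t => (u t)%:C%C) -> int1 u.
Proof.
move=> Lu; have := (cint1_L2M Lu (L2_cst 1)).1.
rewrite (_ : (fun t => complex.Re _) = u)//.
by apply/funext => t; rewrite mulr1.
Qed.

(** What matters is uniformity in r. The constant is 2 * 4: |hcoef k|^2 <= 4, and [sqnorm_dilate_le]
    loses a factor 2. *)
Lemma sqnorm_herg_le u r : L2 (fun t => (u t)%:C%C) -> 0 <= r < 1 ->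
  (sqnorm (fun t => (complex.Re (herg u (r%:C%C * cis t)))%:C%C)%R
   <= 8%:E * sqnorm (fun t => (u t)%:C%C)%R)%E.
Proof.
move=> Lu r01; have iu := L2_int1_real Lu; have au := analytic_herg iu.
have md := measurable_dilate au r01.
apply: (@le_trans _ _ (sqnorm (dilate (herg u) r))).
  apply: le_sqnorm => //; first by apply: measurableC_real; exact: md.1.
  by apply: aeT_W => t _; rewrite normcR normr_Re_le.
apply: le_trans (sqnorm_dilate_le (S := 4 * ((pi *+ 2)^-1 * rnorm2 (fun t => (u t)%:C%C)))
  (herg_series iu) r01 _) _ => [n|].
  apply: (@le_trans _ _ (4 * \sum_(k < n) normc (rfcoef u k) ^+ 2)); last first.
    by rewrite ler_pM2l//; exact: fcoef_sum_le.
  rewrite mulr_sumr; apply: ler_sum => k _; rewrite normcM exprMn ler_wpM2r ?sqr_ge0//.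
  case: (nat_of_ord k) => [|j]; first by rewrite normc1 expr1n ler1n.
  rewrite /hcoef -[2](rmorph_nat (real_complex R)) normcR ger0_norm//.
  by rewrite expr2 -natrM.
rewrite sqnorm_rnorm2// -EFinM lee_fin le_eqVlt; apply/orP; left; apply/eqP.
have p0 : (pi : R) *+ 2 != 0 by rewrite gt_eqF// pi2_gt0.
by rewrite (mulrCA 4) mulVKf// mulrA -natrM.
Qed.

Lemma L2_bounded_real u (M : R) : measurable_fun circle u ->
  (forall t, circle t -> `|u t| <= M) -> L2 (fun t => (u t)%:C%C).
Proof.
move=> mu' uM; apply: Linfty_L2; split; first exact: measurableC_real.
by exists M; apply: aeT_W => t ct; rewrite normcR uM.
Qed.

(** Among the nonnegative frequencies Re(k cis t) has the single coefficient k / 2, at 1, which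
    [hcoef] doubles; its Herglotz integral is therefore k z. *)
Lemma poisson_trig (k : C) z : normc z < 1 ->
  complex.Re (herg (fun t => complex.Re (k * cis t)) z) = complex.Re (k * z).
Proof.
move=> z1; pose u t := complex.Re (k * cis t).
have mu' : measurable_fun circle u.
  by have [] := measurableCM (measurableC_cst k) (@measurableC_cis R).
have Lu : L2 (fun t => (u t)%:C%C).
  apply: (L2_bounded_real (M := normc k)) => // t _.
  by rewrite (le_trans (normr_Re_le _))// normcM normc_cis mulr1.
have h := herg_series (L2_int1_real Lu).
suff Hc : power_series_of (fun w => k * w) (fun j => hcoef j * rfcoef u j).
  by rewrite -(power_series_eq h Hc z1).
have uE : (fun t => (u t)%:C%C) = (fun t => (k / 2) * cis t ^+ 1 + (conjc k / 2) * conjc (cis t ^+ 1)).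
  apply/funext => t; by rewrite /u expr1 ReJ_add conjcM; ring.
have Lj n : L2 (fun t => conjc (cis t ^+ n) : C) by apply: L2J; exact: L2_cisX.
have E0 j : fcoef (fun t => conjc (cis t ^+ 1)) j = 0.
  have -> : 0 = conjc (fcoef (fun t => cis t ^+ j.+1) 0) by rewrite fcoef_cisX conjc0.
  rewrite /fcoef -innerC//; [|exact: L2_cisX|exact: L2_cisX].
  congr (_ * cintegral _); apply/funext => s.
  by rewrite expr0 mul1r -conjcM -exprD add1n.
have E j : rfcoef u j = (k / 2) * (j == 1%N)%:R.
  rewrite /rfcoef uE /fcoef innerDl; [|by apply: L2Z; exact: L2_cisX|exact: L2Z|exact: L2_cisX].
  rewrite innerZl; [|exact: L2_cisX|exact: L2_cisX].
  rewrite innerZl//; last exact: L2_cisX.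
  by rewrite -!/(fcoef _ j) E0 mulr0 addr0 fcoef_cisX eq_sym.
move=> w w1; apply/normc_cvg0P => e e0; exists 2%N => -[//|[//|n]] _.
rewrite /psum !big_ord_recl/= !E/= big1 => [|i _]; last by rewrite E mulr0 mulr0 mul0r.
have -> : k * w - (1 * (k / 2 * 0) * w ^+ 0 + (2 * (k / 2 * 1) * w ^+ bump 0 0 + 0)) = 0.
  by rewrite /bump/= expr1; field.
by rewrite normc0 ltW.
Qed.

End HerglotzTransform.

(** * Convergence of Poisson integrals and the boundary modulus of outer functions *)

Section OuterFunctions.
Variable R : realType.
Local Notation mu := (@lebesgue_measure R).
Local Notation C := R[i].
Local Notation circle := (@circle R).
Local Notation int1 f := (mu.-integrable circle (EFin \o f)).
Implicit Types (f g h : R -> C) (u v : R -> R) (c : nat -> C) (z w : C) (F G : C -> C) (r s t e : R).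
Let mcircle := @measurable_circle R.
#[local] Hint Resolve mcircle : core.

Lemma realCB (x y : R) : x%:C%C - y%:C%C = (x - y)%:C%C :> C.
Proof. by rewrite rmorphB. Qed.

Lemma ReD z w : complex.Re (z + w) = complex.Re z + complex.Re w.
Proof. exact: raddfD. Qed.

Lemma ReB z w : complex.Re (z - w) = complex.Re z - complex.Re w.
Proof. exact: raddfB. Qed.

Lemma ReZ (x : R) z : complex.Re (x%:C%C * z) = x * complex.Re z.
Proof. by rewrite ReM/= mul0r subr0. Qed.

Lemma int1_ae_bounded u (M : R) : measurable_fun circle u ->
  almost_everywhereT (fun t => `|u t| <= M) -> L2 (fun t => (u t)%:C%C) /\ int1 u.
Proof.
move=> mu' uM; suff Lu : L2 (fun t => (u t)%:C%C) by split => //; exact: L2_int1_real.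
apply: Linfty_L2; split; first exact: measurableC_real.
by exists M; apply: aeT_imp uM _ => t _; rewrite normcR.
Qed.

(** The squared distance is 2 - 2 Re(conj(cis s) cis t). That its Poisson integral vanishes as r ->
    1 expresses, in closed form, the concentration of the Poisson kernel at cis s. *)
Lemma herg_dist_sqr r s : 0 <= r < 1 ->
  complex.Re (herg (fun t => normc (cis t - cis s) ^+ 2) (r%:C%C * cis s)) = 2 - 2 * r.
Proof.
move=> /andP[r0 r1]; have z1 : normc (r%:C%C * cis s) < 1 by rewrite normc_rcis.
pose u t := complex.Re (conjc (cis s) * cis t).
have mu' : measurable_fun circle u.
  by have [] := measurableCM (measurableC_cst (conjc (cis s))) (@measurableC_cis R).
have iu : int1 u.
  apply: (int1_bounded (M := 1)) => // t _.
  by rewrite (le_trans (normr_Re_le _))// normcM normcJ !normc_cis mulr1.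
have -> : (fun t => normc (cis t - cis s) ^+ 2) = (fun t => 2 - 2 * u t).
  apply/funext => t; rewrite /u normc_sqr ReM /cis/=.
  by have := cos2Dsin2 t; have := cos2Dsin2 s; lra.
rewrite hergB//; [|exact: int1_cst|exact: int1Z].
rewrite herg_cst// hergZ// ReB ReZ.
by rewrite poisson_trig// mulrCA [conjc _ * _]mulrC cis_mulJ mulr1.
Qed.

(** Positivity of the kernel turns a majorant of |v - v s| into a bound on the difference of the
    Poisson integrals, provided that the Poisson integral of the majorant is known. *)
Lemma poisson_lipschitz v (L d r s : R) : measurable_fun circle v -> 0 <= L -> 0 < d ->
  (forall t t', `|v t - v t'| <= L * normc (cis t - cis t')) -> 0 <= r < 1 ->
  `|complex.Re (herg v (r%:C%C * cis s)) - v s| <= L * (d / 2 + (1 - r) / d).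
Proof.
move=> mv L0 d0 vL r01; have /andP[r0 r1] := r01.
have z1 : normc (r%:C%C * cis s) < 1 by rewrite normc_rcis.
have iv : int1 v.
  apply: (int1_bounded (M := `|v 0| + L * 2)) => // t _.
  rewrite -(subrK (v 0) (v t)) addrC (le_trans (ler_normD _ _))// lerD2l.
  rewrite (le_trans (vL _ _))// ler_wpM2l//.
  by rewrite (le_trans (normc_triangle _ _))// normcN !normc_cis.
pose q t := normc (cis t - cis s) ^+ 2.
have iq : int1 q.
  apply: (int1_bounded (M := 4)).
    apply: measurable_normc2; apply: measurableCB; first exact: measurableC_cis.
    exact: measurableC_cst.
  move=> t _; rewrite ger0_norm ?sqr_ge0//.
  have : normc (cis t - cis s) <= 2.
    by rewrite (le_trans (normc_triangle _ _))// normcN !normc_cis.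
  by have := normc_ge0 (cis t - cis s); rewrite /q; nra.
pose K := L * (d / 2 + (1 - r) / d).
(* x <= d / 2 + x^2 / (2 d) replaces the distance by its square, whose Poisson integral is 2 - 2
   r. *)
pose b t := L * (d / 2) + (L / (2 * d)) * q t.
have ib : int1 b by apply: int1D; [exact: int1_cst|exact: int1Z].
have hb : complex.Re (herg b (r%:C%C * cis s)) = K.
  rewrite hergD//; [|exact: int1_cst|exact: int1Z].
  rewrite herg_cst// hergZ// ReD ReZ herg_dist_sqr// [complex.Re _]/=.
  by rewrite /K; field; rewrite gt_eqF.
have vb t : `|v t - v s| <= b t.
  apply: le_trans (vL t s) _; rewrite /b -(mulrA L) -mulrDr; apply: ler_wpM2l => //.
  have d2 : 0 < 2 * d by rewrite mulr_gt0.
  rewrite -(ler_pM2l d2) mulrDr mulVKf ?gt_eqF//.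
  by rewrite /q; have := sqr_ge0 (normc (cis t - cis s) - d); nra.
have h1 : complex.Re (herg v (r%:C%C * cis s)) <= complex.Re (herg (fun t => v s + b t) (r%:C%C * cis s)).
  apply: herg_le => //; first by apply: int1D => //; exact: int1_cst.
  apply: aeT_W => t _; rewrite -lerBlDl; exact: le_trans (ler_norm _) (vb t).
have h2 : complex.Re (herg (fun t => v s - b t) (r%:C%C * cis s)) <= complex.Re (herg v (r%:C%C * cis s)).
  apply: herg_le => //; first by apply: int1B => //; exact: int1_cst.
  apply: aeT_W => t _; rewrite lerBlDr -lerBlDl; apply: le_trans (vb t).
  by rewrite distrC ler_norm.
move: h1; rewrite hergD//; last exact: int1_cst.
move: h2; rewrite hergB//; last exact: int1_cst.
rewrite herg_cst// ReB ReD hb /= => h2 h1.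
by rewrite ler_norml; apply/andP; split; rewrite -/K; lra.
Qed.

Definition poisson_dilate u r t : C := (complex.Re (herg u (r%:C%C * cis t)))%:C%C.

Lemma poisson_cvg_lipschitz v (L : R) : measurable_fun circle v -> 0 <= L ->
  (forall t t', `|v t - v t'| <= L * normc (cis t - cis t')) ->
  forall e, 0 < e -> (1 : R)^'- [set r | forall t,
    normc (poisson_dilate v r t - (v t)%:C%C) <= e].
Proof.
move=> mv L0 vL e e0; have L1 : 0 < L + 1 by rewrite ltr_wpDl.
pose d := e / (L + 1); have d0 : 0 < d by rewrite divr_gt0.
have H : (1 : R)^'- [set r | 1 - d * d / 2 < r].
  by apply: nbhs_left_gt; rewrite ltrBlDr ltrDl divr_gt0// mulr_gt0.
apply: filterS2 (at_left1_unit R) H => r r01; rewrite /mkset => hr t.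
rewrite /poisson_dilate realCB normcR; apply: le_trans (poisson_lipschitz t mv L0 d0 vL r01) _.
have h : (1 - r) / d <= d / 2 by rewrite ler_pdivrMr//; lra.
apply: (@le_trans _ _ (L * d)); first by rewrite ler_wpM2l//; lra.
by rewrite /d mulrCA ger_pMr// ler_pdivrMr// mul1r lerDl.
Qed.

Lemma measurable_poisson_dilate u r : int1 u -> 0 <= r < 1 ->
  measurableC (poisson_dilate u r).
Proof.
move=> iu r01; apply: measurableC_real.
by have [] := measurable_dilate (analytic_herg iu) r01.
Qed.

Lemma poisson_dilateB u v r t : int1 u -> int1 v -> 0 <= r < 1 ->
  poisson_dilate (fun t => u t - v t) r t = poisson_dilate u r t - poisson_dilate v r t.
Proof.
move=> iu iv /andP[r0 r1]; rewrite /poisson_dilate hergB ?normc_rcis//.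
by rewrite ReB rmorphB.
Qed.

(** A density argument: convergence is uniform for a Lipschitz v_n, and the Poisson integral of u -
    v_n stays small for all r by [sqnorm_herg_le]. *)
Lemma poisson_cvg u (v_ : nat -> R -> R) : L2 (fun t => (u t)%:C%C) ->
  (forall n, measurable_fun circle (v_ n)) ->
  (forall n, exists L : R, 0 <= L /\
     forall t t', `|v_ n t - v_ n t'| <= L * normc (cis t - cis t')) ->
  cvgL2 \oo (fun n t => (v_ n t)%:C%C) (fun t => (u t)%:C%C) ->
  cvgL2 (1 : R)^'- (poisson_dilate u) (fun t => (u t)%:C%C).
Proof.
move=> Lu mv_ vL cv e e0.
have iu := L2_int1_real Lu; have p0 := pi2_gt0 R.
have [n _ /(_ n (leqnn n)) /= hn] := cv _ (divr_gt0 e0 (ltr0Sn _ 63)).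
set v := v_ n in hn *; have mv : measurable_fun circle v by exact: mv_.
have [L [L0 HL]] := vL n.
have mCv : measurableC (fun t => (v t)%:C%C) by exact: measurableC_real.
have Lv : L2 (fun t => (v t)%:C%C).
  apply: (L2_bounded_real (M := `|v 0| + L * 2)) => // t _.
  rewrite -(subrK (v 0) (v t)) addrC (le_trans (ler_normD _ _))// lerD2l.
  rewrite (le_trans (HL _ _))// ler_wpM2l//.
  by rewrite (le_trans (normc_triangle _ _))// normcN !normc_cis.
have iv := L2_int1_real Lv.
pose d := Num.sqrt (e / 64 / (pi *+ 2)).
have ed0 : 0 < e / 64 / (pi *+ 2) by rewrite !divr_gt0.
have d0 : 0 < d by rewrite sqrtr_gt0.
apply: filterS2 (at_left1_unit R) (poisson_cvg_lipschitz mv L0 HL d0) => r r01 /= hr.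
have mPu := measurable_poisson_dilate iu r01.
have mPv := measurable_poisson_dilate iv r01.
have mCu := L2_meas Lu.
have h1 : (sqnorm (fun t => poisson_dilate u r t - poisson_dilate v r t)%R <= (8 * (e / 64))%:E)%E.
  have -> : (fun t => poisson_dilate u r t - poisson_dilate v r t) =
      poisson_dilate (fun t => u t - v t) r.
    by apply/funext => t; rewrite poisson_dilateB.
  have E : (fun t => (u t - v t)%:C%C) = (fun t => (u t)%:C%C - (v t)%:C%C).
    by apply/funext => t; rewrite rmorphB.
  have LB : L2 (fun t => (u t - v t)%:C%C) by rewrite E; exact: L2B.
  apply: le_trans (sqnorm_herg_le LB r01) _.
  by rewrite EFinM; apply: lee_wpmul2l => //; rewrite E sqnormBC.
have h2 : (sqnorm (fun t => poisson_dilate v r t - (v t)%:C%C)%R <= (e / 64)%:E)%E.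
  apply: le_trans (sqnorm_le_cst _ (ltW d0) _) _ => [|t _|]; [exact: measurableCB|exact: hr|].
  by rewrite lee_fin sqr_sqrtr ?(ltW ed0)// mulrC divfK// gt_eqF.
apply: (le_trans (sqnorm_triangle mPu mPv mCu)).
apply: (@le_trans _ _ (2%:E * (8 * (e / 64))%:E + 2%:E * (2%:E * (e / 64)%:E + 2%:E * (e / 64)%:E))%E).
  apply: leeD; apply: lee_wpmul2l => //.
  apply: (le_trans (sqnorm_triangle mPv mCv mCu)).
  by apply: leeD; apply: lee_wpmul2l.
by rewrite -!EFinM -EFinD lee_fin; lra.
Qed.

Lemma expR_lipschitz (x y B : R) : x <= B -> y <= B -> `|expR x - expR y| <= expR B * `|x - y|.
Proof.
wlog xy : x y / x <= y => [H|xB yB].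
  have [xy|/ltW yx] := leP x y; first exact: H.
  by move=> xB yB; rewrite distrC (distrC x); exact: H.
rewrite distrC (distrC x) !ger0_norm ?subr_ge0 ?ler_expR//.
have -> : expR x = expR y * expR (x - y) by rewrite -expRD addrC subrK.
have -> : expR y - expR y * expR (x - y) = expR y * (1 - expR (x - y)) by ring.
apply: ler_pM; [exact: expR_ge0| |by rewrite ler_expR|].
  by rewrite subr_ge0 -expR0 ler_expR subr_le0.
by have := expR_ge1Dx (x - y); lra.
Qed.

(** The outer function of modulus exp u. It is indexed by the logarithm of the modulus, so that
    products and inverses become sums and opposites. *)
Definition outf u z : C := cexp (herg u z).

Lemma analytic_outf u : int1 u -> analytic_disc (outf u).
Proof. by move=> iu; apply: analytic_cexp; exact: analytic_herg. Qed.

Lemma normc_outf u z : normc (outf u z) = expR (complex.Re (herg u z)).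
Proof. exact: normc_cexp. Qed.

Lemma outfD u v z : int1 u -> int1 v -> normc z < 1 ->
  outf (fun t => u t + v t) z = outf u z * outf v z.
Proof. by move=> iu iv z1; rewrite /outf hergD// cexpD. Qed.

Lemma outfN u z : int1 u -> normc z < 1 -> outf (fun t => - u t) z * outf u z = 1.
Proof.
move=> iu z1; rewrite -outfD//; last exact: int1N.
have -> : (fun t => - u t + u t) = fun=> 0 by apply/funext => t; rewrite addNr.
by rewrite /outf herg_cst// cexp0.
Qed.

Lemma outf_le u (M : R) z : int1 u -> almost_everywhereT (fun t => u t <= M) ->
  normc z < 1 -> normc (outf u z) <= expR M.
Proof.
move=> iu uM z1; rewrite normc_outf ler_expR.
apply: le_trans (herg_le iu (int1_cst M) z1 uM) _.
by rewrite herg_cst.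
Qed.

(** Inside the disc the modulus is the exponential of the Poisson integral, which is at most B, and
    the exponential is Lipschitz below B. So the moduli on the circles converge in L^2 both to |g|
    and to exp u. *)
Lemma outf_boundary_modulus u (B : R) g : measurable_fun circle u ->
  almost_everywhereT (fun t => `|u t| <= B) ->
  cvgL2 (1 : R)^'- (poisson_dilate u) (fun t => (u t)%:C%C) ->
  measurableC g -> boundary_function (outf u) g ->
  almost_everywhereT (fun t => normc (g t) = expR (u t)).
Proof.
move=> mu' uB cP mg /boundaryP bg; have [Lu iu] := int1_ae_bounded mu' uB.
have ao := analytic_outf iu.
have c1 : cvgL2 (1 : R)^'- (fun r t => (normc (dilate (outf u) r t))%:C%C)
    (fun t => (normc (g t))%:C%C).
  exact: (cvgL2_normc (near_meas_dilate ao) mg bg).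
have mE : measurableC (fun t => (expR (u t))%:C%C).
  by apply: measurableC_real; exact: measurableT_comp.
have c2 : cvgL2 (1 : R)^'- (fun r t => (normc (dilate (outf u) r t))%:C%C)
    (fun t => (expR (u t))%:C%C).
  apply: (cvgL2_le (sqr_ge0 (expR B)) _ cP).
  apply: filterS (at_left1_unit R) => r r01 /=.
  have mP := measurable_poisson_dilate iu r01.
  have mPB := measurableCB mP (L2_meas Lu).
  have -> : expR B ^+ 2 = normc ((expR B)%:C%C : C) ^+ 2.
    by rewrite normcR ger0_norm// expR_ge0.
  rewrite -sqnormZ//; apply: le_sqnorm.
  - apply: measurableCB => //.
    exact: (measurableC_real (measurable_normc (measurable_dilate ao r01))).
  - by apply: measurableCM => //; exact: measurableC_cst.
  - apply: (aeT_imp (uB)) => t _ ub.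
    have z1 : normc (r%:C%C * cis t) < 1 by case/andP: r01 => r0 r1; rewrite normc_rcis.
    have xB : complex.Re (herg u (r%:C%C * cis t)) <= B.
      have := herg_le iu (int1_cst B) z1; rewrite herg_cst//; apply.
      by apply: aeT_imp uB _ => s _; apply: le_trans; exact: ler_norm.
    have E1 : normc (dilate (outf u) r t) = expR (complex.Re (herg u (r%:C%C * cis t))).
      exact: normc_outf.
    change (normc ((normc (dilate (outf u) r t))%:C%C - (expR (u t))%:C%C) <=
      normc ((expR B)%:C%C * (poisson_dilate u r t - (u t)%:C%C))).
    rewrite E1 /poisson_dilate; move: (complex.Re _) xB => x xB.
    rewrite !realCB normcM !normcR (ger0_norm (expR_ge0 B)).
    by apply: expR_lipschitz => //; apply: le_trans ub; exact: ler_norm.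
have m1 : (1 : R)^'- [set r | measurableC (fun t => (normc (dilate (outf u) r t))%:C%C)].
  apply: filterS (at_left1_unit R) => r r01.
  exact: (measurableC_real (measurable_normc (measurable_dilate ao r01))).
have mng : measurableC (fun t => (normc (g t))%:C%C).
  by apply: measurableC_real; exact: measurable_normc.
have H : aeT (fun t => (normc (g t))%:C%C) (fun t => (expR (u t))%:C%C).
  exact: (cvgL2_unique m1 mng mE c1 c2).
by apply: (aeT_imp H) => t _ /(@complexI R).
Qed.

(** The truncated logarithm: bounded below by ln e and Lipschitz with constant 1 / e, so that it
    preserves L^2 convergence. *)
Definition logmax (e x : R) : R := ln (Num.max x e).

Lemma logmax_lipschitz e x y : 0 < e -> `|logmax e x - logmax e y| <= e^-1 * `|x - y|.
Proof.
move=> e0; rewrite /logmax; wlog xy : x y / y <= x => [H|].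
  have [xy|/ltW yx] := leP y x; first exact: H.
  by rewrite distrC (distrC x); exact: H.
set a := Num.max x e; set b := Num.max y e.
have ae : e <= a by rewrite le_max lexx orbT.
have be : e <= b by rewrite le_max lexx orbT.
have ba : b <= a by rewrite /a /b ge_max le_max xy le_max lexx orbT.
have a0 : 0 < a by exact: lt_le_trans ae.
have b0 : 0 < b by exact: lt_le_trans be.
have abxy : a - b <= x - y.
  rewrite /a /b !maxEle; case: ifP => [xe|/negbT]; case: ifP => [ye|/negbT]; rewrite -?ltNge; lra.
rewrite !ger0_norm ?subr_ge0 ?ler_ln//.
rewrite -ln_div ?posrE//.
apply: (@le_trans _ _ (a / b - 1)).
  have := @le_ln1Dx _ (a / b - 1); rewrite [1 + _]addrC subrK; apply.
  by rewrite ltrBrDl subrr divr_gt0.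
apply: (@le_trans _ _ ((a - b) / b)); first by rewrite mulrBl divff// gt_eqF.
rewrite mulrC; apply: ler_pM; rewrite ?invr_ge0 ?subr_ge0 ?(ltW b0)//.
by rewrite lef_pV2// posrE.
Qed.

Lemma measurable_logmax e h : measurableC h ->
  measurable_fun circle (fun t => logmax e (normc (h t))).
Proof.
move=> mh; apply: (measurableT_comp (@measurable_ln R)).
by apply: measurable_maxr; [exact: measurable_normc|exact: measurable_cst].
Qed.

Lemma trig_lipschitz c n : exists L : R, 0 <= L /\ forall t s,
  normc (trig c n t - trig c n s) <= L * normc (cis t - cis s).
Proof.
exists (\sum_(k < n) normc (c k) * k%:R); split.
  by rewrite sumr_ge0// => k _; rewrite mulr_ge0// normc_ge0.
move=> t s; rewrite /trig -sumrB mulr_suml; apply: le_trans (normc_sum _ _ _) _.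
apply: ler_sum => k _; rewrite -mulrBr normcM -mulrA ler_wpM2l ?normc_ge0//.
apply: le_trans (@normc_exprB_le _ _ _ 1 k _ _) _; rewrite ?normc_cis//.
by rewrite expr1n mulr1.
Qed.

(** The Lipschitz approximants are the truncated logarithms of the moduli of the Fourier partial
    sums of h; here it matters that h is in H^2, where these sums converge to h. *)
Lemma poisson_cvg_logmax e h : 0 < e -> H2plus h ->
  L2 (fun t => (logmax e (normc (h t)))%:C%C) ->
  cvgL2 (1 : R)^'- (poisson_dilate (fun t => logmax e (normc (h t))))
    (fun t => (logmax e (normc (h t)))%:C%C).
Proof.
move=> e0 /H2plus_trigP[Lh ch] Ll.
have mt n : measurableC (trig (fcoef h) n) by exact: L2_meas (L2_trig _ _).
apply: (poisson_cvg (v_ := fun n t => logmax e (normc (trig (fcoef h) n t)))) => //.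
- by move=> n; exact: measurable_logmax.
- move=> n; have [L [L0 HL]] := trig_lipschitz (fcoef h) n.
  exists (e^-1 * L); split; first by rewrite mulr_ge0// invr_ge0 ltW.
  move=> t s; apply: le_trans (logmax_lipschitz _ _ e0) _.
  rewrite -mulrA; apply: ler_wpM2l; first by rewrite invr_ge0 ltW.
  exact: le_trans (normc_dist _ _) (HL t s).
- apply: (cvgL2_le (sqr_ge0 e^-1) _ ch).
  exists 0%N => // n _.
  change (sqnorm (fun t => (logmax e (normc (trig (fcoef h) n t)))%:C%C -
      (logmax e (normc (h t)))%:C%C)%R <=
    (e^-1 ^+ 2)%:E * sqnorm (fun t => trig (fcoef h) n t - h t)%R)%E.
  have -> : e^-1 ^+ 2 = normc ((e^-1)%:C%C : C) ^+ 2 by rewrite normcR real_normK ?num_real.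
  have mB := measurableCB (mt n) (L2_meas Lh).
  rewrite -sqnormZ//; apply: le_sqnorm.
  + apply: measurableCB; last exact: L2_meas Ll.
    by apply: measurableC_real; exact: measurable_logmax.
  + by apply: measurableCM => //; exact: measurableC_cst.
  + apply: aeT_W => t _; rewrite realCB normcM !normcR.
    rewrite (ger0_norm (_ : 0 <= e^-1)) ?invr_ge0 ?(ltW e0)//.
    apply: le_trans (logmax_lipschitz _ _ e0) _.
    by apply: ler_wpM2l; [rewrite invr_ge0 ltW|exact: normc_dist].
Qed.

End OuterFunctions.

(** * Integrability of ln |h| as a limit of truncated logarithms *)

Section LogIntegrability.
Variable R : realType.
Local Notation mu := (@lebesgue_measure R).
Local Notation C := R[i].
Local Notation circle := (@circle R).
Local Notation int1 f := (mu.-integrable circle (EFin \o f)).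
Implicit Types (f g h : R -> C) (u v : R -> R) (x e M K : R).
Let mcircle := @measurable_circle R.
#[local] Hint Resolve mcircle : core.

Lemma int1_le_ae u v : measurable_fun circle u -> int1 v ->
  almost_everywhereT (fun t => `|u t| <= v t) -> int1 u.
Proof.
move=> mu' iv uv; apply/integrableP; split; first exact/measurable_EFinP.
have /integrableP[mv] := iv.
apply: le_lt_trans; apply: (@ae_ge0_le_integral _ _ _ mu) => //.
- by apply: measurableT_comp => //; exact/measurable_EFinP.
- by apply: measurableT_comp.
- by apply: (aeT_imp uv) => t _ /= h; rewrite lee_fin (le_trans h)// ler_norm.
Qed.

(** The truncation levels 1 / (n + 1): positive from n = 0 on, and never above a bound M >= 1 of
    |h|. *)
Definition inv1 (n : nat) : R := n.+1%:R^-1.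

Lemma inv1_gt0 n : 0 < inv1 n. Proof. by rewrite invr_gt0. Qed.

Lemma inv1_le1 n : inv1 n <= 1. Proof. by rewrite invf_le1// ler1n. Qed.

Lemma le_inv1 m n : (m <= n)%N -> inv1 n <= inv1 m.
Proof. by move=> mn; rewrite lef_pV2 ?posrE// ler_nat. Qed.

Lemma inv1_small x : 0 < x -> exists N, forall n, (N <= n)%N -> inv1 n <= x.
Proof.
move=> x0; exists (Num.bound x^-1) => n Nn; rewrite -[x]invrK lef_pV2 ?posrE ?invr_gt0//.
have x10 : 0 <= x^-1 by rewrite invr_ge0 ltW.
by rewrite (le_trans (ltW (archi_boundP x10)))// ler_nat (leq_trans Nn).
Qed.

Lemma logmaxK e x : 0 < e -> expR (logmax e x) = Num.max x e.
Proof. by move=> e0; rewrite lnK// posrE lt_max e0 orbT. Qed.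

Lemma logmax_id e x : e <= x -> logmax e x = ln x.
Proof. by move=> ex; rewrite /logmax max_l. Qed.

Lemma logmax_le e x M : 0 < e -> x <= M -> e <= M -> logmax e x <= ln M.
Proof.
move=> e0 xM eM; rewrite ler_ln ?posrE ?(lt_le_trans e0 eM)// ?lt_max ?e0 ?orbT//.
by rewrite ge_max xM.
Qed.

Lemma logmax_ge e x : 0 < e -> ln e <= logmax e x.
Proof. by move=> e0; rewrite ler_ln ?posrE ?lt_max ?e0 ?orbT// le_max lexx orbT. Qed.

Lemma ln_le_logmax e x : 0 < e -> 0 < x -> ln x <= logmax e x.
Proof. by move=> e0 x0; rewrite ler_ln ?posrE ?lt_max ?x0// le_max lexx. Qed.

Lemma le_logmax e e' x : 0 < e -> e <= e' -> logmax e x <= logmax e' x.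
Proof.
move=> e0 ee; have e'0 := lt_le_trans e0 ee.
rewrite ler_ln ?posrE ?lt_max ?e0 ?e'0 ?orbT//.
by rewrite ge_max !le_max lexx ee orbT.
Qed.

Lemma logmax_ae_bounded e M h : 0 < e -> e <= M ->
  almost_everywhereT (fun t => normc (h t) <= M) ->
  almost_everywhereT (fun t => `|logmax e (normc (h t))| <= `|ln e| + `|ln M|).
Proof.
move=> e0 eM hM; apply: aeT_imp hM _ => t _ h1.
have := logmax_ge (normc (h t)) e0; have := logmax_le e0 h1 eM.
move: (logmax _ _) (ler_norm (ln M)) (ler_norm (- ln e)) => x; rewrite normrN.
have := normr_ge0 (ln M); have := normr_ge0 (ln e).
by move=> *; rewrite ler_norml; apply/andP; split; lra.
Qed.

(** Monotone convergence: ln M minus the truncated logarithm increases with n, and its limit G has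
    integral at most K, hence is finite almost everywhere and dominates ln M - ln |h|. *)
Lemma log_integrable h M K : measurableC h -> 1 <= M ->
  almost_everywhereT (fun t => normc (h t) <= M) ->
  (forall n, \int[mu]_(t in circle) (ln M - logmax (inv1 n) (normc (h t))) <= K) ->
  almost_everywhereT (fun t => h t <> 0) /\ int1 (fun t => ln (normc (h t))).
Proof.
move=> mh M1 hM hK; pose ul n t := logmax (inv1 n) (normc (h t)).
have iM n : inv1 n <= M by exact: le_trans (inv1_le1 n) M1.
have mul n : measurable_fun circle (ul n) by exact: measurable_logmax.
have iul n : int1 (ul n).
  by have [] := int1_ae_bounded (mul n) (logmax_ae_bounded (inv1_gt0 n) (iM n) hM).
(* Since |h| <= M holds only almost everywhere, the maximum with 0 makes phi nonnegative at every
   point without changing its integral. *)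
pose phi n t := Num.max (ln M - ul n t) 0.
have mphi n : measurable_fun circle (phi n).
  apply: measurable_maxr; last exact: measurable_cst.
  by apply: measurable_funB => //; exact: measurable_cst.
have phiE n : almost_everywhereT (fun t => ln M - ul n t = phi n t).
  apply: aeT_imp hM _ => t _ h1; rewrite /phi max_l// subr_ge0.
  exact: logmax_le (inv1_gt0 n) h1 (iM n).
have iphi n : int1 (phi n).
  by apply: int1_ae (phiE n) _ => //; apply: int1B => //; exact: int1_cst.
have phi0 n t : 0 <= phi n t by rewrite le_max lexx orbT.
have phiK n : (\int[mu]_(t in circle) (phi n t)%:E <= K%:E)%E.
  rewrite -EFin_Rint// lee_fin; apply: le_trans (hK n).
  rewrite le_eqVlt; apply/orP; left; apply/eqP; apply/esym/Rint_ae => //.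
    by apply: measurable_funB => //; exact: (mul n).
  exact: phiE.
have nd t : {homo (fun n => (phi n t)%:E) : m n / (m <= n)%N >-> (m <= n)%E}.
  move=> p q pq; rewrite lee_fin /phi ge_max !le_max lexx orbT andbT lerD2l lerN2.
  by rewrite le_logmax ?inv1_gt0// le_inv1.
pose G t := limn (fun n => (phi n t)%:E).
have mphiE n : measurable_fun circle (fun t => (phi n t)%:E) by exact/measurable_EFinP.
have GK : (\int[mu]_(t in circle) G t <= K%:E)%E.
  rewrite (@monotone_convergence _ _ _ mu _ mcircle (fun n t => (phi n t)%:E))//.
    apply: lime_le; last exact: nearW.
    apply: ereal_nondecreasing_is_cvgn => m n mn.
    apply: (@ge0_le_integral _ _ _ mu) => //.
    - by move=> t _; rewrite lee_fin.
    - exact: mphiE.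
    - exact: mphiE.
    - by move=> t _; exact: nd.
  by move=> n t _; rewrite lee_fin.
have cG t : (fun n => (phi n t)%:E) @ \oo --> G t by exact: ereal_nondecreasing_is_cvgn (nd t).
have leG n t : ((phi n t)%:E <= G t)%E.
  apply: lime_ge; first exact: ereal_nondecreasing_is_cvgn (nd t).
  by exists n => // m /= nm; exact: nd.
have G0 t : (0 <= G t)%E by apply: le_trans (leG 0%N t); rewrite lee_fin.
have mG : measurable_fun circle G by apply: (emeasurable_fun_cvg (fun n t => (phi n t)%:E)) => // t _; exact: cG.
have iG : mu.-integrable circle G.
  apply/integrableP; split => //.
  rewrite (_ : (\int[mu]_(x in circle) _ = \int[mu]_(x in circle) G x)%E).
    by rewrite (le_lt_trans GK)// ltry.
  by apply: eq_integral => t _; rewrite gee0_abs.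
have Gfin : almost_everywhereT (fun t => G t \is a fin_num) by exact: (@integrable_ae _ _ _ mu _ mcircle _ iG).
have h0 : almost_everywhereT (fun t => h t <> 0).
  (* At a zero of h, phi n is at least ln (n + 1), so G would be infinite. *)
  apply: aeT_imp Gfin _ => t _ Gf ht.
  have gE := fineK Gf.
  have bd n : ln (n.+1%:R) <= fine (G t).
    rewrite -lee_fin gE; apply: le_trans (leG n t).
    rewrite lee_fin /phi le_max; apply/orP; left.
    rewrite /ul ht normc0 /logmax max_r; last by rewrite ltW// inv1_gt0.
    rewrite lnV ?posrE// opprK lerDr; exact: ln_ge0.
  have B0 : 0 <= expR (fine (G t)) by exact: expR_ge0.
  have := bd (Num.bound (expR (fine (G t)))).
  rewrite -ler_expR lnK ?posrE// => h1.
  have h2 := archi_boundP B0.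
  have : (Num.bound (expR (fine (G t))))%:R <= (Num.bound (expR (fine (G t)))).+1%:R :> R by rewrite ler_nat.
  by move: h1 h2; lra.
split => //.
have iGf : int1 (fun t => fine (G t)).
  apply/integrableP; split.
    by apply/measurable_EFinP; exact: measurableT_comp.
  rewrite (_ : (\int[mu]_(x in circle) _ = \int[mu]_(x in circle) `|G x|)%E).
    by have /integrableP[] := iG.
  apply: (@ae_eq_integral _ _ _ mu) => //.
  - by apply: measurableT_comp => //; apply/measurable_EFinP; exact: measurableT_comp.
  - exact: measurableT_comp.
  - by apply: (aeT_imp Gfin) => t _ /= Gf; rewrite -{2}(fineK Gf).
apply: (@int1_le_ae _ (fun t => `|ln M| + fine (G t))).
- by apply: (measurableT_comp (@measurable_ln R)); exact: measurable_normc.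
- by apply: int1D => //; exact: int1_cst.
- have H := aeT_imp2 Gfin h0 (fun t _ a b => conj a b).
  apply: aeT_imp2 H hM _ => t _ [Gf ht] h1.
  have n0 : 0 < normc (h t) by rewrite normc_gt0; apply/eqP.
  have [N /(_ N (leqnn N)) hN] := inv1_small n0.
  have : ln M - ln (normc (h t)) <= fine (G t).
    rewrite -lee_fin fineK//; apply: le_trans (leG N t).
    by rewrite lee_fin /phi le_max /ul logmax_id// lexx.
  have : ln (normc (h t)) <= ln M by rewrite ler_ln ?posrE ?(lt_le_trans ltr01 M1).
  have : 0 <= fine (G t) by exact: fine_ge0.
  have := ler_norm (ln M); have := ler_norm (- ln M); rewrite normrN.
  by move=> *; rewrite ler_norml; apply/andP; split; lra.
Qed.

(** Dominated convergence: where h <> 0 the difference is 0 as soon as 1 / (n + 1) <= |h|, and it is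
    dominated by the difference for n = 0. *)
Lemma logmax_cvg_L1 h M e : measurableC h -> 1 <= M ->
  almost_everywhereT (fun t => normc (h t) <= M) ->
  almost_everywhereT (fun t => h t <> 0) -> int1 (fun t => ln (normc (h t))) ->
  0 < e -> exists N, forall n, (N <= n)%N ->
   \int[mu]_(t in circle) `|logmax (inv1 n) (normc (h t)) - ln (normc (h t))| <= e.
Proof.
move=> mh M1 hM h0 iu e0; pose ul n t := logmax (inv1 n) (normc (h t)).
pose u t := ln (normc (h t)).
have iM n : inv1 n <= M by exact: le_trans (inv1_le1 n) M1.
have mul n : measurable_fun circle (ul n) by exact: measurable_logmax.
have mu' : measurable_fun circle u by exact: int1_measurable.
have iul n : int1 (ul n).
  by have [] := int1_ae_bounded (mul n) (logmax_ae_bounded (inv1_gt0 n) (iM n) hM).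
pose d n t := `|ul n t - u t|.
have md n : measurable_fun circle (d n).
  by apply: measurableT_comp => //; exact: measurable_funB.
have iD : mu.-integrable circle (fun t => (ul 0%N t - u t)%:E).
  exact: int1B (iul 0%N) iu.
have mdE n : measurable_fun circle (fun t => (d n t)%:E) by exact/measurable_EFinP.
have cv : {ae mu, forall t, circle t -> (fun n => (d n t)%:E) @ \oo --> 0%:E}.
  apply: (aeT_imp (h0)) => t _ ht.
  have n0 : 0 < normc (h t) by rewrite normc_gt0; apply/eqP.
  have [N hN] := inv1_small n0.
  apply: cvg_near_cst; exists N => // n /= Nn.
  by rewrite /d /ul logmax_id ?hN// /u subrr normr0.
have dom : {ae mu, forall t n, circle t -> (`|(d n t)%:E| <= (ul 0%N t - u t)%:E)%E}.
  have := h0; rewrite /almost_everywhereT.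
  apply: filterS; first exact: (ae_filter_ringOfSetsType mu).
  move=> t ht n ct.
  have n0 : 0 < normc (h t) by rewrite normc_gt0; apply/eqP; exact: ht.
  rewrite lee_fin /d normr_id ger0_norm.
    by rewrite lerB// /ul le_logmax ?inv1_gt0// le_inv1.
  by rewrite subr_ge0; apply: ln_le_logmax => //; exact: inv1_gt0.
have [_ _ cl] := @dominated_convergence _ _ _ mu _ mcircle (fun n t => (d n t)%:E) (fun=> 0%E)
  (fun t => (ul 0%N t - u t)%:E) mdE (@measurable_cst _ _ _ _ _ _) cv iD dom.
rewrite integral0 in cl.
have id n : int1 (d n) by apply: int1_norm; exact: int1B.
have /fine_cvg cl' : (fun n => (\int[mu]_(t in circle) d n t)%:E) @ \oo --> 0%:E.
  by under eq_fun do rewrite EFin_Rint//.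
move/cvgrPdist_le : cl' => /(_ _ e0)[N _ hN].
exists N => n Nn; have := hN n Nn.
by rewrite distrC subr0; apply: le_trans; exact: ler_norm.
Qed.

End LogIntegrability.

(** * Outer majorants and the inner-outer factorization *)

Section InnerOuter.
Variable R : realType.
Local Notation mu := (@lebesgue_measure R).
Local Notation C := R[i].
Local Notation circle := (@circle R).
Local Notation int1 f := (mu.-integrable circle (EFin \o f)).
Local Notation inv1 := (@inv1 R).
Implicit Types (f g h q o : R -> C) (u v : R -> R) (z w : C) (F G H Q : C -> C) (x e M B K : R).
Let mcircle := @measurable_circle R.
#[local] Hint Resolve mcircle : core.

Lemma boundary_ext F G f : (forall z, normc z < 1 -> F z = G z) ->
  boundary_function F f -> boundary_function G f.
Proof.
move=> FG /boundaryP bf; apply/boundaryP => e e0.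
apply: filterS2 (at_left1_unit R) (bf e e0) => r /andP[r0 r1] /=.
have -> // : dilate F r = dilate G r.
by apply/funext => t; apply: FG; rewrite normc_rcis.
Qed.

Lemma Hinfty_data h : Hinfty h -> exists H M, [/\ analytic_disc H, boundary_function H h,
  1 <= M, forall z, normc z < 1 -> normc (H z) <= M
  & almost_everywhereT (fun t => normc (h t) <= M)].
Proof.
move=> Hh; have [_ [H [[aH [M HM]] bh]]] := Hh.
have HM' z : normc z < 1 -> normc (H z) <= Num.max 1 M.
  by move=> z1; rewrite le_max HM ?orbT.
exists H, (Num.max 1 M); split => //; first by rewrite le_max lexx.
exact: boundary_ae_le aH HM' (Hinfty_meas Hh) bh.
Qed.

Lemma outf_boundary u B : measurable_fun circle u ->
  almost_everywhereT (fun t => `|u t| <= B) ->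
  cvgL2 (1 : R)^'- (poisson_dilate u) (fun t => (u t)%:C%C) ->
  exists g, [/\ Linfty g, boundary_function (outf u) g,
    forall z, normc z < 1 -> normc (outf u z) <= expR B
    & almost_everywhereT (fun t => normc (g t) = expR (u t))].
Proof.
move=> mu' uB cu; have [Lu iu] := int1_ae_bounded mu' uB.
have ao := analytic_outf iu.
have oB z : normc z < 1 -> normc (outf u z) <= expR B.
  move=> z1; apply: outf_le => //; apply: (aeT_imp (uB)) => t _.
  by apply: le_trans; exact: ler_norm.
have [g [Lg _ bg]] := boundary_exists ao oB; exists g; split => //.
by apply: (outf_boundary_modulus mu' uB cu _ bg); case: Lg.
Qed.

Lemma poisson_dilateN u r t : int1 u -> 0 <= r < 1 ->
  poisson_dilate (fun t => - u t) r t = - poisson_dilate u r t.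
Proof.
move=> iu r01; have i0 := int1_cst (0 : R).
have -> : (fun t => - u t) = (fun t => 0 - u t) by apply/funext => s; rewrite sub0r.
rewrite poisson_dilateB// {1}/poisson_dilate herg_cst ?sub0r//.
by case/andP: r01 => r0 r1; rewrite normc_rcis.
Qed.

Lemma poisson_cvgN u : L2 (fun t => (u t)%:C%C) ->
  cvgL2 (1 : R)^'- (poisson_dilate u) (fun t => (u t)%:C%C) ->
  cvgL2 (1 : R)^'- (poisson_dilate (fun t => - u t)) (fun t => (- u t)%:C%C).
Proof.
move=> Lu cu e e0; have iu := L2_int1_real Lu.
apply: filterS2 (at_left1_unit R) (cu e e0) => r r01 /=.
have mP := measurable_poisson_dilate iu r01.
have -> : (fun t => poisson_dilate (fun t => - u t) r t - (- u t)%:C%C) =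
   (fun t => - (poisson_dilate u r t - (u t)%:C%C)).
  by apply/funext => t; rewrite poisson_dilateN// rmorphN opprB opprK addrC.
by rewrite sqnormN//; apply: measurableCB => //; exact: L2_meas.
Qed.

Section Truncations.
Variables (h : R -> C) (H : C -> C) (M : R).
Hypotheses (H2h : H2plus h) (M1 : 1 <= M).
Hypothesis hM : almost_everywhereT (fun t => normc (h t) <= M).
Let u_ n t := logmax (inv1 n) (normc (h t)).
Let B n := `|ln (inv1 n)| + `|ln M|.

Let mh : measurableC h. Proof. exact: L2_meas (H2plus_L2 H2h). Qed.

Let mu_ n : measurable_fun circle (u_ n). Proof. exact: measurable_logmax. Qed.

Let uB n : almost_everywhereT (fun t => `|u_ n t| <= B n).
Proof. by apply: logmax_ae_bounded => //; [exact: inv1_gt0|exact: le_trans (inv1_le1 _ n) M1]. Qed.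

Let Lu n : L2 (fun t => (u_ n t)%:C%C). Proof. by have [] := int1_ae_bounded (mu_ n) (uB n). Qed.

Let cu n : cvgL2 (1 : R)^'- (poisson_dilate (u_ n)) (fun t => (u_ n t)%:C%C).
Proof. by apply: poisson_cvg_logmax => //; [exact: inv1_gt0|exact: Lu]. Qed.

Lemma int1_trunc n : int1 (u_ n). Proof. by have [] := int1_ae_bounded (mu_ n) (uB n). Qed.

Lemma outf_trunc n : exists g, [/\ Linfty g, boundary_function (outf (u_ n)) g,
  exists K, forall z, normc z < 1 -> normc (outf (u_ n) z) <= K
  & almost_everywhereT (fun t => normc (g t) = Num.max (normc (h t)) (inv1 n))].
Proof.
have [g [Lg bg gB gE]] := outf_boundary (mu_ n) (uB n) (cu n).
exists g; split => //; first by exists (expR (B n)).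
by apply: (aeT_imp (gE)) => t _ ->; rewrite logmaxK// inv1_gt0.
Qed.

(** The inverse of the outer function of the truncated modulus, bounded because the truncation keeps
    that modulus away from 0. Multiplying by it replaces a division by h. *)
Lemma outf_truncN n : exists g, [/\ Linfty g, boundary_function (outf (fun t => - u_ n t)) g,
  exists K, forall z, normc z < 1 -> normc (outf (fun t => - u_ n t) z) <= K
  & almost_everywhereT (fun t => normc (g t) = (Num.max (normc (h t)) (inv1 n))^-1)].
Proof.
have uBN : almost_everywhereT (fun t => `|- u_ n t| <= B n).
  by apply: (aeT_imp (uB n)) => t _; rewrite normrN.
have mN : measurable_fun circle (fun t => - u_ n t) by exact: measurableT_comp.
have [g [Lg bg gB gE]] := outf_boundary mN uBN (poisson_cvgN (Lu n) (cu n)).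
exists g; split => //; first by exists (expR (B n)).
by apply: (aeT_imp (gE)) => t _ ->; rewrite expRN logmaxK// inv1_gt0.
Qed.

Hypotheses (aH : analytic_disc H) (bh : boundary_function H h).

(* The maximum principle for H / outf (u_ n), of boundary modulus |h| / max(|h|, 1/n). *)
Lemma le_outf_trunc n z : (forall z, normc z < 1 -> normc (H z) <= M) ->
  normc z < 1 -> normc (H z) <= normc (outf (u_ n) z).
Proof.
move=> HM z1; have [g [Lg bg [K gK] gE]] := outf_truncN n.
have iu := int1_trunc n.
have ag : analytic_disc (outf (fun t => - u_ n t)) by apply: analytic_outf; exact: int1N.
have Lh := H2plus_L2 H2h.
have bgh := boundaryM aH ag gK Lh (L2_meas (Linfty_L2 Lg)) bh bg.
have Lgh : L2 (fun t => g t * h t) by exact: L2M_Linfty.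
have gh1 : almost_everywhereT (fun t => normc (g t * h t) <= 1).
  apply: (aeT_imp (gE)) => t _ E; rewrite normcM E.
  have m0 : 0 < Num.max (normc (h t)) (inv1 n) by rewrite lt_max inv1_gt0 orbT.
  by rewrite mulrC ler_pdivrMr// mul1r le_max lexx.
have KM : forall z, normc z < 1 -> normc (outf (fun t => - u_ n t) z * H z) <= K * M.
  move=> w w1; rewrite normcM; apply: ler_pM; rewrite ?normc_ge0//; [exact: gK|exact: HM].
have := boundary_maximum (analyticM ag aH) KM Lgh bgh gh1 z1.
move=> h1; have -> : H z = outf (u_ n) z * (outf (fun t => - u_ n t) z * H z).
  by rewrite mulrA [_ * outf _ z]mulrC outfN// mul1r.
by rewrite [leLHS]normcM ler_piMr// normc_ge0.
Qed.

End Truncations.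

Lemma boundary_disc0 H h : L2 h -> boundary_function H h ->
  (forall z, normc z < 1 -> H z = 0) -> aeT h (cst 0).
Proof.
move=> Lh bh H0; have b0 : boundary_function (fun=> 0) h by exact: boundary_ext bh.
apply: boundary_unique (analytic_cst 0) (L2_meas Lh) _ b0 (boundary_cst 0).
exact: measurableC_cst.
Qed.

Lemma Hinfty_H2plus h : Hinfty h -> H2plus h.
Proof.
move=> Hh; have [H [M [aH bh _ _ _]]] := Hinfty_data Hh.
by apply/H2plusP; split; [exact: Hinfty_L2|exists H].
Qed.

Lemma Hinfty_log_integrable h : Hinfty h -> ~ aeT h (cst 0) ->
  almost_everywhereT (fun t => h t <> 0) /\ int1 (fun t => ln (normc (h t))).
Proof.
move=> Hh h0; have [H [M [aH bh M1 HM hM]]] := Hinfty_data Hh.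
have H2h := Hinfty_H2plus Hh; have p0 := pi2_gt0 R.
have [z [z1 Hz]] : exists z, normc z < 1 /\ H z <> 0.
  apply: contrapT => nz; apply: h0; apply: boundary_disc0 (Hinfty_L2 Hh) bh _ => z z1.
  by apply: contrapT => Hz; apply: nz; exists z.
have n0 : 0 < normc (H z) by rewrite normc_gt0; apply/eqP.
(* Harnack's constant at z: d times the integral of ln M - u_n is at most the value at z of its
   Poisson integral, and so at most ln M - ln |H z|. *)
pose d := (1 - normc z) / 2 * (pi *+ 2)^-1.
have d0 : 0 < d by rewrite mulr_gt0 ?invr_gt0// divr_gt0// subr_gt0.
apply: (log_integrable (K := (ln M - ln (normc (H z))) / d) (Hinfty_meas Hh) M1 hM) => n.
rewrite ler_pdivlMr// mulrC -mulrA.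
have iu := int1_trunc H2h M1 hM n.
have iD : int1 (fun t => ln M - logmax (inv1 n) (normc (h t))).
  by apply: int1B => //; exact: int1_cst.
apply: le_trans (herg_ge_avg iD z1 _) _.
  apply: (aeT_imp (hM)) => t _ h1; rewrite subr_ge0; apply: logmax_le => //.
    exact: inv1_gt0.
  exact: le_trans (inv1_le1 _ n) M1.
rewrite hergB//; last exact: int1_cst.
rewrite herg_cst// ReB lerD2l lerN2 -ler_expR lnK ?posrE// -normc_outf.
exact: (le_outf_trunc H2h M1 hM aH bh n HM z1).
Qed.

Lemma le_outf_log h H M z : H2plus h -> 1 <= M -> analytic_disc H -> boundary_function H h ->
  almost_everywhereT (fun t => normc (h t) <= M) ->
  (forall z, normc z < 1 -> normc (H z) <= M) ->
  almost_everywhereT (fun t => h t <> 0) -> int1 (fun t => ln (normc (h t))) ->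
  normc z < 1 -> normc (H z) <= normc (outf (fun t => ln (normc (h t))) z).
Proof.
move=> H2h M1 aH bh hM HM h0 iu z1; rewrite normc_outf.
have [/eqP Hz|Hz] := boolP (normc (H z) == 0); first by rewrite Hz expR_ge0.
have n0 : 0 < normc (H z) by rewrite lt_neqAle eq_sym Hz normc_ge0.
rewrite -[leLHS]lnK ?posrE// ler_expR; apply/ler_addgt0Pr => e e0.
have p0 := pi2_gt0 R; have d0 : 0 < 1 - normc z by rewrite subr_gt0.
(* The constant of [herg_lip] at z. *)
pose k := (pi *+ 2)^-1 * (2 * (2 / (1 - normc z))) : R.
have k0 : 0 < k by rewrite !mulr_gt0 ?invr_gt0.
have mh := L2_meas (H2plus_L2 H2h).
have [n /(_ n (leqnn n)) hn] := logmax_cvg_L1 mh M1 hM h0 iu (divr_gt0 e0 k0).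
have iun := int1_trunc H2h M1 hM n.
have h1 : `|complex.Re (herg (fun t => logmax (inv1 n) (normc (h t))) z) -
    complex.Re (herg (fun t => ln (normc (h t))) z)| <= e.
  rewrite -ReB; apply: le_trans (normr_Re_le _) _.
  apply: le_trans (herg_lip iun iu z1) _.
  rewrite [leLHS]mulrA -/k; apply: (@le_trans _ _ (k * (e / k))); first by apply: ler_wpM2l; [exact: ltW|exact: hn].
  by rewrite mulrC divfK// gt_eqF.
have h2 : ln (normc (H z)) <= complex.Re (herg (fun t => logmax (inv1 n) (normc (h t))) z).
  rewrite -ler_expR lnK ?posrE// -normc_outf.
  exact: (le_outf_trunc H2h M1 hM aH bh n HM z1).
by have := le_trans (ler_norm _) h1; lra.
Qed.

(** [outf_boundary_modulus] does not apply to ln |h|, which need not be bounded. The bound |o| <=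
    |h| comes from the truncations instead, and |o| |q| = |h| with |q| <= 1 yields the equality. *)
Lemma inner_outer h H : Hinfty h -> analytic_disc H -> boundary_function H h ->
  ~ aeT h (cst 0) -> let u t := ln (normc (h t)) in
  [/\ almost_everywhereT (fun t => h t <> 0), int1 u &
  exists q o, [/\ Hinfty q, Hinfty o /\ boundary_function (outf u) o,
    boundary_function (fun z => outf (fun t => - u t) z * H z) q,
    almost_everywhereT (fun t => normc (q t) = 1) &
    aeT h (fun t => q t * o t)]].
Proof.
move=> Hh aH bh h0' u; have [h0 iu] := Hinfty_log_integrable Hh h0'.
split => //; have [H' [M [aH' bh' M1 HM' hM]]] := Hinfty_data Hh.
have HM z : normc z < 1 -> normc (H z) <= M.
  move=> z1; have Lh := Hinfty_L2 Hh.
  rewrite (boundary_disc_eq aH aH' Lh Lh bh bh')//; first exact: HM'.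
  exact: aeT_W.
have H2h := Hinfty_H2plus Hh; have mh := Hinfty_meas Hh.
have M0 : 0 < M := lt_le_trans ltr01 M1.
have uM : almost_everywhereT (fun t => u t <= ln M).
  apply: (aeT_imp2 (h0) hM) => t _ ht h1; rewrite ler_ln ?posrE//.
  by rewrite normc_gt0; apply/eqP.
have aN : analytic_disc (outf (fun t => - u t)) by apply: analytic_outf; exact: int1N.
have au : analytic_disc (outf u) by exact: analytic_outf.
have oM z : normc z < 1 -> normc (outf u z) <= M.
  by move=> z1; rewrite -[leRHS]lnK ?posrE//; exact: outf_le.
have [ o [Lo _ bo]] := boundary_exists au oM.
pose Q z := outf (fun t => - u t) z * H z.
have aQ : analytic_disc Q by exact: analyticM.
have HQ z : normc z < 1 -> H z = outf u z * Q z.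
  by move=> z1; rewrite mulrA [_ * outf _ z]mulrC outfN// mul1r.
have Q1 z : normc z < 1 -> normc (Q z) <= 1.
  move=> z1; have o0 : 0 < normc (outf u z) by rewrite normc_outf expR_gt0.
  rewrite -(ler_pM2l o0) mulr1 -normcM -HQ//.
  exact: (le_outf_log H2h M1 aH bh hM HM h0 iu z1).
have [q [Lq q1 bq]] := boundary_exists aQ Q1.
have mo := L2_meas (Linfty_L2 Lo); have mq := L2_meas (Linfty_L2 Lq).
have bqo := boundaryM aQ au oM (Linfty_L2 Lq) mo bq bo.
have hqo : aeT h (fun t => o t * q t).
  have boq : boundary_function H (fun t => o t * q t).
    by apply: boundary_ext bqo => z z1; rewrite HQ.
  by apply: boundary_unique aH mh _ bh boq; exact: measurableCM.
(* outf u is the product of outf (u - u_n), of modulus at most 1 as u <= u_n almost everywhere, and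
   of outf u_n, whose boundary modulus is known. *)
have o_le n : almost_everywhereT (fun t => normc (o t) <= Num.max (normc (h t)) (inv1 n)).
  have [g [Lg bg [K gK] gE]] := outf_trunc H2h M1 hM n.
  pose un t := logmax (inv1 n) (normc (h t)).
  have iun : int1 un := int1_trunc H2h M1 hM n.
  have iD : int1 (fun t => u t - un t) by exact: int1B.
  have aD := analytic_outf iD.
  have D1 z : normc z < 1 -> normc (outf (fun t => u t - un t) z) <= 1.
    move=> z1; rewrite -[leRHS]expR0; apply: outf_le => //; apply: (aeT_imp (h0)) => t _ ht.
    rewrite subr_le0; apply: ln_le_logmax; first exact: inv1_gt0.
    by rewrite normc_gt0; apply/eqP.
  have [k [Lk k1 bk]] := boundary_exists aD D1.
  have mg := L2_meas (Linfty_L2 Lg); have mk := L2_meas (Linfty_L2 Lk).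
  have ag : analytic_disc (outf un) by exact: analytic_outf.
  have bgk := boundaryM ag aD D1 (Linfty_L2 Lg) mk bg bk.
  have E : aeT o (fun t => k t * g t).
    apply: boundary_unique au mo (measurableCM mk mg) bo _.
    apply: boundary_ext bgk => z z1; rewrite -outfD//.
    by congr (outf _ z); apply/funext => t; rewrite subrK.
  have H1 := aeT_imp2 gE k1 (fun t _ a b => conj a b).
  apply: (aeT_imp2 (E) H1) => t _ -> [<- k1'].
  by rewrite normcM ler_piMl// normc_ge0.
have oh : almost_everywhereT (fun t => normc (o t) <= normc (h t)).
  apply: (aeT_imp2 (aeT_forall_nat o_le) h0) => t _ ont ht.
  have n0 : 0 < normc (h t) by rewrite normc_gt0; apply/eqP.
  have [N /(_ N (leqnn N)) hN] := inv1_small n0.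
  by have := ont N; rewrite max_l.
exists q, o; split.
- by split => //; exists Q; split => //; split => //; exists 1.
- by split => //; split => //; exists (outf u); split => //; split => //; exists M.
- exact: bq.
- have H1 := aeT_imp2 oh h0 (fun t _ a b => conj a b).
  have H2 := aeT_imp2 q1 hqo (fun t _ a b => conj a b).
  apply: (aeT_imp2 (H1) H2) => t _ [oht ht] [q1t hE].
  have n0 : 0 < normc (h t) by rewrite normc_gt0; apply/eqP.
  apply/eqP; rewrite eq_le q1t/=; have := n0; rewrite {1}hE normcM => n1.
  have E : normc (h t) = normc (o t) * normc (q t) by rewrite {1}hE normcM.
  have := normc_ge0 (o t); have := normc_ge0 (q t).
  move: E n0 oht; move: (normc _) (normc _) (normc _) => x y w; nra.
- by apply: (aeT_imp (hqo)) => t _ ->; rewrite mulrC.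
Qed.

End InnerOuter.

(** * Repeated division by an inner function, and division by an outer one *)

Section InnerIteration.
Variable R : realType.
Local Notation mu := (@lebesgue_measure R).
Local Notation C := R[i].
Local Notation circle := (@circle R).
Local Notation int1 f := (mu.-integrable circle (EFin \o f)).
Local Notation inv1 := (@inv1 R).
Implicit Types (a b f g h q o : R -> C) (u v : R -> R) (z w : C) (F G H Q : C -> C) (x e M B : R)
  (K : set (R -> C)).
Let mcircle := @measurable_circle R.
#[local] Hint Resolve mcircle : core.

Lemma rnorm2_ae_le f g : L2 f -> L2 g ->
  almost_everywhereT (fun t => normc (f t) <= normc (g t)) -> rnorm2 f <= rnorm2 g.
Proof.
move=> Lf Lg fg; rewrite -lee_fin -!sqnorm_rnorm2//.
exact: le_sqnorm (L2_meas Lf) (L2_meas Lg) fg.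
Qed.

Lemma rnorm2_le1 f : L2 f -> almost_everywhereT (fun t => normc (f t) <= 1) ->
  rnorm2 f <= pi *+ 2.
Proof.
move=> Lf f1; apply: (@le_trans _ _ (rnorm2 (fun=> 1 : C))).
  by apply: rnorm2_ae_le => //; [exact: L2_cst|apply: (aeT_imp (f1)) => t _; rewrite normc1].
have := @rnorm2_le R (fun=> 1) 1 (L2_cst 1); rewrite expr1n mulr1; apply => t.
by rewrite normc1.
Qed.

(** Equality in the maximum principle at 0: by Pythagoras, [rnorm2] of q - Q(0) is that of q minus 2
    pi |Q(0)|^2, hence at most 0. *)
Lemma ae_cst_of_at0 q Q : L2 q -> almost_everywhereT (fun t => normc (q t) <= 1) ->
  analytic_disc Q -> boundary_function Q q -> 1 <= normc (Q 0) -> aeT q (fun=> Q 0).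
Proof.
move=> Lq q1 aQ bq Q1; have Ld : L2 (fun t => q t - Q 0) by apply: L2B => //; exact: L2_cst.
suff d0 : rnorm2 (fun t => q t - Q 0) = 0.
  apply: (aeT_imp (rnorm2_eq0 Ld d0)) => t _ E.
  by apply/eqP; rewrite -subr_eq0; apply/eqP.
apply/eqP; rewrite eq_le rnorm2_ge0 andbT.
have := rnorm2_sub_cisX 0 Lq; rewrite (boundary_at0 aQ Lq bq).
have -> : (fun t => q t - Q 0 * cis t ^+ 0) = (fun t => q t - Q 0).
  by apply/funext => t; rewrite expr0 mulr1.
move=> ->; rewrite subr_le0 (le_trans (rnorm2_le1 Lq q1))//.
by rewrite ler_peMr ?(ltW (pi2_gt0 R))// expr_ge1// normc_ge0.
Qed.

Lemma H2plus_trigpoly (c : nat -> C) n : H2plus (trig c n).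
Proof.
apply/H2plus_trigP; split; first exact: L2_trig.
move=> e e0; exists n => // m /= nm.
have -> : (fun t => trig (fcoef (trig c n)) m t - trig c n t) = (fun=> 0).
  apply/funext => t; apply/eqP; rewrite subr_eq0; apply/eqP.
  rewrite -(subnKC nm); elim: (m - n)%N => [|k IH].
    by rewrite addn0; apply: eq_bigr => i _; rewrite fcoef_trig ltn_ord.
  by rewrite addnS trigS IH fcoef_trig ltnNge leq_addr mul0r addr0.
apply: le_trans (sqnorm_le_cst (measurableC_cst _) (lexx 0) _) _ => [t _|].
  by rewrite normc0.
by rewrite expr0n mulr0 lee_fin ltW.
Qed.

(** Division by the j-th power of the variable: the vanishing coefficients make the shifted partial
    sums polynomials again, and H^2 is closed. *)
Lemma H2plus_shift g j : H2plus g -> (forall i, (i < j)%N -> fcoef g i = 0) ->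
  H2plus (fun t => conjc (cis t ^+ j) * g t).
Proof.
move=> /H2plus_trigP[Lg cg] g0; set c := fcoef g in cg.
have Le : Linfty (fun t => conjc (cis t ^+ j) : C).
  apply: LinftyJ; split; first by apply: measurableCX; exact: measurableC_cis.
  by exists 1; apply: aeT_W => t _; rewrite normcX normc_cis expr1n.
have me := L2_meas (Linfty_L2 Le).
apply: (H2plus_closed (f_ := trig (fun k => c (k + j)%N))).
- by move=> n; exact: H2plus_trigpoly.
- exact: L2M_Linfty.
- have E n : trig (fun k => c (k + j)%N) n = (fun t => conjc (cis t ^+ j) * trig c (n + j) t).
    apply/funext => t; elim: n => [|n IH].
      rewrite add0n /trig big_ord0 big1 ?mulr0// => i _.
      by rewrite /c g0 ?mul0r.
    rewrite addSn !trigS IH mulrDr; congr (_ + _).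
    by rewrite exprD conjcX [RHS]mulrCA [conjc _ ^+ j * _]mulrCA -exprMn [conjc _ * _]mulrC cis_mulJ expr1n mulr1.
  move=> e e0; have [N _ HN] := cg e e0; exists N => // n /= Nn.
  have mt : measurableC (fun t => trig c (n + j) t - g t).
    by apply: measurableCB; [exact: L2_meas (L2_trig _ _)|exact: L2_meas].
  have -> : (fun t => trig (fun k => c (k + j)%N) n t - conjc (cis t ^+ j) * g t) =
      (fun t => conjc (cis t ^+ j) * (trig c (n + j) t - g t)).
    by apply/funext => t; rewrite E mulrBr.
  apply: le_trans (sqnormM_le (M := 1) me mt _) _.
    by apply: aeT_W => t _; rewrite normcJ normcX normc_cis expr1n.
  by rewrite expr1n mul1e; apply: HN; rewrite /= (leq_trans Nn)// leq_addr.
Qed.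

Lemma fcoef_shift g j : fcoef (fun t => conjc (cis t ^+ j) * g t) 0 = fcoef g j.
Proof.
rewrite /fcoef /inner; congr (_ * cintegral _); apply/funext => t.
by rewrite expr0 conjc1 mulr1 mulrC.
Qed.

(** After division by the j-th power of the variable the coefficients in question are values at 0 of
    analytic extensions, and these multiply. *)
Lemma fcoef_mul q Q f g j : Hinfty q -> analytic_disc Q -> boundary_function Q q ->
  (exists M, forall z, normc z < 1 -> normc (Q z) <= M) -> H2plus g ->
  measurableC f -> aeT f (fun t => q t * g t) ->
  (forall i, (i < j)%N -> fcoef g i = 0) -> fcoef f j = Q 0 * fcoef g j.
Proof.
move=> Hq aQ bq [M QM] Hg mf fqg g0; have Hs := H2plus_shift Hg g0.
have Lg := H2plus_L2 Hg; have mq := Hinfty_meas Hq.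
have /H2plusP[Ls [G [aG bG]]] := Hs.
have bQG := boundaryM aG aQ QM Ls mq bG bq.
have Lqs : L2 (fun t => q t * (conjc (cis t ^+ j) * g t)) by apply: L2M_Linfty => //; case: Hq.
transitivity (fcoef (fun t => q t * (conjc (cis t ^+ j) * g t)) 0).
  rewrite -(fcoef_shift f); apply: inner_aeT.
  - by apply: measurableCM => //; apply: measurableCJ; exact: L2_meas (L2_cisX _ _).
  - exact: L2_meas.
  - exact: L2_meas (L2_cisX _ _).
  - by apply: (aeT_imp (fqg)) => t _ ->; rewrite mulrCA.
by rewrite (boundary_at0 (analyticM aQ aG) Lqs bQG) -(fcoef_shift g) (boundary_at0 aG Ls bG).
Qed.

(* If the coefficients of all the functions of K vanish below m, then dividing n
   times by q bounds |fcoef f m|^2 by |Q 0|^(2n) times a constant. *)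
Lemma inner_multiples_eq0 q Q K : Hinfty q -> analytic_disc Q -> boundary_function Q q ->
  (exists M, forall z, normc z < 1 -> normc (Q z) <= M) ->
  almost_everywhereT (fun t => normc (q t) = 1) -> normc (Q 0) < 1 ->
  (forall f, K f -> H2plus f /\ exists g, K g /\ aeT f (fun t => q t * g t)) ->
  forall f, K f -> aeT f (cst 0).
Proof.
move=> Hq aQ bq QM q1 Q1 HK; have p0 := pi2_gt0 R.
suff c0 m f : K f -> fcoef f m = 0.
  move=> f Kf; have [Hf _] := HK _ Kf.
  have [Lf cf] := (H2plus_trigP _).1 Hf.
  have c0' : trig (fcoef f) = fun _ _ => 0.
    apply/funext => n; apply/funext => t; rewrite /trig big1// => i _.
    by rewrite c0// mul0r.
  rewrite c0' in cf.
  have m0 : \oo [set _ : nat | measurableC (fun=> 0 : C)].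
    by exists 0%N => // n _; exact: measurableC_cst.
  have cf0 : cvgL2 \oo (fun (_ : nat) (_ : R) => 0 : C) (cst 0).
    move=> e e0; exists 0%N => // n _; rewrite /mkset.
    have -> : (fun t : R => (0 : C) - cst 0 t) = (fun=> 0) by apply/funext => t; rewrite subr0.
    apply: le_trans (sqnorm_le_cst (measurableC_cst _) (lexx 0) _) _ => [t _|].
      by rewrite normc0.
    by rewrite expr0n mulr0 lee_fin ltW.
  exact: cvgL2_unique m0 (L2_meas Lf) (measurableC_cst _) cf cf0.
elim/ltn_ind: m f => m IH.
have step n : forall f, K f -> pi *+ 2 * normc (fcoef f m) ^+ 2 <= rnorm2 f * (normc (Q 0) ^+ 2) ^+ n.
  elim: n => [|n IHn] f Kf; have [Hf [g [Kg fqg]]] := HK _ Kf; have Lf := H2plus_L2 Hf.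
    by rewrite expr0 mulr1; exact: normc_fcoef.
  have [Hg _] := HK _ Kg; have Lg := H2plus_L2 Hg.
  rewrite (fcoef_mul Hq aQ bq QM Hg (L2_meas Lf) fqg) => [|i im]; last exact: IH.
  rewrite normcM exprMn (exprS _ n) [leLHS]mulrCA [leRHS]mulrCA.
  apply: ler_wpM2l; first exact: sqr_ge0.
  apply: le_trans (IHn _ Kg) _; apply: ler_wpM2r; first by rewrite exprn_ge0// sqr_ge0.
  apply: rnorm2_ae_le => //; apply: (aeT_imp2 (fqg) q1) => t _ -> q1t.
  by rewrite normcM q1t mul1r.
move=> f Kf; apply/eqP; rewrite -normc_eq0; apply/eqP.
have Q2 : 0 <= normc (Q 0) ^+ 2 < 1 by rewrite sqr_ge0 exprn_ilt1 ?normc_ge0.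
have h e : 0 < e -> pi *+ 2 * normc (fcoef f m) ^+ 2 <= e.
  move=> e0; have [N /(_ N (leqnn N))] := exp_cvg0 Q2 (rnorm2_ge0 f) e0.
  by apply: le_trans; exact: step.
apply/eqP; rewrite -sqrf_eq0 eq_le sqr_ge0 andbT.
rewrite -(pmulr_rle0 _ p0); apply/ler_addgt0Pr => e e0; rewrite add0r; exact: h.
Qed.

(** If |Q(0)| were at least 1, q would be the constant Q(0), and H = Q(0) outf u is the formula
    defining outer functions, with lam = Q(0). *)
Lemma not_outer_factor h : Hinfty h -> ~ outer h -> ~ aeT h (cst 0) ->
  exists q o Q, [/\ Hinfty q /\ Hinfty o, analytic_disc Q /\ boundary_function Q q,
    (exists M, forall z, normc z < 1 -> normc (Q z) <= M),
    almost_everywhereT (fun t => normc (q t) = 1) /\ normc (Q 0) < 1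
    & aeT h (fun t => q t * o t)].
Proof.
move=> Hh noh h0; have [H [M [aH bh M1 HM hM]]] := Hinfty_data Hh.
have [hn0 iu [q [ o [Hq [Ho bo] bq q1 hqo]]]] := inner_outer Hh aH bh h0.
set u := fun t => ln (normc (h t)) in iu bo bq.
pose Q z := outf (fun t => - u t) z * H z.
have aQ : analytic_disc Q by apply: analyticM => //; apply: analytic_outf; exact: int1N.
have Lq := Hinfty_L2 Hq.
have q1' : almost_everywhereT (fun t => normc (q t) <= 1).
  by apply: (aeT_imp (q1)) => t _ ->.
exists q, o, Q; split => //.
  have [_ [Q' [[aQ' [B QB]] bQ']]] := Hq; exists B => z z1.
  rewrite (boundary_disc_eq aQ aQ' Lq Lq bq bQ')//; first exact: QB.
  exact: aeT_W.
split => //; rewrite ltNge; apply/negP => Q1.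
have qE := ae_cst_of_at0 Lq q1' aQ bq Q1.
apply: noh; split => //; exists H; split => //.
have p0 := pi2_gt0 R.
have n0 : normc (Q 0) = 1.
  apply/eqP; rewrite eq_le Q1 andbT -(@ler_pXn2r _ 2) ?nnegrE ?normc_ge0// expr1n.
  rewrite -(ler_pM2l p0) mulr1 -(boundary_at0 aQ Lq bq).
  exact: le_trans (normc_fcoef 0 Lq) (rnorm2_le1 Lq q1').
exists (Q 0); split => // z z1.
have <- : Q z = Q 0.
  apply: (boundary_disc_eq aQ (analytic_cst (Q 0)) Lq (L2_cst _) bq _ qE z1).
  exact: boundary_cst.
change (H z = Q z * outf u z).
by rewrite /Q mulrAC outfN// mul1r.
Qed.

(** Common to both inclusions: K is the larger kernel, K' the one multiplied by h. The case h = 0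
    a.e. has no factorization and is treated apart: there h K' = {0}. *)
Lemma not_outer_trivial h K K' : Hinfty h -> ~ outer h ->
  (forall f, K f -> H2plus f /\ exists g, K' g /\ aeT f (fun t => h t * g t)) ->
  (forall q o g, Hinfty q -> Hinfty o -> almost_everywhereT (fun t => normc (q t) = 1) ->
    aeT h (fun t => q t * o t) -> K' g -> K (fun t => o t * g t)) ->
  forall f, K f -> aeT f (cst 0).
Proof.
move=> Hh noh KK' K'K; have [h0|h0] := EM (aeT h (cst 0)).
  move=> f /KK'[_ [g [_ fhg]]].
  by apply: (aeT_imp2 (fhg) h0) => t _ -> ->; rewrite mul0r.
have [q [ o [Q [[Hq Ho] [aQ bq] QM [q1 Q1] hqo]]]] := not_outer_factor Hh noh h0.
apply: (inner_multiples_eq0 Hq aQ bq QM q1 Q1) => f /KK'[Hf [g [K'g fhg]]].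
split => //; exists (fun t => o t * g t); split; first exact: K'K Hq Ho q1 hqo K'g.
by apply: (aeT_imp2 (fhg) hqo) => t _ -> ->; rewrite mulrA.
Qed.

(* Smirnov's theorem for the division by an outer function. *)
Lemma outer_division h f g : Hinfty h -> outer h -> H2plus f -> L2 g ->
  aeT f (fun t => h t * g t) -> H2plus g.
Proof.
move=> Hh [h0 iu [H [aH bh [lam [lam1 HE]]]]] Hf Lg fhg.
have [_ [M [_ _ M1 _ hM]]] := Hinfty_data Hh.
have H2h := Hinfty_H2plus Hh; have Lh := Hinfty_L2 Hh; have p0 := pi2_gt0 R.
pose u t := ln (normc (h t)); pose u_ n t := logmax (inv1 n) (normc (h t)).
have {}HE z : normc z < 1 -> H z = lam * outf u z by exact: HE.
have {}iu : int1 u by exact: iu.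
have iu_ n : int1 (u_ n) by exact: int1_trunc H2h M1 hM n.
have iD n : int1 (fun t => u t - u_ n t) by exact: int1B.
have uu_ n : almost_everywhereT (fun t => u t - u_ n t <= 0).
  apply: (aeT_imp (h0)) => t _ ht; rewrite subr_le0; apply: ln_le_logmax.
    exact: inv1_gt0.
  by rewrite normc_gt0; apply/eqP.
(* As h is outer, H = lam outf u, so that Q n is, up to the constant lam, the product of H and a
   bounded outer function k: the product q_n g becomes conj(lam) k f, which is in H^2 without any
   division. *)
pose Q n := outf (fun t => u t - u_ n t).
have aQ n : analytic_disc (Q n) by exact: analytic_outf.
have Q1 n z : normc z < 1 -> normc (Q n z) <= 1.
  by move=> z1; rewrite -[leRHS]expR0; apply: outf_le.
have [q_ Hq_] := choice (fun n => boundary_exists (aQ n) (Q1 n)).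
have Lq n : Linfty (q_ n) by case: (Hq_ n).
have q1 n : almost_everywhereT (fun t => normc (q_ n t) <= 1) by case: (Hq_ n).
have bq n : boundary_function (Q n) (q_ n) by case: (Hq_ n).
have L2q n := Linfty_L2 (Lq n); have mq n := L2_meas (L2q n); have mg := L2_meas Lg.
have Hqg n : H2plus (fun t => q_ n t * g t).
  have [k [Lk bk [B kB] _]] := outf_truncN H2h M1 hM n.
  have mk := L2_meas (Linfty_L2 Lk).
  have ak : analytic_disc (outf (fun t => - u_ n t)) by apply: analytic_outf; exact: int1N.
  have Hk : Hinfty k.
    by split => //; exists (outf (fun t => - u_ n t)); split => //; split => //; exists B.
  have b1 := boundaryM aH ak kB Lh mk bh bk.
  have b2 : boundary_function (fun z => lam * Q n z) (fun t => lam * q_ n t).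
    apply: (boundaryM (G := fun=> lam) (M := normc lam) (aQ n) (analytic_cst lam)) => //.
    exact: boundary_cst.
  have E : aeT (fun t => k t * h t) (fun t => lam * q_ n t).
    have Lkh : L2 (fun t => k t * h t) by exact: L2M_Linfty.
    apply: boundary_unique (analyticM (analytic_cst lam) (aQ n)) (L2_meas Lkh) _ _ b2.
      by apply: measurableCM => //; exact: measurableC_cst.
    apply: boundary_ext b1 => z z1; rewrite HE// /Q.
    rewrite (outfD (v := fun t => - u_ n t))//; last exact: int1N.
    by rewrite mulrCA [_ * outf u z]mulrC.
  have := H2plusZ (conjc lam) (H2plusM_Hinfty Hk Hf); apply: H2plus_aeT.
    exact: measurableCM.
  apply: (aeT_imp2 (fhg) E) => t _ -> Et.
  by rewrite (mulrA (k t)) Et !mulrA [conjc lam * lam]mulrC mulcJ lam1 expr1n mul1r.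
apply: (H2plus_closed Hqg Lg).
(* As |q_n - 1| <= 2, convergence of q_n to 1 in mean square is enough for q_n g -> g, even for
   unbounded g. *)
suff c1 : cvgL2 \oo (fun n t => q_ n t - 1) (cst 0).
  have HW : \oo [set n | measurableC (fun t => q_ n t - 1) /\
      almost_everywhereT (fun t => normc (q_ n t - 1) <= 2)].
    exists 0%N => // n _; split.
      by apply: measurableCB => //; exact: measurableC_cst.
    apply: (aeT_imp (q1 n)) => t _ q1t; apply: (le_trans (normc_triangle (q_ n t) (- 1))).
    by rewrite normcN normc1; move: q1t; lra.
  have c2 : cvgL2 \oo (fun n t => (q_ n t - 1) * g t) (cst 0).
    exact: cvgL2_truncation HW Lg c1.
  apply: (cvgL2_le (k := 1)) c2 => //; exists 0%N => // n _; rewrite /mkset mul1e.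
  have -> : (fun t => q_ n t * g t - g t) = (fun t => (q_ n t - 1) * g t - cst 0 t) => //.
  by apply/funext => t; rewrite mulrBl mul1r subr0.
move=> e e0; have [N HN] := logmax_cvg_L1 (L2_meas Lh) M1 hM h0 iu (divr_gt0 e0 (ltr0Sn _ 3)).
exists N => // n Nn; rewrite /mkset.
pose r := (pi *+ 2)^-1 * \int[mu]_(t in circle) (u t - u_ n t).
(* The mean of q_n is the positive real x <= 1, so |q_n| <= 1 and Pythagoras give that [rnorm2] of
   q_n - x is at most 2 pi (1 - x^2): it suffices that x -> 1. The final bound is 2 P (1 - x^2) + 2
   P (1 - x)^2 = 4 P (1 - x) <= - 4 P r with P = 2 pi, whence the choice of e / 4. *)
pose x := expR r; have Qx : Q n 0 = x%:C%C by rewrite /Q /outf herg0 cexp_real.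
have x0 : 0 < x := expR_gt0 r.
have x1 : x <= 1.
  by have := Q1 n 0; rewrite Qx normc0 normcR gtr0_norm// => /(_ ltr01).
have rx : - (e / 4) <= pi *+ 2 * r.
  rewrite /r mulrA divff ?gt_eqF// mul1r lerNl; apply: le_trans (HN n Nn).
  apply: le_trans (ler_norm _) _; rewrite normrN; apply: (le_trans (@le_normr_Rintegral _ _ _ mu _ _ mcircle (iD n))).
  by apply: le_Rint => //; [exact: int1_norm|exact: int1_norm (int1B (iu_ n) iu)|
    apply: aeT_W => t _; rewrite distrC].
have rx' : 1 + r <= x := expR_ge1Dx r.
have h1 : (sqnorm (fun t => q_ n t - x%:C%C)%R <= (pi *+ 2 * (1 - x ^+ 2))%:E)%E.
  rewrite sqnorm_rnorm2; last by apply: L2B => //; exact: L2_cst.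
  have := rnorm2_sub_cisX 0 (L2q n); rewrite (boundary_at0 (aQ n) (L2q n) (bq n)) Qx.
  have -> : (fun t => q_ n t - x%:C%C * cis t ^+ 0) = (fun t => q_ n t - x%:C%C).
    by apply/funext => t; rewrite expr0 mulr1.
  move=> ->; rewrite lee_fin normcR (gtr0_norm x0) mulrBr mulr1 lerB//.
  exact: rnorm2_le1.
have h2 : (sqnorm (fun _ : R => x%:C%C - 1 : C)%R <= (pi *+ 2 * (1 - x) ^+ 2)%:E)%E.
  apply: sqnorm_le_cst; [exact: measurableC_cst|by rewrite subr_ge0|move=> t _].
  by rewrite realCB normcR distrC ger0_norm// subr_ge0.
have -> : (fun t => q_ n t - 1 - cst 0 t) = (fun t => q_ n t - 1).
  by apply/funext => t; rewrite subr0.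
apply: le_trans (sqnorm_triangle (mq n) (measurableC_cst x%:C%C) (measurableC_cst 1)) _.
apply: (@le_trans _ _ (2%:E * (pi *+ 2 * (1 - x ^+ 2))%:E + 2%:E * (pi *+ 2 * (1 - x) ^+ 2)%:E)%E).
  by apply: leeD; apply: lee_wpmul2l.
rewrite -!EFinM -EFinD lee_fin; move: p0 rx rx' x1; move: (pi *+ 2) => P p0 rx rx' x1.
have : P * r <= P * (x - 1) by rewrite ler_pM2l//; lra.
by nra.
Qed.

End InnerIteration.

(** * Inclusions and equalities between the kernels *)

Section Kernels.
Variable R : realType.
Local Notation C := R[i].
Implicit Types (a b f g h : R -> C).

Lemma mulset_kerplus_l a b h : Hinfty h ->
  mulset h (kerplus (fun t => a t * h t) b) `<=` kerplus a b.
Proof.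
move=> Hh f [Lf [g [/kerplusP[Hg [m [Hm E]]] fhg]]]; apply/kerplusP; split.
  by apply: H2plus_aeT (H2plusM_Hinfty Hh Hg); [exact: L2_meas|exact: aeT_sym].
exists m; split => //; apply: (aeT_imp2 (fhg) E) => t _ -> <-.
by rewrite mulrA.
Qed.

Lemma mulset_kerplus_r a b h : Hinfty h ->
  mulset h (kerplus a b) `<=` kerplus a (fun t => b t * h t).
Proof.
move=> Hh f [Lf [g [/kerplusP[Hg [m [Hm E]]] fhg]]]; apply/kerplusP; split.
  by apply: H2plus_aeT (H2plusM_Hinfty Hh Hg); [exact: L2_meas|exact: aeT_sym].
exists m; split => //; apply: (aeT_imp2 (fhg) E) => t _ -> Et.
have -> : a t * (h t * g t) + b t * h t * m t = h t * (a t * g t + b t * m t) by ring.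
by rewrite Et /cst mulr0.
Qed.

Lemma kerplus_mulset_l a b h : almost_everywhereT (fun t => a t <> 0) -> Hinfty h ->
  GHinfty h \/ outer h /\ Linfty (fun t => b t / (a t * h t)) ->
  kerplus a b `<=` mulset h (kerplus (fun t => a t * h t) b).
Proof.
move=> a0 Hh HG f /kerplusP[Hf [m [Hm E]]]; split; first exact: H2plus_L2.
case: HG => [[_ [g [Hg hg]]]|[Oh Lq]].
  exists (fun t => g t * f t); split; last first.
    by apply: (aeT_imp (hg)) => t _ hgt; rewrite mulrA hgt mul1r.
  apply/kerplusP; split; first exact: H2plusM_Hinfty.
  exists m; split => //; apply: (aeT_imp2 (hg) E) => t _ hgt <-.
  by rewrite -(mulrA (a t)) (mulrA (h t)) hgt mul1r.
have [h0 _ _] := Oh; have ah0 := aeT_imp2 a0 h0 (fun t _ x y => conj x y).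
(* This is f / h, by the equation a f + b m = 0, written as a bounded function times an element of
   L^2. *)
pose g t := - (b t / (a t * h t) * m t).
have Lg : L2 g by apply: L2N; apply: L2M_Linfty => //; exact: H2minus_L2.
have fhg : aeT f (fun t => h t * g t).
  apply: (aeT_imp2 (ah0) E) => t _ [/eqP at0 /eqP ht0] Et.
  have bm : b t * m t = - (a t * f t) by apply/eqP; rewrite -addr_eq0 addrC Et.
  by rewrite /g mulrAC bm; field; rewrite at0 ht0.
exists g; split => //; apply/kerplusP; split; first exact: outer_division Hh Oh Hf Lg fhg.
exists m; split => //; apply: (aeT_imp2 (fhg) E) => t _ ft.
by rewrite ft mulrA.
Qed.

Lemma kerplus_mulset_r a b h : almost_everywhereT (fun t => a t <> 0) -> Hinfty h ->
  GHinfty h \/ outer h /\ Linfty (fun t => b t / a t) ->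
  kerplus a (fun t => b t * h t) `<=` mulset h (kerplus a b).
Proof.
move=> a0 Hh HG f /kerplusP[Hf [m [Hm E]]]; split; first exact: H2plus_L2.
case: HG => [[_ [g [Hg hg]]]|[Oh Lq]].
  exists (fun t => g t * f t); split; last first.
    by apply: (aeT_imp (hg)) => t _ hgt; rewrite mulrA hgt mul1r.
  apply/kerplusP; split; first exact: H2plusM_Hinfty.
  exists m; split => //; apply: (aeT_imp2 (hg) E) => t _ hgt Et.
  (* The equation of f multiplied by g = 1 / h, up to a multiple of 1 - h g. *)
  have -> : a t * (g t * f t) + b t * m t =
    g t * (a t * f t + b t * h t * m t) + b t * m t * (1 - h t * g t) by ring.
  by rewrite Et hgt /cst subrr !mulr0 addr0.
(* Again f / h, now from a f + b h m = 0; the equation a g + b m = 0 then holds by construction. *)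
pose g t := - (b t / a t * m t).
have Lg : L2 g by apply: L2N; apply: L2M_Linfty => //; exact: H2minus_L2.
have fhg : aeT f (fun t => h t * g t).
  apply: (aeT_imp2 (a0) E) => t _ /eqP at0 Et.
  have bm : a t * f t = - (b t * h t * m t) by apply/eqP; rewrite -addr_eq0 Et.
  by apply: (mulfI at0); rewrite bm /g; field.
exists g; split => //; apply/kerplusP; split; first exact: outer_division Hh Oh Hf Lg fhg.
exists m; split => //; apply: (aeT_imp (a0)) => t _ /eqP at0.
by rewrite /g /cst; field.
Qed.

Lemma not_outer_kerplus_l a b h : Hinfty h -> ~ outer h ->
  kerplus a b `<=` mulset h (kerplus (fun t => a t * h t) b) ->
  forall f, kerplus a b f -> aeT f (cst 0).
Proof.
move=> Hh noh sub; apply: (not_outer_trivial (K' := kerplus (fun t => a t * h t) b) Hh noh) =>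
  [f Kf|q o g Hq Ho q1 hqo].
  by split; [have /kerplusP[] := Kf|have [] := sub f Kf].
move=> /kerplusP[Hg [m [Hm E]]]; apply/kerplusP; split; first exact: H2plusM_Hinfty.
exists (fun t => conjc (q t) * m t); split; first exact: H2minusM_conj.
have H := aeT_imp2 q1 hqo (fun t _ x y => conj x y).
apply: (aeT_imp2 (H) E) => t _ [q1t ht] Et.
have qq : q t * conjc (q t) = 1 by rewrite mulcJ q1t expr1n.
(* Modulo |q|^2 = 1, this is conj(q) times the equation of g, because conj(q) h = o. *)
have -> : a t * (o t * g t) + b t * (conjc (q t) * m t) =
    conjc (q t) * (a t * h t * g t + b t * m t) + a t * o t * g t * (1 - q t * conjc (q t)).
  by rewrite ht; ring.
by rewrite Et qq /cst subrr !mulr0 addr0.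
Qed.

Lemma not_outer_kerplus_r a b h : Hinfty h -> ~ outer h ->
  kerplus a (fun t => b t * h t) `<=` mulset h (kerplus a b) ->
  forall f, kerplus a (fun t => b t * h t) f -> aeT f (cst 0).
Proof.
move=> Hh noh sub; apply: (not_outer_trivial (K' := kerplus a b) Hh noh) =>
  [f Kf|q o g Hq Ho q1 hqo].
  by split; [have /kerplusP[] := Kf|have [] := sub f Kf].
move=> /kerplusP[Hg [m [Hm E]]]; apply/kerplusP; split; first exact: H2plusM_Hinfty.
exists (fun t => conjc (q t) * m t); split; first exact: H2minusM_conj.
have H := aeT_imp2 q1 hqo (fun t _ x y => conj x y).
apply: (aeT_imp2 (H) E) => t _ [q1t ht] Et.
have qq : q t * conjc (q t) = 1 by rewrite mulcJ q1t expr1n.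
(* Here the equation of g is multiplied by o: the factor h of the second symbol absorbs conj(q),
   again by conj(q) h = o. *)
have -> : a t * (o t * g t) + b t * h t * (conjc (q t) * m t) =
    o t * (a t * g t + b t * m t) - b t * o t * m t * (1 - q t * conjc (q t)).
  by rewrite ht; ring.
by rewrite Et qq /cst subrr !mulr0 subr0.
Qed.

End Kernels.

Theorem proposition3p7 (R : realType) (a b h : R -> R[i])
    (La : Linfty a) (Lb : Linfty b)
    (a_neq0 : almost_everywhereT (fun t => a t <> 0))
    (b_neq0 : almost_everywhereT (fun t => b t <> 0))
    (ab : aeT a b \/ almost_everywhereT (fun t => a t - b t <> 0))
    (Hh : Hinfty h) :
  let ah := fun t => a t * h t in
  let bh := fun t => b t * h t in
  [/\ (mulset h (kerplus ah b) `<=` kerplus a b /\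
       mulset h (kerplus a b) `<=` kerplus a bh),
      (GHinfty h \/ (outer h /\ Linfty (fun t => b t / ah t)) ->
       mulset h (kerplus ah b) = kerplus a b),
      (GHinfty h \/ (outer h /\ Linfty (fun t => b t / a t)) ->
       mulset h (kerplus a b) = kerplus a bh)
    & (* when the larger set is trivial, both sides are equal to {0} *)
      (~ outer h ->
       (nontrivial (kerplus a b) ->
        mulset h (kerplus ah b) `<` kerplus a b) /\
       (nontrivial (kerplus a bh) ->
        mulset h (kerplus a b) `<` kerplus a bh))].
Proof.
move=> ah bh; have sl := mulset_kerplus_l (a := a) (b := b) Hh.
have sr := mulset_kerplus_r (a := a) (b := b) Hh.
split => //.
- by move=> H; apply/seteqP; split => //; exact: kerplus_mulset_l.
- by move=> H; apply/seteqP; split => //; exact: kerplus_mulset_r.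
(* A strict inclusion is an inclusion whose converse fails; the converse [sub] would make every
   element of the larger kernel, in particular the nonzero f, vanish almost everywhere. *)
- move=> noh; split=> -[f [Kf f0]]; split => // sub; apply: f0.
  + exact: (not_outer_kerplus_l Hh noh sub).
  + exact: (not_outer_kerplus_r Hh noh sub).
Qed.
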